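(* Let $r_0, r_d, d \in \mathbb{Z}_{>0}$ and let $s \geq r_0(d r_d + 1) + r_d + 1$ be an integer. Let $\mathbf{r} = (r_0, 0, 0, \dotsc, 0, r_d)$ be a $(d+1)$-tuple. Then for all integers $a$ sufficiently large, setting $T = T^a_{\mathbf{r}}$ and $q = \Sigma_T(s)$, the following holds: for every $\varepsilon>0$ there exist $\delta>0$ and $n_0$ such that every $(s,q)$-graph $G$ on $n\ge n_0$ vertices with $P(G) \geq \Pi_{T}(n)^{1-\delta}$ is within edit distance $\varepsilon n^2$ of some product-maximising blow-up of $T$ on the same vertex set (that is, a blow-up $G^*$ of $T$ with $P(G^* )=\Pi_T(n)$).
   Context: A multigraph $G=(V,w)$ is a finite vertex set $V$ together with $w\colon\binom{V}{2}\to\mathbb{Z}_{\ge0}$. For $X\subseteq V$, $e(X)=\sum_{uv\in\binom X2}w(uv)$, $P(X)=\prod_{uv\in\binom X2}w(uv)$, $e(G)=e(V)$, $P(G)=P(V)$. $G$ is an $(s,q)$-graph if $e(X)\le q$ for every $s$-set $X\subseteq V$. The edit distance between two multigraphs on the same vertex set is the number of pairs whose multiplicities differ. A pattern $P$ on a finite set $V(P)$ assigns non-negative integer multiplicities $P(\{v\})$ to vertices (loops) and $P(\{u,v\})$ to pairs. A blow-up of $P$ on an $n$-element vertex set $V$ is a multigraph on $V$ with a map $f\colon V\to V(P)$ (not necessarily surjective) such that $w(vv')=P(\{f(v),f(v')\})$ for all distinct $v,v'$ (a loop multiplicity if $f(v)=f(v')$). $\Sigma_P(n)$ and $\Pi_P(n)$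 are the maximum of $e(G)$ and of $P(G)$, respectively, over blow-ups $G$ of $P$ on $n$ vertices. Generalised Turán pattern: for a $(d+1)$-tuple $\mathbf{r}=(r_0,\dots,r_d)$ of non-negative integers with $r_0,r_d>0$ and integer $a$, with $R=\sum_ir_i$, $T^a_{\mathbf{r}}$ is the pattern on $[R]$ where for $v$ with $\sum_{i<j}r_i<v\le\sum_{i\le j}r_i$ the loop at $v$ has multiplicity $a-j$ and each pair $\{v,v'\}$ with $v<v'\le R$ has multiplicity $a-j+1$. *)

(* Defs.v *)
From mathcomp Require Import all_boot.

Set Implicit Arguments.
Unset Strict Implicit.
Unset Printing Implicit Defensive.

(* The multiplicity of a pair uv is w [set u; v].  Values of w outside the
   2-element sets are irrelevant: no definition below depends on them. *)
Definition multigraph (V : finType) := {set V} -> nat.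

Definition pairs (V : finType) (X : {set V}) : {set {set V}} :=
  [set B : {set V} | (B \subset X) && (#|B| == 2)].

Definition edge_sum (V : finType) (w : multigraph V) (X : {set V}) : nat :=
  \sum_(B in pairs X) w B.

Definition edge_prod (V : finType) (w : multigraph V) (X : {set V}) : nat :=
  \prod_(B in pairs X) w B.

Definition sq_graph (s q : nat) (V : finType) (w : multigraph V) : Prop :=
  forall X : {set V}, #|X| = s -> edge_sum w X <= q.

Definition edit_distance (V : finType) (w1 w2 : multigraph V) : nat :=
  #|[set B in pairs [set: V] | w1 B != w2 B]|.

(* P [set u] is the multiplicity of the loop at u and P [set u; v], for u != v,
   that of the pair uv; other values are irrelevant. *)
Definition pattern (U : finType) := {set U} -> nat.

Definition is_blowup (U : finType) (P : pattern U) (V : finType)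
    (w : multigraph V) : Prop :=
  exists f : V -> U,
    forall v v', v != v' -> w [set v; v'] = P [set f v; f v'].

(* On a pair [set v; v'] this is P [set f v; f v'], as [set x; x] = [set x]. *)
Definition blowup (U : finType) (P : pattern U) (V : finType) (f : V -> U) :
    multigraph V :=
  fun B => P (f @: B).

Lemma blowupP (U : finType) (P : pattern U) (V : finType) (f : V -> U) :
  is_blowup P (blowup P f).
Proof. by exists f => v v' _; rewrite /blowup imsetU1 imset_set1. Qed.

Definition sigma_max (U : finType) (P : pattern U) (n : nat) : nat :=
  \max_(f : {ffun 'I_n -> U}) edge_sum (blowup P f) [set: 'I_n].

Definition pi_max (U : finType) (P : pattern U) (n : nat) : nat :=
  \max_(f : {ffun 'I_n -> U}) edge_prod (blowup P f) [set: 'I_n].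

(* Positions are counted from 0, so the position v corresponds to the vertex
   v + 1 of {1, ..., sumn r}; see turan_levelP. *)
Definition turan_level (r : seq nat) (v : nat) : nat := reshape_index r v.

Lemma turan_levelP (r : seq nat) (v j : nat) : v < sumn r ->
  (turan_level r v == j) =
  (j < size r) && (sumn (take j r) < v.+1 <= sumn (take j.+1 r)).
Proof.
rewrite /turan_level /reshape_index.
elim: r v j => [|n r IHr] v j //= lt_v; rewrite subn_eq0.
case: (ltnP v n) => [lt_vn|le_nv].
  case: j => [|j] /=; first by rewrite take0 addn0 lt_vn.
  symmetry; apply/negbTE; rewrite negb_and negb_and -!leqNgt.
  by rewrite (leq_trans lt_vn) ?leq_addr ?orbT.
case: j => [|j] /=; first by rewrite take0 addn0 ltnNge le_nv.
have lt_vn : v - n < sumn r by rewrite ltn_subLR.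
by rewrite subSn // eqSS IHr // ltnS [j.+1 < _]ltnS leq_subRL // ltn_subLR.
Qed.

(* The multiplicity of a loop or pair B is determined by the level j of its
   smallest vertex: it is a - j for a loop and a - j + 1 for a pair.  The
   subtraction is truncated, which only matters for a < d, where d + 1 is the
   length of r; there the pattern is not defined. *)
Definition turan_pattern (r : seq nat) (a : nat) : pattern 'I_(sumn r) :=
  fun B =>
    if [pick v in B | [forall u in B, v <= u]] is Some v
    then a - turan_level r v + (#|B| == 2) else 0.

Lemma turan_pattern_loop (r : seq nat) (a : nat) (v : 'I_(sumn r)) :
  turan_pattern a [set v] = a - turan_level r v.
Proof.
rewrite /turan_pattern; case: pickP => [u /andP[/set1P-> _]|/(_ v)].
  by rewrite cards1 addn0.
rewrite set11 /= => /negbT/negP[].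
by apply/forall_inP => u /set1P->.
Qed.

Lemma turan_pattern_pair (r : seq nat) (a : nat) (v v' : 'I_(sumn r)) :
  v < v' -> turan_pattern a [set v; v'] = a - turan_level r v + 1.
Proof.
move=> lt_vv'; rewrite /turan_pattern.
have neq : v != v' by apply: contraTneq lt_vv' => ->; rewrite ltnn.
case: pickP => [u /andP[/set2P[]-> /forall_inP le_u]|/(_ v)].
- by rewrite cards2 neq.
- by have := le_u v (set21 _ _); rewrite leqNgt lt_vv'.
rewrite set21 /= => /negbT/negP[].
by apply/forall_inP => u /set2P[]->; rewrite // ltnW.
Qed.

(* Main.v *)
(** Write a multiplicity as [a + 1 - c] and measure a pair by its deficiency [c],
    or, for products, by its loss [ln ((a + 1) / (a + 1 - c)) / ln ((a + 1) / a)],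
    which is at least [c] and close to it for large [a].  By LP duality the bound
    [e(X) <= Sigma_T(k)] on k-sets is the family, over all [th], of the linear
    bounds [2 th k <= 2 def(X) + r0 th (th + 1) + 2 h(th)].

    Let all loss degrees in the (s, q)-graph be at most [lam n] up to a small
    error, where [lam] is the loss density of the best blow-up.  If some (k-1)-set
    violated its bound, every other vertex would be too deficient towards it; so
    all bounds for [k <= s] hold.  By the same averaging there is a set [Z] of
    size [r0 I + rd - 1], [I = d rd + 1], attaining its bound.  The vertices of
    least possible deficiency [I - 1] to [Z] form a full part of level 0: adding
    one of them to [Z], almost all vertices have deficiency exactly [I] to the
    result, hence deficiency 1 or 0 to the added vertex according to whether they
    are in that part.  Removing the part lowers [r0], and induction produces a
    copy of the blow-up with large parts of level 0 and single vertices at level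
    [d].  Averaged over this copy with the optimal weights, every vertex has loss
    at least [lam], with a gap unless it looks exactly like a vertex of the
    pattern.  So almost all vertices do, two of them have at least the deficiency
    prescribed by the pattern, and comparison with the quadratic form of the
    pattern, which is positive definite, bounds both the number of wrong pairs
    and the deviation of the part sizes.  High degree vertices are removed
    beforehand, one at a time. *)

Require Import Defs.
From mathcomp Require Import all_boot all_order all_algebra.
From mathcomp Require Import reals exp.
From mathcomp Require Import perm zify ring lra.

Set Implicit Arguments.
Unset Strict Implicit.
Unset Printing Implicit Defensive.

Import Order.TTheory GRing.Theory Num.Theory.

(** * Deficiencies at level d and their Legendre dual *)

(** What shapes the proof is the order of the choices. Put M = r0 I + rd. As [a] grows, [lam] tends
    to I / M from above. The structural steps compare integers with multiples of I / M, where a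
    strict inequality leaves a gap of 1 / M; they tolerate loss degrees slightly above I / M, by an
    amount independent of [a]. So the skeleton size t is fixed first, then the precision K, then [a]
    so large that [lam] is within tolerance, and only then [eps], [delta] and [n0]. The bound q =
    Sigma_T(s) grows with [a], but enters only errors of lower order in n.

    The threshold for s is M + 1: a tight set of size M - 1, one vertex of its star, and the vertex
    tested against both.

    Multiplicities above a + 1 have negative loss and are excluded only once the bounds have
    descended to k = 2. Hence the bounds are first stated for multiplicities ([wcons]) and for
    truncated deficiencies ([sparse]) only afterwards.

    To see that few vertices are pruned, the loss of what remains must be bounded below. This is
    [rsum_lower], valid for every set of vertices and obtained from the same structure. *)

Section Costs.
Variables (rd d : nat).
Hypotheses (rd_gt0 : 0 < rd) (d_gt0 : 0 < d).

(** The I of the overview: d (rd - 1) + (d + 1), the deficiency of a level d vertex to one vertex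
    from each part of level d. In the limit of large [a] it is also the ratio of the optimal part
    sizes at levels 0 and d. *)
Definition lvl := d * rd + 1.

(* The cheapest i-th vertex at level d has deficiency [i * lvl %/ rd] to the
   previous ones; [slots j], a rounded up quotient, counts the i for which this
   is at most j. *)
Definition slots (j : nat) := ((j.+1 * rd).-1 %/ lvl).+1.

(** The h of the overview: the conjugate of the cost of Y vertices at level d, which is the sum of
    [i * lvl %/ rd] over i < Y, built from its slopes [slots]. *)
Definition dualB (th : nat) := \sum_(j < th) slots j.

Lemma lvl_gt0 : 0 < lvl. Proof. by rewrite /lvl addn1. Qed.

Lemma leq_lvl : d <= lvl.
Proof. by rewrite /lvl addn1 leqW // leq_pmulr. Qed.

Lemma slots_leq j k : (slots j <= k) = (j.+1 * rd <= k * lvl).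
Proof.
rewrite /slots ltn_divLR ?lvl_gt0 //.
have : 0 < j.+1 * rd by rewrite muln_gt0.
by case: (j.+1 * rd).
Qed.

Lemma dualBS th : dualB th.+1 = dualB th + slots th.
Proof. by rewrite /dualB big_ord_recr. Qed.

Lemma slots_small j : j < d -> slots j = 1.
Proof.
move=> ltjd; apply/eqP; rewrite eqn_leq slots_leq mul1n /lvl.
by rewrite andbT addn1 leqW // leq_mul2r ltjd orbT.
Qed.

Lemma dualB_small th : th <= d -> dualB th = th.
Proof.
elim: th => [|th IH] le_d; first by rewrite /dualB big_ord0.
by rewrite dualBS IH ?(ltnW le_d) // slots_small // addn1.
Qed.

Lemma slots_top : slots lvl.-1 = rd.
Proof.
have e : lvl.-1.+1 = lvl by rewrite prednK ?lvl_gt0.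
apply/eqP; rewrite eqn_leq slots_leq e mulnC leqnn /=.
have s := slots_leq lvl.-1 rd.-1; rewrite e in s.
rewrite -[rd in rd <= _](prednK rd_gt0) ltnNge s -ltnNge mulnC.
by rewrite ltn_pmul2l ?lvl_gt0 // prednK.
Qed.

Lemma slots_le_rd j : j < lvl -> slots j <= rd.
Proof. by move=> lt; rewrite slots_leq mulnC leq_mul2l lt orbT. Qed.

Lemma slots_le_div j : slots j <= (j %/ d).+1.
Proof.
rewrite slots_leq /lvl; have := divn_eq j d; have := ltn_pmod j d_gt0.
move: (j %/ d) (j %% d) => q m lt_m ->.
nia.
Qed.

Lemma dualB_mul k : 2 * dualB (d * k) <= d * k * k.+1.
Proof.
elim: k => [|k IH]; first by rewrite muln0 /dualB big_ord0.
have aux i : i <= d -> dualB (d * k + i) <= dualB (d * k) + i * k.+1.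
  elim: i => [|i IHi] lei; first by rewrite addn0 mul0n addn0.
  rewrite addnS dualBS mulSnr addnA; apply: leq_add; first exact: (IHi (ltnW lei)).
  apply: leq_trans (slots_le_div _) _.
  by rewrite ltnS mulnC divnMDl // divn_small // addn0.
have := aux d (leqnn d); rewrite mulnSr; nia.
Qed.

(** Reverse of the conjugate inequality at slope I, attained by [rd] vertices with pairwise
    deficiency d, as in the set B of a skeleton. [dualB_mul] at [k = rd] handles all slots but the
    last, which is [rd]. *)
Lemma dualB_lvl : 2 * dualB lvl + d * rd * rd.-1 <= 2 * rd * lvl.
Proof.
have := dualB_mul rd; have := slots_top.
rewrite /lvl addn1 dualBS /= => ->.
case: rd rd_gt0 => // k _ /=; nia.
Qed.

Lemma dualB_pred : dualB lvl = dualB lvl.-1 + rd.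
Proof. by rewrite -{1}(prednK lvl_gt0) dualBS slots_top. Qed.

Lemma sum_ltn_le n m : \sum_(j < n) (j < m) <= m.
Proof.
suff -> : \sum_(j < n) (j < m) = minn n m by exact: geq_minr.
elim: n => [|n IH]; first by rewrite big_ord0 min0n.
rewrite big_ord_recr /= IH; case: ltnP; lia.
Qed.

(* Lattice points of a Y by th rectangle, split by the line [i lvl = (j + 1) rd]. *)
Lemma dualB_lattice th Y : th * Y <= \sum_(i < Y) (i * lvl %/ rd) + dualB th.
Proof.
have -> : th * Y = \sum_(i < Y) \sum_(j < th) 1.
  by under eq_bigr do rewrite sum1_card card_ord; rewrite sum_nat_const card_ord mulnC.
have le1 : \sum_(i < Y) \sum_(j < th) 1 <=
  \sum_(i < Y) \sum_(j < th) (j < i * lvl %/ rd) +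
  \sum_(i < Y) \sum_(j < th) (i < slots j).
  rewrite -big_split; apply: leq_sum => i _ /=.
  rewrite -big_split; apply: leq_sum => j _ /=.
  have -> : (i < slots j) = ~~ (j.+1 * rd <= i * lvl) by rewrite ltnNge slots_leq.
  by rewrite leq_divRL //; case: (j.+1 * rd <= _).
apply: leq_trans le1 _; rewrite [X in _ + X]exchange_big /=.
apply: leq_add; first by apply: leq_sum => i _; exact: sum_ltn_le.
by apply: leq_sum => j _; exact: sum_ltn_le.
Qed.

(** Filling [rd] parts in rotation, the i-th point meets [i %/ rd] earlier ones in its part. *)
Lemma sum_div2 Y :
  2 * (\sum_(i < Y) (i %/ rd)) + rd * (Y %/ rd) * (Y %/ rd).+1 = 2 * (Y %/ rd) * Y.
Proof.
elim: Y => [|Y IH]; first by rewrite big_ord0 div0n !muln0.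
rewrite big_ord_recr /= mulnDr.
have [lt|e] : Y %% rd < rd.-1 \/ Y %% rd = rd.-1.
  by have := ltn_pmod Y rd_gt0; move: (Y %% rd) => m; lia.
  have e : Y.+1 %/ rd = Y %/ rd.
    rewrite {1}(divn_eq Y rd) -addnS divnMDl // [(Y %% rd).+1 %/ rd]divn_small ?addn0 //.
    by move: (Y %% rd) lt => m; lia.
  by rewrite e addnAC IH mulnSr.
have e2 : Y.+1 = (Y %/ rd).+1 * rd.
  by rewrite {1}(divn_eq Y rd) e -addnS prednK // mulSnr.
have e3 : Y.+1 %/ rd = (Y %/ rd).+1 by rewrite e2 mulnK.
rewrite e3; move: (\sum_(i < Y) _) (Y %/ rd) e2 IH => S p e2 IH.
have -> : 2 * p.+1 * Y.+1 = 2 * p * Y + (2 * p + 2 * Y.+1) by lia.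
rewrite -IH e2; lia.
Qed.

Lemma sum_lvl_div Y :
  2 * (\sum_(i < Y) (i * lvl %/ rd)) =
  d * Y * Y.-1 + 2 * \sum_(i < Y) (i %/ rd).
Proof.
have e i : i * lvl %/ rd = d * i + i %/ rd.
  by rewrite /lvl mulnDr muln1 mulnCA mulnA divnMDl // mulnC.
under eq_bigr do rewrite e.
rewrite big_split mulnDr; congr (_ + _) => /=.
elim: Y => [|Y IH]; first by rewrite big_ord0 !muln0.
rewrite big_ord_recr mulnDr IH /=; case: Y {IH} => [|Y]; nia.
Qed.

(** An even split is cheapest: with p = Y %/ rd, every part satisfies (n b - p) (n b - p - 1) >= 0,
    and the sum over the parts is compared with [sum_div2]. *)
Lemma dualB_blowup (B : finType) (n : B -> nat) th : #|B| = rd ->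
  2 * th * (\sum_b n b) <=
  d * (\sum_b n b) * (\sum_b n b).-1 + \sum_b n b * (n b).-1 + 2 * dualB th.
Proof.
move=> cB; set Y := \sum_b n b.
have := dualB_lattice th Y; have := sum_lvl_div Y; have := sum_div2 Y.
set p := Y %/ rd.
have : 2 * p * Y <= \sum_b n b * (n b).-1 + rd * p * p.+1.
  have -> : rd * p * p.+1 = \sum_(b : B) p * p.+1.
    by rewrite sum_nat_const cB mulnA.
  rewrite /Y -big_split big_distrr; apply: leq_sum => b _ /=.
  case: (n b) => [|m]; first by rewrite muln0.
  case: (leqP p m) => [/subnK <-|/subnK <-]; move: (_ - _) => k /=; lia.
rewrite -/Y => {}h1 h2 h3 h4; lia.
Qed.
End Costs.

(** * Skeletons: copies of the blow-up in sparse graphs *)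

Section Deficiency.
Variables (V : finType) (c : V -> V -> nat).
Hypotheses (csym : forall x y, c x y = c y x) (c0 : forall x, c x x = 0).
Implicit Types (X Y W A B : {set V}) (u v x y : V).

Definition deg v X := \sum_(x in X) c v x.

Definition dsum X := \sum_(x in X) deg x X.

Lemma sum_setU (F : V -> nat) X Y : [disjoint X & Y] ->
  \sum_(x in X :|: Y) F x = \sum_(x in X) F x + \sum_(x in Y) F x.
Proof.
by move=> XY; rewrite -bigU //; apply: eq_bigl => x; rewrite !inE.
Qed.

Lemma deg_setU v X Y : [disjoint X & Y] -> deg v (X :|: Y) = deg v X + deg v Y.
Proof. by move=> XY; rewrite /deg sum_setU. Qed.

Lemma deg_setU1 v x X : x \notin X -> deg v (x |: X) = c v x + deg v X.
Proof. by move=> xX; rewrite /deg big_setU1. Qed.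

Lemma deg1 v x : deg v [set x] = c v x.
Proof. by rewrite /deg big_set1. Qed.

Lemma deg_const v X e : {in X, forall x, c v x = e} -> deg v X = #|X| * e.
Proof. by move=> cX; rewrite /deg (eq_bigr (fun=> e)) ?sum_nat_const. Qed.

Lemma leq_deg v X Y : X \subset Y -> deg v X <= deg v Y.
Proof.
by move=> XY; rewrite /deg [leqRHS](big_setID X) /= (setIidPr XY) leq_addr.
Qed.

Lemma sum_deg X Y : \sum_(x in X) deg x Y = \sum_(y in Y) deg y X.
Proof.
rewrite exchange_big /=; apply: eq_bigr => y _; apply: eq_bigr => x _.
exact: csym.
Qed.

Lemma dsumU X Y : [disjoint X & Y] ->
  dsum (X :|: Y) = dsum X + dsum Y + 2 * \sum_(x in X) deg x Y.
Proof.
move=> XY; rewrite /dsum sum_setU //=.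
under eq_bigr do rewrite deg_setU //.
under [X in _ + X]eq_bigr do rewrite deg_setU //.
rewrite !big_split /= (sum_deg Y X); lia.
Qed.

Lemma dsum1 x : dsum [set x] = 0.
Proof. by rewrite /dsum big_set1 deg1. Qed.

Lemma dsum_setU1 x X : x \notin X -> dsum (x |: X) = dsum X + 2 * deg x X.
Proof.
by move=> xX; rewrite dsumU ?disjoints1 // dsum1 big_set1.
Qed.

Lemma deg_clique x X e : x \in X ->
  {in X &, forall x y, x != y -> c x y = e} -> deg x X = #|X|.-1 * e.
Proof.
move=> xX cX; rewrite -(setD1K xX) deg_setU1 ?setD11 // c0 add0n.
rewrite (deg_const (e := e)); first by rewrite cardsU1 setD11.
by move=> y /setD1P[yx yX]; rewrite cX // eq_sym.
Qed.

Lemma dsum_clique X e :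
  {in X &, forall x y, x != y -> c x y = e} -> dsum X = #|X| * (#|X|.-1 * e).
Proof.
move=> cX; rewrite /dsum (eq_bigr (fun=> #|X|.-1 * e)) ?sum_nat_const //.
by move=> x xX; apply: deg_clique.
Qed.

Variables (rd d : nat).
Hypotheses (rd_gt0 : 0 < rd) (d_gt0 : 0 < d).
Local Notation I := (lvl rd d).
Local Notation dual := (dualB rd d).

(* The Legendre dual form of the requirement that every k-subset of W, with
   k <= r * I + rd + 1, has at least the deficiency of the best blow-up of the
   pattern with r parts of level 0. *)
Definition sparse r W := forall X, X \subset W -> #|X| <= r * I + rd + 1 ->
  forall th, th <= I ->
  2 * th * #|X| <= dsum X + r * th * th.+1 + 2 * dual th.

(** Degrees are at most (I / M + 1 / (K M)) |W| for M = r I + rd, with denominators cleared. Here I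
    / M is the limit, for large [a], of the optimal loss density with r parts of level 0. *)
Definition bounded_deg K r W :=
  forall v, v \in W -> K * (r * I + rd) * deg v W <= (K * I + 1) * #|W|.

(* The bound for Y :|: A with th = #|A|. *)
Lemma sparse_strip r W Y A : sparse r.+1 W -> Y \subset W -> A \subset W ->
  [disjoint Y & A] -> {in A &, forall x y, x != y -> c x y = 1} ->
  {in Y & A, forall y x, c y x = 0} -> #|Y| <= r * I + rd + 1 -> #|A| <= I ->
  2 * #|A| * #|Y| <= dsum Y + r * #|A| * #|A|.+1 + 2 * dual #|A|.
Proof.
move=> sp YW AW dYA cA cYA leY leA.
have := sp (Y :|: A); rewrite subUset YW AW => /(_ isT).
rewrite cardsU (disjoint_setI0 dYA) cards0 subn0 => /(_ _ #|A| leA).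
rewrite dsumU // (dsum_clique cA) big1 => [|y Yy]; last first.
  by rewrite /deg big1 // => x; apply: cYA.
move=> H; have {}H := H ltac:(rewrite mulSn; lia).
(* For m = |A|, the terms m (m - 1) of the clique and m (m + 1) of one part cancel 2 m^2 on the
   left: exactly one part leaves the bound. *)
move: H; case: #|A| {leA} => [|m] /=; nia.
Qed.

Lemma sum_deg_le K r W X : bounded_deg K r W -> X \subset W ->
  K * (r * I + rd) * (\sum_(v in W) deg v X) <= #|X| * ((K * I + 1) * #|W|).
Proof.
move=> bd XW; rewrite sum_deg big_distrr /= -sum_nat_const.
by apply: leq_sum => x xX; apply: bd; apply: (subsetP XW).
Qed.

(** Averaging. By integrality |X| I + 1 <= (th + 1) M; half of this unit absorbs the error 1 / K in
    the degrees, the other half the vertices of X, as W is large. *)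
Lemma cheap_vertex K r W X th : bounded_deg K r W -> X \subset W ->
  #|X| <= r * I + rd -> #|X| * I < th.+1 * (r * I + rd) ->
  2 * (r * I + rd) <= K -> 2 * (r * I + rd) * ((r * I + rd) * I + 1) < #|W| ->
  exists2 v, v \in W :\: X & deg v X <= th.
Proof.
move=> bd XW leX ltX leK ltW.
case: (pickP [pred v | (v \in W :\: X) && (deg v X <= th)]) => [v /andP[]|none].
  by exists v.
have big : th.+1 * (#|W| - #|X|) <= \sum_(v in W) deg v X.
  rewrite (big_setID X) /= -cardsDS // mulnC -sum_nat_const.
  apply: leq_trans (leq_addl _ _); apply: leq_sum => v vWX.
  by have := none v; rewrite /= vWX /= => /negbT; rewrite -ltnNge.
have le_S := sum_deg_le bd XW; exfalso.
move: (\sum_(v in W) _) leX ltX leK ltW big le_S (subset_leq_card XW).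
move: (#|X|) (#|W|) I (r * I + rd) => k n J M Sm leX ltX leK ltW big le_S lekn.
have h1 : K * M * (th.+1 * (n - k)) <= k * ((K * J + 1) * n).
  by apply: leq_trans le_S; rewrite leq_mul2l big orbT.
have h2 : K * (k * J + 1) * (n - k) <= k * ((K * J + 1) * n).
  have e : k * J + 1 <= M * th.+1 by lia.
  by apply: leq_trans h1; rewrite mulnA -[K * M * _]mulnA leq_mul2r leq_mul2l e !orbT.
have h3 : K * n <= k * n + K * (k * (k * J + 1)).
  move: h2; rewrite mulnBr; nia.
have h4 : 2 * (k * n) <= K * n by rewrite mulnA leq_mul2r; apply/orP; right; nia.
have h5 : K * n <= 2 * (K * (k * (k * J + 1))) by lia.
have h6 : n <= 2 * (k * (k * J + 1)).
  have K_gt0 : 0 < K by nia.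
  by rewrite -(leq_pmul2l K_gt0) mulnCA.
have h7 : k * (k * J + 1) <= M * (M * J + 1).
  by apply: leq_mul => //; rewrite leq_add2r leq_mul2r leX orbT.
lia.
Qed.
End Deficiency.

(** * Tight sets and their stars *)

Section Find.
Variables (V : finType) (c : V -> V -> nat).
Hypotheses (csym : forall x y, c x y = c y x) (c0 : forall x, c x x = 0).
Variables (rd d : nat).
Hypotheses (rd_gt0 : 0 < rd) (d_gt0 : 0 < d).
Implicit Types (X Y Z W A B S E : {set V}) (u v x y : V).
Local Notation I := (lvl rd d).
Local Notation dual := (dualB rd d).
Local Notation deg := (deg c).
Local Notation dsum := (dsum c).
Local Notation sparse := (sparse c rd d).
Local Notation bounded_deg := (bounded_deg c rd d).

(* The reverse inequality is [sparse]. *)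
Definition tight r th X := dsum X + r * th * th.+1 + 2 * dual th <= 2 * th * #|X|.

(** Passing to th + 1 adds 2 (r (th + 1) + [slots th]) on the left and 2 |X| on the right. *)
Lemma tight_raise r th X : r * th.+1 + slots rd d th <= #|X| ->
  tight r th X -> tight r th.+1 X.
Proof. by rewrite /tight dualBS; nia. Qed.

Lemma raise_cond r th k : th.+1 * (r * I + rd) <= k * I ->
  r * th.+1 + slots rd d th <= k.
Proof.
move=> le; have le2 : r * th.+1 <= k.
  rewrite -(leq_pmul2r (lvl_gt0 rd d)); apply: leq_trans le; nia.
rewrite -(subnKC le2) leq_add2l slots_leq // mulnBl; nia.
Qed.

(** Raising stops exactly where [cheap_vertex] becomes applicable; it stops below I because |X| <
    M. *)
Lemma tight_raise_max r th X : th < I -> #|X| < r * I + rd -> tight r th X ->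
  exists th', [/\ th' < I, tight r th' X & #|X| * I < th'.+1 * (r * I + rd)].
Proof.
move=> + ltX; elim: {th}(I - th) {-2}th (leqnn (I - th)) => [|m IH] th lem lt tg.
  by move: lem; rewrite leqn0 subn_eq0 leqNgt lt.
case: (leqP (th.+1 * (r * I + rd)) (#|X| * I)) => [le|gt]; last by exists th.
have lt' : th.+1 < I.
  rewrite -(@ltn_pmul2r (r * I + rd)) ?addn_gt0 ?rd_gt0 ?orbT //.
  apply: leq_ltn_trans le _; rewrite [I * _]mulnC ltn_pmul2r //; exact: lvl_gt0.
apply: (IH th.+1) => //; first by lia.
exact: tight_raise (raise_cond le) tg.
Qed.

Lemma tight_raise_top r th X : th < I -> r * I.-1 + rd <= #|X| -> tight r th X ->
  tight r I.-1 X.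
Proof.
move=> + leX; elim: {th}(I - th) {-2}th (leqnn (I - th)) => [|m IH] th lem lt tg.
  by move: lem; rewrite leqn0 subn_eq0 leqNgt lt.
case: (eqVneq th I.-1) => [<-//|ne].
have lt' : th.+1 < I by lia.
apply: (IH th.+1) => //; first by lia.
apply: tight_raise tg; have := slots_le_rd rd_gt0 lt; nia.
Qed.

(** Greedy: the empty set is tight at 0. After raising [th] there is a new vertex of deficiency at
    most [th]; it adds at most 2 th on the left and exactly 2 th on the right. *)
Lemma tight_chain K r W k : bounded_deg K r W -> k <= r * I + rd ->
  2 * (r * I + rd) <= K -> 2 * (r * I + rd) * ((r * I + rd) * I + 1) < #|W| ->
  exists X th, [/\ X \subset W, #|X| = k, th < I & tight r th X].
Proof.
move=> bd + leK ltW; elim: k => [|k IH] lek.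
  exists set0, 0; rewrite sub0set cards0 lvl_gt0 /tight /dsum big_set0.
  by rewrite !muln0 /dualB big_ord0.
have [X [th [XW cX lt tg]]] := IH (ltnW lek).
have ltX : #|X| < r * I + rd by rewrite cX.
have [th' [lt' tg' small]] := tight_raise_max lt ltX tg.
have [v /setDP[vW vX] le] := cheap_vertex csym rd_gt0 d_gt0 bd XW (ltnW ltX) small leK ltW.
exists (v |: X), th'; split=> //; first by rewrite subUset sub1set vW.
  by rewrite cardsU1 vX cX.
by move: tg'; rewrite /tight dsum_setU1 // cardsU1 vX; nia.
Qed.

(** The size is M - 1, so that [sparse] still applies after adding two vertices: one of the star and
    one tested against the result. *)
Lemma tight_top K r W : bounded_deg K r.+1 W ->
  2 * (r.+1 * I + rd) <= K -> 
  2 * (r.+1 * I + rd) * ((r.+1 * I + rd) * I + 1) < #|W| ->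
  exists Z, [/\ Z \subset W, #|Z| = r.+1 * I + rd.-1 & tight r.+1 I.-1 Z].
Proof.
move=> bd leK ltW.
have lek : r.+1 * I + rd.-1 <= r.+1 * I + rd by rewrite leq_add2l leq_pred.
have [Z [th [ZW cZ lt tg]]] := tight_chain bd lek leK ltW.
exists Z; split => //; apply: tight_raise_top tg => //; rewrite cZ.
have := lvl_gt0 rd d; nia.
Qed.

Section Star.
Variables (K r : nat) (W Z : {set V}).
Local Notation M := (r.+1 * I + rd).
Hypotheses (sp : sparse r.+1 W) (bd : bounded_deg K r.+1 W).
Hypotheses (ZW : Z \subset W) (cZ : #|Z| = r.+1 * I + rd.-1).
Hypothesis tgZ : tight r.+1 I.-1 Z.

Let cZ1 : #|Z|.+1 = M.
Proof. by rewrite cZ; lia. Qed.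

Lemma deg_tight v : v \in W -> v \notin Z -> I.-1 <= deg v Z.
Proof.
move=> vW vZ; have := sp (X := v |: Z) _ _ (leq_pred I).
rewrite subUset sub1set vW ZW cardsU1 vZ add1n dsum_setU1 // => H.
have {}H := H isT ltac:(lia).
move: tgZ; rewrite /tight; nia.
Qed.

(* By [star_good] the star is, up to few pairs, a whole part of level 0. *)
Definition star := [set v in W :\: Z | deg v Z == I.-1].

(** Adding x, of deficiency I - 1, preserves tightness at I - 1. The new size M = (r + 1) I +
    [slots I.-1] is just enough to raise the slope to I. *)
Lemma star_tight x : x \in star -> tight r.+1 I (x |: Z).
Proof.
rewrite inE => /andP[/setDP[xW xZ] /eqP degx].
rewrite /tight dualB_pred // dsum_setU1 // cardsU1 xZ degx add1n.
have [J eJ] : exists J, I = J.+1 by exists I.-1; rewrite prednK ?lvl_gt0.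
move: tgZ cZ; rewrite /tight eJ /=.
move: (dual _) (dsum Z) (#|Z|) => D T n + en; rewrite {}en; lia.
Qed.

(* All but few vertices have deficiency exactly lvl to the tight set x |: Z. *)
Definition star_bad x := [set v in W | (v \in x |: Z) || (deg v (x |: Z) != I)].

(** [c u x] is the difference of the deficiencies of u to [x |: Z] and to Z. The former is I; the
    latter is I - 1 in the star and at least I elsewhere. *)
Lemma star_good x u : x \in star -> u \in W -> u \notin star_bad x ->
  c u x = (u \in star).
Proof.
move=> xS uW; rewrite inE uW negb_or negbK /= in_setU1 negb_or.
have /setDP[xW xZ] : x \in W :\: Z by move: xS; rewrite inE => /andP[].
case/andP=> /andP[ux uZ] /eqP; rewrite deg_setU1 // inE in_setD uZ uW /=.
have := deg_tight uW uZ; have := lvl_gt0 rd d.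
case: eqP => /=; lia.
Qed.

(** Outside the tight set [x |: Z], of size M, every deficiency to it is at least I, while the
    average is at most about I + 1 / K. So at most about |W| / K vertices exceed I. *)
Lemma star_bad_card x : x \in star -> K * #|star_bad x| <= #|W| + K * (I + 1) * M.
Proof.
move=> xS; have tg := star_tight xS.
have /setDP[xW xZ] : x \in W :\: Z by move: xS; rewrite inE => /andP[].
set X := x |: Z in tg *.
have cX : #|X| = M by rewrite cardsU1 xZ add1n.
have XW : X \subset W by rewrite subUset sub1set xW.
have ge v : v \in W :\: X -> I <= deg v X.
  case/setDP=> vW vX; have := sp (X := v |: X) _ _ (leqnn I).
  rewrite subUset sub1set vW XW cardsU1 vX add1n dsum_setU1 // => H.
  have {}H := H isT ltac:(lia).
  move: tg; rewrite /tight; nia.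
have le1 : #|star_bad x| <= M + #|[set v in W :\: X | deg v X != I]|.
  rewrite -cX; apply: leq_trans (leq_card_setU _ _); apply: subset_leq_card.
  apply/subsetP=> v; rewrite in_set => /andP[vW /orP[vX|ne]]; rewrite in_setU.
    by apply/orP; left.
  case vX: (v \in X); first by [].
  by rewrite orFb in_set in_setD vX vW.
have le2 : I * (#|W| - M) + #|[set v in W :\: X | deg v X != I]|
    <= \sum_(v in W) deg v X.
  rewrite (big_setID X) /=; apply: leq_trans (leq_addl _ _).
  rewrite -cX -cardsDS // mulnC -sum_nat_const -sum1_card.
  rewrite [X in _ + X](eq_bigl (fun v => (v \in W :\: X) && (deg v X != I))).
    rewrite big_mkcondr -big_split /=; apply: leq_sum => v vWX.
    by have := ge _ vWX; case: eqP => [->|] /=; lia.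
  by move=> v; rewrite inE.
have := sum_deg_le csym bd XW; rewrite cX.
move: (\sum_(v in W) _) le2 le1 => Sm le2 le1 le3.
have {}le3 : K * Sm <= (K * I + 1) * #|W|.
  have M_gt0 : 0 < M by lia.
  by rewrite -(leq_pmul2l M_gt0) mulnA [M * K]mulnC.
have := leq_mul (leqnn K) le1; have := leq_mul (leqnn K) le2.
have : K * (I * #|W|) <= K * (I * (#|W| - M)) + K * (I * M).
  by rewrite -!mulnDr !leq_mul2l [_ - _ + _]addnC -leq_subLR leqnn !orbT.
move: le3; move: (r.+1 * I + rd) (#|W|) (#|W| - _) (#|[set v in _ | _]|) (#|star_bad x|).
move=> m n e b k.
rewrite !mulnDr !mulnDl ?mul1n !mulnA ?muln1; clear -e; lia.
Qed.

(** The M - 1 vertices of Z allow an average deficiency of about I - I / M, and only vertices of the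
    star lie below I, by one each. So the star has at least about |W| I / M vertices. *)
Lemma star_ge : K * I * #|W| <= K * M * #|star| + M * #|W| + K * M * I * M.
Proof.
have le2 : I * (#|W| - #|Z|) <= \sum_(v in W) deg v Z + #|star|.
  rewrite (big_setID Z) /= -addnA; apply: leq_trans (leq_addl _ _).
  rewrite -cardsDS // mulnC -sum_nat_const -sum1_card.
  rewrite [X in _ + X](eq_bigl (fun v => (v \in W :\: Z) && (deg v Z == I.-1))).
    rewrite big_mkcondr -big_split /=; apply: leq_sum => v /setDP[vW vZ].
    by have := deg_tight vW vZ; case: eqP => [->|] /=; lia.
  by move=> v; rewrite inE.
have le3 := sum_deg_le csym bd ZW.
move: (\sum_(v in W) _) le2 le3 => Sm le2 le3.
have h1 : K * M * (I * #|W|) <= K * M * (Sm + #|star|) + K * M * (I * M).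
  rewrite -mulnDr leq_mul2l; apply/orP; right.
  apply: leq_trans (leq_add le2 (leqnn _)); rewrite -mulnDr leq_mul2l; lia.
have h2 : K * M * (I * #|W|) = (#|Z| * (K * I)) * #|W| + K * I * #|W|.
  by rewrite -{1}cZ1; move: (#|Z|) (#|W|) (I); clear => *; lia.
have h3 : #|Z| * #|W| <= M * #|W| by rewrite leq_mul2r -cZ1 leqnSn orbT.
have h4 : #|Z| * ((K * I + 1) * #|W|) = (#|Z| * (K * I)) * #|W| + #|Z| * #|W|.
  by move: (#|Z|) (#|W|) (I); clear => *; lia.
move: h1 h2 h3 le3; rewrite h4 mulnDr; lia.
Qed.

Lemma star_le x : x \in star ->
  K * M * #|star| <= (K * I + 1) * #|W| + K * M * #|star_bad x|.
Proof.
move=> xS; have xW : x \in W by move: xS; rewrite !inE => /andP[/andP[]].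
apply: leq_trans (leq_add (bd xW) (leqnn _)); rewrite -mulnDr leq_mul2l.
apply/orP; right; rewrite -(cardsID (star_bad x) star) addnC leq_add //.
  rewrite -sum1_card; apply: leq_trans (leq_deg c x (_ : star :\: star_bad x \subset W)).
    rewrite /deg; apply: leq_sum => u /setDP[uS ubad].
    have uW : u \in W by move: uS; rewrite !inE => /andP[/andP[]].
    by rewrite csym star_good // uS.
  by apply/subsetP=> u /setDP[]; rewrite !inE => /andP[/andP[]].
by apply: subset_leq_card; rewrite subsetIr.
Qed.

(** Greedy: each new vertex avoids the bad sets of its predecessors, which [E] collects. *)
Lemma star_pick j b : (forall x, x \in star -> #|star_bad x| <= b) ->
  j * b < #|star| -> 0 < b ->
  exists A E, [/\ A \subset star, #|A| = j, #|E| <= j * b,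
    {in A &, forall x y, x != y -> c x y = 1} &
    {in W :\: E & A, forall u x, u != x /\ c u x = (u \in star)}].
Proof.
move=> leb + b_gt0; elim: j => [|j IH] lt.
  exists set0, set0; split; rewrite ?sub0set ?cards0 //.
  - by move=> x y; rewrite inE.
  - by move=> x y _; rewrite inE.
have [|A [E [AS cA cE c1 cU]]] := IH; first by lia.
have [x] : exists x, x \in star :\: E.
  apply/set0Pn; rewrite -card_gt0; have := cardsID E star.
  have := subset_leq_card (subsetIr star E); lia.
case/setDP=> xS xE.
have SW : star \subset W by apply/subsetP=> u; rewrite !inE => /andP[/andP[]].
have xW := subsetP SW _ xS.
have xWE : x \in W :\: E by rewrite in_setD xE.
have xA : x \notin A.
  by apply/negP=> xA; case: (cU x x xWE xA); rewrite eqxx.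
exists (x |: A), (E :|: star_bad x); split.
- by rewrite subUset sub1set xS.
- by rewrite cardsU1 xA cA.
- by apply: leq_trans (leq_card_setU _ _) _; rewrite mulSnr leq_add ?leb.
- have cx y : y \in A -> c x y = 1.
    by move=> yA; case: (cU x y xWE yA) => _ ->; rewrite xS.
  move=> y z /setU1P[->|yA] /setU1P[->|zA]; rewrite ?eqxx // => ne.
  + exact: cx.
  + by rewrite csym; apply: cx.
  + exact: c1.
- move=> u y /setDP[uW]; rewrite in_setU negb_or => /andP[uE ub] /setU1P[->|yA].
    split; last exact: star_good.
    (* [star_bad x] contains x itself, hence u differs from x. *)
    by apply: contra ub => /eqP->; rewrite inE xW setU11.
  by apply: cU => //; rewrite in_setD uE.
Qed.
End Star.
End Find.

Lemma subset_of_card (V : finType) (A : {set V}) k : k <= #|A| ->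
  exists2 B : {set V}, B \subset A & #|B| = k.
Proof.
move=> le; exists [set x in take k (enum A)].
  by apply/subsetP=> x; rewrite inE => /mem_take; rewrite mem_enum.
rewrite cardsE; have /card_uniqP -> : uniq (take k (enum A)).
  by rewrite take_uniq ?enum_uniq.
by rewrite size_takel // -cardE.
Qed.

(** * Building a skeleton part by part *)

Section Skeleton.
Variables (V : finType) (c : V -> V -> nat).
Hypotheses (csym : forall x y, c x y = c y x) (c0 : forall x, c x x = 0).
Variables (rd d : nat).
Hypotheses (rd_gt0 : 0 < rd) (d_gt0 : 0 < d).
Implicit Types (X Y Z W B S E : {set V}) (u v x y : V).
Local Notation I := (lvl rd d).
Local Notation dual := (dualB rd d).
Local Notation deg := (deg c).
Local Notation dsum := (dsum c).
Local Notation sparse := (sparse c rd d).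
Local Notation bounded_deg := (bounded_deg c rd d).

(* A copy in W of the blow-up of the pattern with r parts of level 0, of size t
   each, and parts of size 1 at level d. *)
Definition skeleton r t W (A : nat -> {set V}) B := [/\
  forall i, i < r -> [/\ A i \subset W, #|A i| = t &
    {in A i &, forall x y, x != y -> c x y = 1}],
  forall i j, i < j < r -> [disjoint A i & A j] /\
    {in A i & A j, forall x y, c x y = 0},
  forall i, i < r -> [disjoint A i & B] /\ {in A i & B, forall x y, c x y = 0},
  B \subset W /\ #|B| = rd &
  {in B &, forall x y, x != y -> c x y = d}].

Lemma deg_eq v X e : deg v X <= #|X| * e -> {in X, forall x, e <= c v x} ->
  {in X, forall x, c v x = e}.
Proof.
move=> le ge x xX; apply/eqP; rewrite eqn_leq ge // andbT.
move: le; rewrite /deg (big_setD1 x) //= (cardsD1 x) xX mulSn.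
have : \sum_(i in X :\ x) e <= \sum_(i in X :\ x) c v i.
  by apply: leq_sum => y /setD1P[_]; apply: ge.
rewrite sum_nat_const; lia.
Qed.

Lemma sparse0_pair W x y : sparse 0 W -> x \in W -> y \in W -> x != y -> d <= c x y.
Proof.
move=> sp xW yW ne; have := sp [set x; y]; rewrite subUset !sub1set xW yW cards2 ne.
move=> /(_ isT) H; have {}H := H ltac:(lia) d ltac:(rewrite /lvl; nia).
move: H; rewrite dualB_small // dsum_setU1 ?inE // dsum1 // deg1; lia.
Qed.

(** As k < rd gives k I < (k d + 1) rd, some vertex has deficiency at most k d to the k vertices
    found so far; each pair has at least d, so equality holds throughout. *)
Lemma find_clique K W k : sparse 0 W -> bounded_deg K 0 W -> k <= rd ->
  2 * rd <= K -> 2 * rd * (rd * I + 1) < #|W| ->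
  exists B, [/\ B \subset W, #|B| = k & {in B &, forall x y, x != y -> c x y = d}].
Proof.
move=> sp bd + leK ltW; elim: k => [|k IH] lek.
  by exists set0; rewrite sub0set cards0; split=> // x y; rewrite inE.
have [B [BW cB cd]] := IH (ltnW lek).
have [||||v /setDP[vW vB] le] := @cheap_vertex _ _ csym _ _ rd_gt0 d_gt0 K 0 W B (k * d) bd BW.
- by rewrite mul0n add0n cB ltnW.
- by rewrite mul0n add0n cB /lvl; nia.
- by rewrite mul0n add0n.
- by rewrite mul0n add0n.
have cv : {in B, forall x, c v x = d}.
  apply: deg_eq; first by rewrite cB.
  move=> x xB; apply: sparse0_pair sp vW _ _; first exact: (subsetP BW).
  by apply: contra vB => /eqP->.
exists (v |: B); split.
- by rewrite subUset sub1set vW.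
- by rewrite cardsU1 vB cB.
move=> x y /setU1P[->|xB] /setU1P[->|yB]; rewrite ?eqxx // => ne.
- exact: cv.
- by rewrite csym; apply: cv.
- exact: cd.
Qed.

(** The last bound says |W'| / |W| >= (r I + rd) / M - O(1 / K): removing the star leaves the share
    of the other parts, so the degree density I / M in W becomes I / (r I + rd) relative to W'. *)
Lemma find_part r t K W (M := r.+1 * I + rd) : I <= t -> sparse r.+1 W ->
  bounded_deg K r.+1 W -> (2 * t + 2) * M <= K ->
  2 * M * (M * I + 1) + K * (I + 1) * M < #|W| ->
  exists A W' : {set V}, [/\ A \subset W, W' \subset W & [disjoint A & W']] /\
    [/\ #|A| = t, {in A &, forall x y, x != y -> c x y = 1},
        {in A & W', forall x y, c x y = 0}, sparse r W' &
        K * (r * I + rd) * #|W| <= K * M * #|W'| + (1 + 2 * M + 2 * t * M) * #|W|].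
Proof.
move=> le_t sp bd leK ltW; have I_gt0 := lvl_gt0 rd d.
have K_gt0 : 0 < K by apply: leq_trans leK; rewrite muln_gt0; lia.
have [Z [ZW cZ tgZ]] : exists Z,
    [/\ Z \subset W, #|Z| = r.+1 * I + rd.-1 & tight c rd d r.+1 I.-1 Z].
  apply: (tight_top csym c0 rd_gt0 d_gt0 bd); rewrite -/M.
    by apply: leq_trans leK; rewrite leq_mul2r; apply/orP; right; lia.
  by apply: leq_ltn_trans ltW; rewrite leq_addr.
have n_big : K * (I + 1) * M <= #|W|.
  by apply: leq_trans (ltnW ltW); rewrite leq_addl.
pose S := star c rd d W Z; pose b := 2 * #|W| %/ K.
have leb x : x \in S -> #|star_bad c rd d W Z x| <= b.
  move=> xS; rewrite leq_divRL // mulnC.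
  apply: leq_trans (star_bad_card csym c0 rd_gt0 d_gt0 sp bd ZW cZ tgZ xS) _.
  rewrite mul2n -addnn leq_add2l; exact: n_big.
have Kb : K * b <= 2 * #|W| by rewrite mulnC leq_trunc_div.
have b_gt0 : 0 < b.
  rewrite divn_gt0 //; apply: leq_trans (_ : K * (I + 1) * M <= _).
    by rewrite -mulnA leq_pmulr // muln_gt0 addn1 /M addn_gt0 rd_gt0 orbT.
  by rewrite mul2n -addnn (leq_trans n_big) ?leq_addr.
have lt_tb : t * b < #|S|.
  have := star_ge csym c0 rd_gt0 d_gt0 sp bd ZW cZ tgZ; rewrite -/S -/M => ge.
  rewrite ltnNge; apply/negP=> leS.
  have h1 : K * M * #|S| <= M * (t * (2 * #|W|)).
    apply: (@leq_trans (K * M * (t * b))); first by rewrite leq_mul2l leS orbT.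
    rewrite [K * M]mulnC -mulnA leq_mul2l mulnCA leq_mul2l Kb !orbT //.
  have h2 : (2 * t + 2) * M * #|W| <= K * I * #|W|.
    by rewrite leq_mul2r (leq_trans leK) ?orbT // leq_pmulr.
  have h3 : M * #|W| <= M * (K * M * I) by nia.
  have M_gt0 : 0 < M by rewrite /M addn_gt0 rd_gt0 orbT.
  move: h3; rewrite leq_pmul2l // leqNgt => /negP[].
  apply: leq_trans ltW; rewrite ltnS; apply: leq_trans (leq_addl _ _).
  by rewrite -!mulnA leq_mul2l [M * I]mulnC leq_mul2r leq_addr !orbT.
have [A [E [AS cA cE c1 cU]]] :=
  star_pick csym c0 rd_gt0 d_gt0 sp ZW cZ tgZ leb lt_tb b_gt0.
have SW : S \subset W by apply/subsetP=> u; rewrite !inE => /andP[/andP[]].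
have AW := subset_trans AS SW.
pose W' := W :\: (S :|: E).
have dAW : [disjoint A & W'].
  rewrite disjoints_subset; apply/subsetP=> x xA.
  by rewrite in_setC in_setD in_setU (subsetP AS _ xA).
have W'W : W' \subset W by apply: subsetDl.
have c0A : {in A & W', forall x y, c x y = 0}.
  move=> x y xA; rewrite in_setD in_setU negb_or => /andP[/andP[yS yE] yW].
  have yWE : y \in W :\: E by rewrite in_setD yE.
  by rewrite csym; case: (cU y x yWE xA) => _ ->; rewrite -/S (negbTE yS).
exists A, W'; do !split => //.
  move=> X XW leX th leth.
  (* As th <= I <= t, a clique of size th can be attached to X, which uses up one part. *)
  have [A' A'A cA'] : exists2 A' : {set V}, A' \subset A & #|A'| = th.
    by apply: subset_of_card; rewrite cA (leq_trans leth).
  rewrite -cA'; refine (sparse_strip csym c0 rd_gt0 d_gt0 sp _ _ _ _ _ _ _) => //.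
  - exact: subset_trans XW W'W.
  - exact: subset_trans A'A AW.
  - rewrite disjoint_sym; apply: disjointWl A'A _.
    exact: disjointWr XW dAW.
  - by move=> x y xA yA; apply: c1; apply: (subsetP A'A).
  - by move=> y x yX xA; rewrite csym c0A ?(subsetP A'A) ?(subsetP XW).
  - by rewrite cA'.
have [x xA] : exists x, x \in A.
  by apply/set0Pn; rewrite -card_gt0 cA; apply: leq_trans le_t.
have := star_le csym c0 rd_gt0 d_gt0 sp bd ZW cZ tgZ (subsetP AS _ xA).
rewrite -/S -/M => leS.
have leW : #|W| <= #|W'| + (#|S| + #|E|).
  rewrite -(cardsID (S :|: E) W) addnC leq_add2l.
  apply: leq_trans (subset_leq_card (subsetIr _ _)) _; exact: leq_card_setU.
have h1 : K * M * #|star_bad c rd d W Z x| <= M * (2 * #|W|).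
  rewrite [K * M]mulnC -mulnA leq_mul2l; apply/orP; right.
  by apply: leq_trans Kb; rewrite leq_mul2l leb ?orbT // (subsetP AS).
have h2 : K * M * #|E| <= M * (t * (2 * #|W|)).
  rewrite [K * M]mulnC -mulnA leq_mul2l; apply/orP; right.
  apply: (@leq_trans (K * (t * b))); first by rewrite leq_mul2l cE orbT.
  by rewrite mulnCA leq_mul2l Kb orbT.
have h3 : K * M * #|W| <= K * M * #|W'| + K * M * #|S| + K * M * #|E|.
  by rewrite -addnA -!mulnDr leq_mul2l leW orbT.
have h4 : K * M * #|W| = K * (r * I + rd) * #|W| + K * I * #|W|.
  by rewrite -mulnDl -mulnDr; congr (_ * _ * _); rewrite /M mulSn -addnA addnC.
by move: leS h1 h2 h3 h4; clear; lia.
Qed.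
End Skeleton.

Section FindSkeleton.
Variables (rd d : nat).
Hypotheses (rd_gt0 : 0 < rd) (d_gt0 : 0 < d).
Local Notation I := (lvl rd d).

Lemma find_skeleton r t : I <= t -> exists K n0, forall (V : finType)
  (c : V -> V -> nat) (W : {set V}), (forall x y, c x y = c y x) ->
  (forall x, c x x = 0) -> n0 <= #|W| -> sparse c rd d r W ->
  bounded_deg c rd d K r W -> exists A B, skeleton c rd d r t W A B.
Proof.
move=> le_t; elim: r => [|r [K' [n' IH]]].
  exists (2 * rd), (2 * rd * (rd * I + 1)).+1 => V c W csym c0 leW sp bd.
  have [B [BW cB cd]] := find_clique csym c0 rd_gt0 d_gt0 sp bd (leqnn _) (leqnn _) leW.
  by exists (fun=> set0), B; split=> // i j /andP[].
pose M := r.+1 * I + rd; pose M' := r * I + rd; pose C := 1 + 2 * M + 2 * t * M.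
(* [K' * M'] pays for the degree error 1 / K and [(K' * I + 1) * C] for the error in the size of W',
   both against the target precision 1 / K'. The first summand is required by [find_part], and C + 1
   keeps W' large. *)
pose K := (2 * t + 2) * M + K' * M' + (K' * I + 1) * C + C + 1.
exists K, (2 * M * (M * I + 1) + K * (I + 1) * M + K * M * n').+1.
move=> V c W csym c0 leW sp bd.
have [||A [W' [[AW W'W dis] [cA c1 c00 sp' leW']]]] :=
    find_part csym c0 rd_gt0 d_gt0 le_t sp bd.
- rewrite -/M /K; move: (K' * M') ((K' * I + 1) * C) => p q; lia.
- by apply: leq_ltn_trans leW; rewrite leq_addr.
have M'_gt0 : 0 < M' by rewrite /M' addn_gt0 rd_gt0 orbT.
have K_gt0 : 0 < K by rewrite /K addn1.
have M_gt0 : 0 < M by rewrite /M addn_gt0 rd_gt0 orbT.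
move: leW'; rewrite -/M -/M' -/C => leW'.
have bd' : bounded_deg c rd d K' r W'.
  move=> v vW'; have := bd v (subsetP W'W _ vW'); rewrite -/M -/M' => bdv.
  have le_deg := leq_deg c v W'W.
  rewrite -(@leq_pmul2l (K * M)) ?muln_gt0 ?K_gt0 //.
  apply: (@leq_trans (K' * M' * ((K * I + 1) * #|W|))).
    by rewrite mulnCA leq_mul2l (leq_trans _ bdv) ?orbT // leq_mul2l le_deg orbT.
  have h : K' * M' + (K' * I + 1) * C <= K * M'.
    apply: leq_trans (leq_pmulr _ M'_gt0); rewrite /K; lia.
  have h2 := leq_mul h (leqnn #|W|).
  have h3 := leq_mul (leqnn (K' * I + 1)) leW'.
  move: h2 h3; move: (#|W|) (#|W'|) I => n m J; clearbody K C M M'.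
  lia.
have leW2 : n' <= #|W'|.
  rewrite -(@leq_pmul2l (K * M)) ?muln_gt0 ?K_gt0 //.
  apply: (@leq_trans #|W|); first by apply: leq_trans (ltnW leW); rewrite leq_addl.
  have h : C + 1 <= K * M'.
    by apply: leq_trans (leq_pmulr _ M'_gt0); rewrite /K -addnA leq_addl.
  have := leq_mul h (leqnn #|W|); rewrite mulnDl mul1n; lia.
have [As [B [hA hAA hAB [BW cB] hB]]] := IH V c W' csym c0 leW2 sp' bd'.
exists (fun i => if i == r then A else As i), B; split=> //.
- move=> i; rewrite ltnS leq_eqVlt; case: eqP => [->|_] //= lt.
  have [AiW ci c1i] := hA i lt; split=> //; exact: subset_trans W'W.
- move=> i j /andP[ltij ltj]; have ltir : i < r by lia.
  rewrite (ltn_eqF ltir); case: eqP => [ej|ne]; last by apply: hAA; lia.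
  have [AiW _ _] := hA i ltir; split.
    by rewrite disjoint_sym; apply: disjointWr AiW dis.
  by move=> x y xA yA; rewrite csym c00 // (subsetP AiW).
- move=> i; rewrite ltnS leq_eqVlt; case: eqP => [->|_] //= lt; last exact: hAB.
  split; first exact: disjointWr BW dis.
  by move=> x y xA yB; rewrite c00 // (subsetP BW).
- split=> //; exact: subset_trans W'W.
Qed.
End FindSkeleton.

(** * Classifying vertices by their deficiencies to a skeleton *)

Section Classify.
Variables (V : finType) (c : V -> V -> nat).
Hypotheses (csym : forall x y, c x y = c y x) (c0 : forall x, c x x = 0).
Implicit Types (X Y Z W S E : {set V}) (u v x y : V).
Local Notation deg := (deg c).
Local Notation dsum := (dsum c).

Lemma mem_bigcup_seq (T : Type) (js : seq T) (A : T -> {set V}) x :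
  (x \in \bigcup_(i <- js) A i) = has (fun i => x \in A i) js.
Proof.
elim: js => [|i js IH]; first by rewrite big_nil inE.
by rewrite big_cons in_setU IH.
Qed.

Lemma strips (js : seq nat) (A : nat -> {set V}) th Y : uniq js ->
  {in js, forall i, [/\ #|A i| = th, {in A i &, forall x y, x != y -> c x y = 1},
    [disjoint Y & A i] & {in Y & A i, forall x y, c x y = 0}]} ->
  {in js &, forall i j, i != j ->
    [disjoint A i & A j] /\ {in A i & A j, forall x y, c x y = 0}} ->
  exists2 X, X = Y :|: \bigcup_(i <- js) A i &
  #|X| = #|Y| + size js * th /\ dsum X = dsum Y + size js * (th * th.-1).
Proof.
elim: js => [|i js IH] /=.
  by move=> _ _ _; exists Y; rewrite ?big_nil ?setU0 ?addn0.
case/andP=> ijs ujs hA hAA.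
have [||X eX [cX dX]] := IH ujs.
- by move=> j jjs; apply: hA; rewrite in_cons jjs orbT.
- by move=> j k jjs kjs; apply: hAA; rewrite in_cons ?jjs ?kjs orbT.
have [cAi c1 dYi c0i] := hA i (mem_head _ _).
have zX : {in A i & X, forall x y, x != y /\ c x y = 0}.
  move=> x y xi; rewrite eX => /setUP[yY|].
    split; last by rewrite csym c0i.
    by apply: contraTneq dYi => exy; apply/pred0Pn; exists x; rewrite /= xi exy yY.
  rewrite mem_bigcup_seq => /hasP[j jjs yj].
  have [||dij zij] := hAA i j (mem_head _ _); rewrite ?in_cons ?jjs ?orbT //.
    by apply: contraNneq ijs => ->.
  split; last exact: zij.
  by apply: contraTneq dij => exy; apply/pred0Pn; exists x; rewrite /= xi exy yj.
have dis : [disjoint A i & X].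
  apply/pred0P=> x /=; apply/negP=> /andP[xi xX].
  by have [] := zX x x xi xX; rewrite eqxx.
exists (A i :|: X); first by rewrite eX big_cons setUCA.
rewrite cardsU (disjoint_setI0 dis) cards0 subn0 dsumU // (dsum_clique c0 c1) cAi.
rewrite big1 => [|x xi]; last by apply: big1 => y yX; case: (zX x y xi yX).
by rewrite cX dX !mulSn; split; lia.
Qed.

Variables (rd d r0 t : nat).
Hypotheses (rd_gt0 : 0 < rd) (d_gt0 : 0 < d).
Local Notation I := (lvl rd d).
Local Notation dual := (dualB rd d).
Variables (W : {set V}) (A : nat -> {set V}) (B : {set V}).
Hypotheses (sp : sparse c rd d r0 W) (sk : skeleton c rd d r0 t W A B).

(** Subsets of size [th] of parts to which Y has no deficiency are attached to Y. As in
    [sparse_strip], each of them cancels the term of one part. *)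
Lemma skeleton_ineq js (A' : nat -> {set V}) th Y : uniq js ->
  {in js, forall i, [/\ i < r0, A' i \subset A i, #|A' i| = th,
    [disjoint Y & A' i] & {in Y & A' i, forall x y, c x y = 0}]} ->
  th <= I -> Y \subset W -> #|Y| + size js * th <= r0 * I + rd + 1 ->
  2 * th * #|Y| <= dsum Y + (r0 - size js) * th * th.+1 + 2 * dual th.
Proof.
move=> ujs hA' leth YW leY; have [hA hAA hAB hB hBB] := sk.
have lejs : size js <= r0.
  rewrite -(size_iota 0 r0); apply: uniq_leq_size => // i /hA'[lt _ _ _ _].
  by rewrite mem_iota.
have [||X eX [cX dX]] := @strips js A' th Y ujs.
- move=> i /hA'[lt sA cA dY zY]; split=> // x y xi yi.
  by have [_ _] := hA i lt; apply; apply: (subsetP sA).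
- have aux i j : i \in js -> j \in js -> i < j ->
      [disjoint A' i & A' j] /\ {in A' i & A' j, forall x y, c x y = 0}.
    move=> /hA'[lti si _ _ _] /hA'[ltj sj _ _ _] lt.
    have [|dij zij] := hAA i j; first by rewrite lt.
    split; first exact: disjointWl si (disjointWr sj dij).
    by move=> x y xi yj; apply: zij; [apply: (subsetP si) | apply: (subsetP sj)].
  move=> i j ijs jjs; rewrite neq_ltn => /orP[|]; first exact: aux.
  move=> /(aux _ _ jjs ijs)[dji zji]; rewrite disjoint_sym; split=> // x y xi yj.
  by rewrite csym zji.
have XW : X \subset W.
  rewrite eX subUset YW /=; apply/subsetP=> x; rewrite mem_bigcup_seq.
  move=> /hasP[i /hA'[lt sA _ _ _] xi].
  by have [AW _ _] := hA i lt; apply: (subsetP AW); apply: (subsetP sA).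
have := sp XW; rewrite cX => /(_ leY th leth); rewrite dX.
have [k ek] : exists k, r0 = k + size js by exists (r0 - size js); rewrite subnK.
have -> : r0 - size js = k by rewrite ek addnK.
rewrite ek; move: (size js) (#|Y|) (dsum Y) (dual _) => m y D e.
by clear; case: th => [|th] /=; lia.
Qed.

Definition zeros v i := [set x in A i | c v x == 0].

Definition outside v := [/\ v \in W, forall i, i < r0 -> v \notin A i & v \notin B].

(** Strips of zeros of v use up all r0 parts, so only the level d terms remain in the bound for
    [v |: K]. *)
Lemma zeros_ineq v m (K : {set V}) : outside v -> m <= I -> K \subset B ->
  (forall i, i < r0 -> m <= #|zeros v i|) ->
  2 * m * #|K|.+1 <= #|K| * (#|K|.-1 * d) + 2 * deg v K + 2 * dual m.
Proof.
move=> [vW vA vB] lem KB hz; have [hA hAA hAB [BW cB] hBB] := sk.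
have vK : v \notin K by apply: contra vB; apply: (subsetP KB).
have ex i : exists A' : {set V}, i < r0 -> A' \subset zeros v i /\ #|A'| = m.
  case: (ltnP i r0) => [lt|]; last by exists set0.
  by have [A' sA cA] := subset_of_card (hz i lt); exists A'.
have [A' hA'] : exists A' : nat -> {set V}, forall i, i < r0 ->
    A' i \subset zeros v i /\ #|A' i| = m.
  have ex2 i : exists A' : {set V}, (i < r0) ==> ((A' \subset zeros v i) && (#|A'| == m)).
    by have [S hS] := ex i; exists S; apply/implyP=> /hS[-> /eqP->].
  exists (fun i => xchoose (ex2 i)) => i lt.
  by have /implyP/(_ lt)/andP[? /eqP] := xchooseP (ex2 i).
have := @skeleton_ineq (iota 0 r0) A' m (v |: K) (iota_uniq _ _).
rewrite size_iota subnn mul0n mul0n addn0 dsum_setU1 // cardsU1 vK add1n.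
have cK : {in K &, forall x y, x != y -> c x y = d}.
  by move=> x y xK yK; apply: hBB; apply: (subsetP KB).
rewrite (dsum_clique c0 cK); apply => //.
- move=> i; rewrite mem_iota add0n => lt; have [sz cz] := hA' i lt.
  have sA : A' i \subset A i.
    by apply: (subset_trans sz); apply/subsetP=> x; rewrite inE => /andP[].
  have [dAB zAB] := hAB i lt.
  split=> //.
    rewrite disjoint_sym disjoints_subset; apply/subsetP=> x xA.
    rewrite in_setC in_setU1 negb_or; apply/andP; split.
      by apply: contraNneq (vA i lt) => <-; apply: (subsetP sA).
    apply: contraTN dAB => xK; apply/pred0Pn; exists x => /=.
    by rewrite (subsetP sA) // (subsetP KB).
  move=> x y /setU1P[->|xK] yA.
    by have := subsetP sz _ yA; rewrite inE => /andP[_ /eqP].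
  by rewrite csym zAB ?(subsetP sA) ?(subsetP KB).
- by rewrite subUset sub1set vW (subset_trans KB).
- have := subset_leq_card KB; rewrite cB.
  have : r0 * m <= r0 * I by rewrite leq_mul2l lem orbT.
  lia.
Qed.

Lemma zeros1 v y : outside v -> (forall i, i < r0 -> 0 < #|zeros v i|) ->
  y \in B -> 0 < c v y.
Proof.
move=> ov hz yB; have := @zeros_ineq v 1 [set y] ov (lvl_gt0 _ _).
rewrite sub1set => /(_ yB hz); rewrite cards1 deg1 dualB_small //; lia.
Qed.

Lemma zeros_d v y : outside v -> (forall i, i < r0 -> d <= #|zeros v i|) ->
  y \in B -> d <= c v y.
Proof.
move=> ov hz yB; have led : d <= I by apply: leq_lvl.
have := @zeros_ineq v d [set y] ov led.
rewrite sub1set => /(_ yB hz); rewrite cards1 deg1 dualB_small //; lia.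
Qed.

(** For K = B, [dualB_lvl] cancels the contribution of B; what remains is a single vertex at slope
    I. *)
Lemma zeros_lvl v : outside v -> (forall i, i < r0 -> I <= #|zeros v i|) ->
  I <= deg v B.
Proof.
move=> ov hz; have [_ _ _ [_ cB] _] := sk.
have := zeros_ineq ov (leqnn I) (subxx B) hz; rewrite cB.
have := dualB_lvl rd_gt0 d_gt0; nia.
Qed.

Variable R : nat.
Hypothesis eR : R = r0 + rd.

(** For [d < a] the multiplicities of the pattern are [a.+1 - defic], with loops on the diagonal;
    see [turan_pattern_defic]. *)
Definition defic (p q : 'I_R) : nat :=
  if p == q then (if p < r0 then 1 else d.+1)
  else if (p < r0) || (q < r0) then 0 else d.

Definition part (p : 'I_R) : {set V} :=
  if p < r0 then A p else [set x | (x \in B) && (index x (enum B) == p - r0)].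

Lemma part_A (p : 'I_R) : p < r0 -> part p = A p.
Proof. by rewrite /part => ->. Qed.

Lemma part_B (p : 'I_R) : r0 <= p -> exists2 y, y \in B & part p = [set y].
Proof.
have [_ _ _ [_ cB] _] := sk.
move=> le; have lt : p - r0 < size (enum B).
  by rewrite -cardE cB; have := ltn_ord p; lia.
have [y0 _] : exists y, y \in B by apply/set0Pn; rewrite -card_gt0 cB.
have yB : nth y0 (enum B) (p - r0) \in B by rewrite -mem_enum mem_nth.
exists (nth y0 (enum B) (p - r0)) => //.
rewrite /part ltnNge le /=; apply/setP=> x; rewrite in_set in_set1.
apply/andP/eqP => [[xB /eqP <-]|->]; first by rewrite nth_index // mem_enum.
by rewrite index_uniq ?enum_uniq.
Qed.

Lemma part_inB y : y \in B -> exists2 p : 'I_R, r0 <= p & part p = [set y].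
Proof.
have [_ _ _ [_ cB] _] := sk.
move=> yB; have lt : r0 + index y (enum B) < R.
  by rewrite eR ltn_add2l -cB cardE index_mem mem_enum.
have le : r0 <= Ordinal lt by rewrite /= leq_addr.
exists (Ordinal lt) => //; have [z zB e] := part_B le.
have eyz : index z (enum B) = index y (enum B).
  by have := set11 z; rewrite -e /part ltnNge le /= inE addKn => /andP[_ /eqP].
rewrite e; congr [set _]; rewrite -(nth_index z (s := enum B) (x := z)) ?mem_enum //.
by rewrite eyz nth_index // mem_enum.
Qed.

Lemma part_inj (p q : 'I_R) y : r0 <= p -> r0 <= q -> y \in part p -> y \in part q -> p = q.
Proof.
move=> lep leq; rewrite /part !ltnNge lep leq /= !inE => /andP[_ /eqP e1] /andP[_ /eqP e2].
by apply: val_inj => /=; lia.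
Qed.

Lemma card_part p : #|part p| = if p < r0 then t else 1.
Proof.
case: ltnP => [lt|le]; first by rewrite part_A //; have [hA _ _ _ _] := sk; case: (hA p lt).
by have [y _ ->] := part_B le; rewrite cards1.
Qed.

Lemma part_sub p : part p \subset W.
Proof.
have [hA _ _ [BW _] _] := sk.
case: (ltnP p r0) => [lt|le]; first by rewrite part_A //; case: (hA p lt).
by have [y yB ->] := part_B le; rewrite sub1set (subsetP BW).
Qed.

Definition free v := v \in W :\: \bigcup_p part p.

Lemma free_outside v : free v -> outside v.
Proof.
case/setDP=> vW /bigcupP no; split=> //.
  move=> i lt; apply/negP=> vA; apply: no.
  have ltR : i < R by rewrite eR (leq_trans lt) ?leq_addr.
  by exists (Ordinal ltR) => //; rewrite part_A.
by apply/negP=> /part_inB[p _ e]; apply: no; exists p; rewrite ?e ?set11.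
Qed.

(** Distinguish by the zeros of v in the parts of level 0. A part with none serves as p; a part with
    some but fewer than I is the second alternative. With at least I in each, v has deficiency at
    least I = d rd + 1 to B, so more than d to some y, whose part serves as p. *)
Lemma classify v : free v ->
  (exists p, forall q, {in part q, forall x, defic p q <= c v x}) \/
  (exists2 p : 'I_R, p < r0 & #|[set x in part p | c v x == 0]| < I /\
     forall q : 'I_R, r0 <= q -> {in part q, forall x, 0 < c v x}).
Proof.
move=> fv; have ov := free_outside fv; have [_ _ _ [_ cB] _] := sk.
have sR i : i < r0 -> i < R by move/leq_trans; apply; rewrite eR leq_addr.
case: (boolP [exists i : 'I_r0, #|zeros v i| == 0]) => [/existsP[i /eqP/cards0_eq z0]|].
  left; exists (Ordinal (sR i (ltn_ord i))) => q x.
  rewrite /defic /= ltn_ord /=; case: eqP => [<-|//].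
  rewrite part_A //= => xA; rewrite lt0n; apply/negP=> e.
  by have := in_set0 x; rewrite -z0 inE xA e.
rewrite negb_exists => /forallP no0.
have z1 i : i < r0 -> 0 < #|zeros v i|.
  by move=> lt; rewrite lt0n; apply: (no0 (Ordinal lt)).
case: (boolP [exists i : 'I_r0, #|zeros v i| < I]) => [/existsP[i lt]|].
  right; exists (Ordinal (sR i (ltn_ord i))); first exact: (ltn_ord i).
  split; first by rewrite part_A /= ?(ltn_ord i).
  move=> q le x; have [y yB ->] := part_B le; rewrite inE => /eqP->.
  exact: zeros1.
rewrite negb_exists => /forallP noI; left.
have zI i : i < r0 -> I <= #|zeros v i|.
  by move=> lt; rewrite leqNgt; apply: (noI (Ordinal lt)).
have zd i : i < r0 -> d <= #|zeros v i|.
  by move=> /zI; apply: leq_trans; exact: leq_lvl.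
have [y yB lt] : exists2 y, y \in B & d < c v y.
  have := zeros_lvl ov zI; case: (pickP [pred y | (y \in B) && (d < c v y)]).
    by move=> y /andP[yB lt] _; exists y.
  move=> none; rewrite leqNgt => /negP[].
  rewrite /lvl addn1 ltnS mulnC -cB -sum_nat_const; apply: leq_sum => y yB.
  by have := none y; rewrite /= yB /= => /negbT; rewrite -leqNgt.
have [p lep ep] := part_inB yB.
exists p => q x xq; rewrite /defic [p < r0]ltnNge lep /=.
case: eqP => [epq|_]; first by move: xq; rewrite -epq ep inE => /eqP->.
case: ltnP => // leq; have [z zB ez] := part_B leq.
by move: xq; rewrite ez inE => /eqP->; apply: zeros_d.
Qed.

Hypothesis le_t : I <= t.

(** Where the pattern prescribes a positive deficiency, a test set containing u and v, with strips
    of the skeleton attached, would be too cheap if [c u v] were smaller. *)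
Lemma typed_pair u v p q : free u -> free v -> u != v ->
  (forall q', {in part q', forall x, c u x = defic p q'}) ->
  (forall q', {in part q', forall x, c v x = defic q q'}) ->
  defic p q <= c u v.
Proof.
move=> fu fv ne tu tv; have [hA hAA hAB [BW cB] hBB] := sk.
have [uW uA uB] := free_outside fu; have [vW vA vB] := free_outside fv.
have sR i : i < r0 -> i < R by move/leq_trans; apply; rewrite eR leq_addr.
have exA th i : th <= t -> exists A' : {set V},
    (i < r0) ==> ((A' \subset A i) && (#|A'| == th)).
  move=> le; case: (ltnP i r0) => [lt|_]; last by exists set0.
  have [_ cA _] := hA i lt.
  by have [|A' sA /eqP cA'] := @subset_of_card _ (A i) th; [rewrite cA | exists A'; rewrite sA cA'].
have zA th (le : th <= t) (Y : {set V}) js : uniq js ->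
  {in js, forall i, i < r0 /\ {in Y & A i, forall x y, c x y = 0}} -> 
  (forall i, i < r0 -> [disjoint Y & A i]) ->
  th <= I -> Y \subset W -> #|Y| + size js * th <= r0 * I + rd + 1 ->
  2 * th * #|Y| <= dsum Y + (r0 - size js) * th * th.+1 + 2 * dual th.
  move=> ujs hjs dY; apply: (@skeleton_ineq js (fun i => xchoose (exA th i le))) => //.
  move=> i /hjs[lt z]; have /implyP/(_ lt)/andP[sA /eqP cA] := xchooseP (exA th i le).
  split=> //; first exact: disjointWr sA (dY i lt).
  by move=> x y xY yA; apply: z => //; apply: (subsetP sA).
have disA Y i : i < r0 -> {in Y, forall x, x = u \/ x = v \/ x \in B} -> [disjoint Y & A i].
  move=> lt hY; rewrite disjoints_subset; apply/subsetP=> x /hY; rewrite in_setC.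
  case=> [->|[->|xB]]; [exact: uA|exact: vA|].
  apply/negP=> xA; have [dAB _] := hAB i lt.
  by move: dAB => /pred0P/(_ x); rewrite /= xA xB.
have [y0 y0B] : exists y, y \in B by apply/set0Pn; rewrite -card_gt0 cB.
have I_gt0 := lvl_gt0 rd d.
have cuA i x : i < r0 -> x \in A i -> c u x = (p == i :> nat).
  move=> lt xA; rewrite (tu (Ordinal (sR i lt))) ?part_A // /defic -val_eqE /=.
  by case: eqP => [->|_]; rewrite lt ?orbT.
have cvA i x : i < r0 -> x \in A i -> c v x = (q == i :> nat).
  move=> lt xA; rewrite (tv (Ordinal (sR i lt))) ?part_A // /defic -val_eqE /=.
  by case: eqP => [->|_]; rewrite lt ?orbT.
have t_gt0 : 0 < t by apply: leq_trans le_t.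
rewrite /defic; case: (ltnP p r0) => [ltp|lep]; last first.
  rewrite orFb; case: (ltnP q r0) => [ltq|leq].
    by case: eqP => // epq; move: ltq; rewrite -epq ltnNge lep.
  have pne i : i < r0 -> (p == i :> nat) = false.
    by move/leq_trans/(_ lep); rewrite ltn_neqAle eq_sym => /andP[/negbTE].
  have qne i : i < r0 -> (q == i :> nat) = false.
    by move/leq_trans/(_ leq); rewrite ltn_neqAle eq_sym => /andP[/negbTE].
  case: eqP => [epq|npq].
    (* Test set: B with y replaced by both u and v, at slope I, against [dualB_lvl]. *)
    have [y yB ey] := part_B lep.
    have cub z : z \in B -> c u z = if z == y then d.+1 else d.
      move=> zB; have [q' leq' eq'] := part_inB zB.
      rewrite (tu q') ?eq' ?set11 // /defic ltnNge lep ltnNge leq' /=.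
      case: eqP => [e|ne']; first by move: eq'; rewrite -e ey => /set1_inj <-; rewrite eqxx.
      case: eqP => // ezy; case: ne'; apply: (@part_inj _ _ y) => //.
        by rewrite ey set11.
      by rewrite eq' ezy set11.
    have cvb z : z \in B -> c v z = if z == y then d.+1 else d.
      move=> zB; rewrite -cub //; have [q' leq' eq'] := part_inB zB.
      by rewrite (tv q') ?(tu q') ?eq' ?set11 // epq.
    have vY : v \notin B :\ y by apply: contra vB => /setD1P[].
    have uY : u \notin v |: (B :\ y).
      by rewrite in_setU1 negb_or ne; apply: contra uB => /setD1P[].
    have cY : #|B :\ y|.+1 = rd by rewrite -cB (cardsD1 y B) yB.
    have := @zA I le_t (u |: (v |: (B :\ y))) (iota 0 r0) (iota_uniq _ _).
    rewrite size_iota subnn !mul0n addn0 !dsum_setU1 // !cardsU1 vY uY.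
    rewrite deg_setU1 // (deg_const (e := d)); last first.
      by move=> z /setD1P[zy zB]; rewrite cvb // (negbTE zy).
    rewrite (deg_const (e := d)); last first.
      by move=> z /setD1P[zy zB]; rewrite cub // (negbTE zy).
    rewrite (dsum_clique c0 (e := d)); last first.
      by move=> z z' /setD1P[_ zB] /setD1P[_ zB']; apply: hBB.
    move=> H; have {}H := H _ _ (leqnn _) _ _.
    have {}H : 2 * I * (1 + (1 + #|B :\ y|)) <=
      #|B :\ y| * (#|B :\ y|.-1 * d) + 2 * (#|B :\ y| * d) +
      2 * (c u v + #|B :\ y| * d) + 2 * dual I.
      apply: H.
      - move=> i; rewrite mem_iota add0n => lt; split=> // x z + zA'.
        case/setU1P=> [->|/setU1P[->|/setD1P[_ xB]]].
        + by rewrite (cuA _ _ lt zA') pne.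
        + by rewrite (cvA _ _ lt zA') qne.
        + by rewrite csym; have [_ ->] := hAB i lt.
      - move=> i lt; apply: disA => // x /setU1P[->|/setU1P[->|/setD1P[_ xB]]]; auto.
      - by rewrite !subUset !sub1set uW vW (subset_trans (subsetDl _ _)).
      - by rewrite add1n add1n cY addnC -addn1 addnA.
    have eI : I = d * rd + 1 by [].
    move: H (dualB_lvl rd_gt0 d_gt0) cY eI.
    move: (c u v) (#|B :\ y|) I (dual I) => e k J D H1 H2 cY eJ.
    move: H1 H2; rewrite eJ -cY /=; clear; case: k => [|k] /=; lia.
  (* Test set {u, v} at slope d, where h(d) = d. *)
  have := @zA d _ [set u; v] (iota 0 r0) (iota_uniq _ _).
  rewrite size_iota subnn !mul0n addn0 dsum_setU1 ?inE // dsum1 // deg1 cards2 ne.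
  rewrite dualB_small // => H.
  have led : d <= I by apply: leq_lvl.
  have {}H : 2 * d * 2 <= 0 + 2 * c u v + 2 * d.
    apply: H => //; first exact: leq_trans le_t.
    - move=> i; rewrite mem_iota add0n => lt; split=> // x z + zA'.
      by case/set2P=> ->; rewrite ?(cuA _ _ lt zA') ?(cvA _ _ lt zA') ?pne ?qne.
    - by move=> i lt; apply: disA => // x /set2P[]->; auto.
    - by rewrite subUset !sub1set uW.
    - have : r0 * d <= r0 * I by rewrite leq_mul2l led orbT.
      clear -rd_gt0; lia.
  move: H; clear; lia.
case: eqP => [epq|//].
have cub : c u y0 = 0.
  have [q' leq' eq'] := part_inB y0B; rewrite (tu q') ?eq' ?set11 // /defic ltp /=.
  by case: eqP => // e; move: leq'; rewrite -e leqNgt ltp.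
have cvb : c v y0 = 0.
  have [q' leq' eq'] := part_inB y0B; rewrite (tv q') ?eq' ?set11 // -epq /defic ltp /=.
  by case: eqP => // e; move: leq'; rewrite -e leqNgt ltp.
have vY : v \notin [set y0] by rewrite inE; apply: contraNneq vB => ->.
have uY : u \notin v |: [set y0].
  by rewrite !inE negb_or ne; apply: contraNneq uB => ->.
(* Slope 1, attaching every part of level 0 but p. The vertex [y0] gains 2, which cancels
   [2 * dual 1]; {u, v} alone would give nothing. *)
have := @zA 1 t_gt0 (u |: (v |: [set y0])) (rem (p : nat) (iota 0 r0)) (rem_uniq _ (iota_uniq _ _)).
rewrite size_rem ?mem_iota // size_iota !dsum_setU1 // !cardsU1 vY uY cards1.
rewrite deg_setU1 // !deg1 dsum1 // cub cvb dualB_small // => H.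
have {}H : 2 * 1 * (1 + (1 + 1)) <= 0 + 2 * 0 + 2 * (c u v + 0) + (r0 - r0.-1) * 1 * 2 + 2 * 1.
  apply: H => //.
  - move=> i; rewrite rem_filter ?iota_uniq // mem_filter mem_iota add0n => /andP[/= nip lt].
    split=> // x z + zA'; case/setU1P=> [->|/setU1P[->|/set1P->]].
    + by rewrite (cuA _ _ lt zA') eq_sym (negbTE nip).
    + by rewrite (cvA _ _ lt zA') -epq eq_sym (negbTE nip).
    + by rewrite csym; have [_ ->] := hAB i lt.
  - by move=> i lt; apply: disA => // x /setU1P[->|/setU1P[->|/set1P->]]; auto.
  - by rewrite !subUset !sub1set uW vW (subsetP BW).
  - have : r0 <= r0 * I by rewrite leq_pmulr.
    by clear -rd_gt0 ltp; lia.
by move: H ltp; clear; lia.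
Qed.
End Classify.

Local Open Scope ring_scope.

(** * Losses and the quadratic form of the pattern *)

Section Loss.
Variables (R : realType) (a : nat).
Hypothesis a_gt0 : (0 < a)%N.

Definition unit_loss : R := ln a.+1%:R - ln a%:R.

(* Normalised so that the multiplicity a has loss 1. *)
Definition loss (w : nat) : R := (ln a.+1%:R - ln w%:R) / unit_loss.

Lemma ln_le_sub1 (x : R) : 0 < x -> ln x <= x - 1.
Proof. by move=> x_gt0; rewrite -[x in ln x](addrNK 1) addrC le_ln1Dx //; lra. Qed.

Lemma ln_ratio_le (x y : R) : 0 < x -> 0 < y -> ln x - ln y <= (x - y) / y.
Proof.
move=> x_gt0 y_gt0; rewrite -ln_div ?posrE //.
apply: le_trans (ln_le_sub1 _) _; first exact: divr_gt0.
by rewrite mulrBl divff ?gt_eqF.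
Qed.

Lemma unit_loss_gt0 : 0 < unit_loss.
Proof. by rewrite subr_gt0 ltr_ln ?posrE ?ltr0n // ltr_nat. Qed.

Lemma unit_loss_ge : a.+1%:R^-1 <= unit_loss.
Proof.
have h : ln a%:R - ln a.+1%:R <= (a%:R - a.+1%:R) / a.+1%:R :> R.
  by apply: ln_ratio_le; rewrite ltr0n.
rewrite /unit_loss -opprB lerNr; apply: le_trans h _.
by rewrite -natr1 opprD addNKr mulN1r.
Qed.

(** ln (1 + 1 / w) decreases in w. *)
Lemma unit_loss_le w : (0 < w)%N -> (w <= a)%N -> unit_loss <= ln w.+1%:R - ln w%:R.
Proof.
move=> w_gt0 le_wa; rewrite /unit_loss -!ln_div ?posrE ?ltr0n //.
rewrite ler_ln ?posrE ?divr_gt0 ?ltr0n //.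
have a0 : (0 : R) < a%:R by rewrite ltr0n.
have w0 : (0 : R) < w%:R by rewrite ltr0n.
rewrite -!natr1 !mulrDl !divff ?gt_eqF // lerD2l !mul1r lef_pV2 ?posrE //.
by rewrite ler_nat.
Qed.

Lemma lossE w : ln w%:R = ln a.+1%:R - unit_loss * loss w.
Proof.
by rewrite /loss mulrCA divff ?mulr1 ?gt_eqF ?unit_loss_gt0 // subKr.
Qed.

Lemma loss_top : loss a.+1 = 0.
Proof. by rewrite /loss subrr mul0r. Qed.

Lemma loss1 : loss a = 1.
Proof. by rewrite /loss divff // gt_eqF ?unit_loss_gt0. Qed.

Lemma loss_step w : (0 < w)%N -> (w <= a)%N -> loss w.+1 + 1 <= loss w.
Proof.
move=> w_gt0 le_wa; have u0 := unit_loss_gt0.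
rewrite -(ler_pM2l u0) mulrDr mulr1.
have := unit_loss_le w_gt0 le_wa; rewrite (lossE w) (lossE w.+1).
by set x := loss w; set y := loss w.+1 => h; lra.
Qed.

Lemma loss_le w w' : (0 < w)%N -> (w <= w' <= a.+1)%N ->
  loss w' + (w' - w)%:R <= loss w.
Proof.
move=> w_gt0; elim: w' => [|w' IH] /andP[le1 le2].
  by rewrite leqn0 in le1; rewrite (eqP le1) in w_gt0.
move: le1; rewrite leq_eqVlt => /orP[/eqP->|]; first by rewrite subnn addr0.
rewrite ltnS => le1; have le_w : (w <= w' <= a.+1)%N by rewrite le1 ltnW.
apply: le_trans (IH le_w); rewrite subSn // -natr1 addrCA [loss w' + _]addrC lerD2l.
by apply: loss_step => //; apply: leq_trans le1.
Qed.

(** Above a + 1 losses are negative, but ln x <= x - 1 at x = w / (a + 1) and [unit_loss_ge] keep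
    them above the line. *)
Lemma loss_ge w : (0 < w)%N -> a.+1%:R - w%:R <= loss w.
Proof.
move=> w_gt0; case: (leqP w a.+1) => [le|lt].
  by have := @loss_le w a.+1 w_gt0; rewrite le leqnn loss_top add0r natrB // => ->.
have u0 := unit_loss_gt0; have uge := unit_loss_ge.
have w0 : (0 : R) < w%:R by rewrite ltr0n.
rewrite -(ler_pM2l u0) /loss mulrCA divff ?mulr1 ?gt_eqF //.
have h : ln w%:R - ln a.+1%:R <= (w%:R - a.+1%:R) / a.+1%:R :> R.
  by apply: ln_ratio_le; rewrite ltr0n.
rewrite -lerN2 -mulrN !opprB; apply: le_trans h _; rewrite mulrC.
apply: ler_wpM2r => //; by rewrite subr_ge0 ler_nat ltnW.
Qed.

Definition gap (j : nat) : R := loss (a.+1 - j).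

Lemma gap0 : gap 0 = 0. Proof. by rewrite /gap subn0 loss_top. Qed.
Lemma gap1 : gap 1 = 1. Proof. by rewrite /gap subn1 loss1. Qed.

Lemma gap_le j k : (j <= k <= a)%N -> gap j + (k - j)%:R <= gap k.
Proof.
move=> /andP[le1 le2].
have := @loss_le (a.+1 - k) (a.+1 - j); rewrite /gap.
have -> : (a.+1 - j - (a.+1 - k) = k - j)%N by lia.
by apply; [rewrite subn_gt0 | rewrite leq_sub2l //= leq_subr].
Qed.

Lemma gap_upper j : (j <= a)%N -> gap j <= j%:R * (a.+1%:R / (a.+1 - j)%:R).
Proof.
move=> le; have lt : (0 < a.+1 - j)%N by rewrite subn_gt0.
have u0 := unit_loss_gt0; have uge := unit_loss_ge.
have x0 : (0 : R) < (a.+1 - j)%:R by rewrite ltr0n.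
have a0 : (0 : R) < a.+1%:R by rewrite ltr0n.
rewrite /gap /loss ler_pdivrMr //.
have h : ln a.+1%:R - ln (a.+1 - j)%:R <= (a.+1%:R - (a.+1 - j)%:R) / (a.+1 - j)%:R :> R.
  by apply: ln_ratio_le.
apply: le_trans h _; rewrite natrB 1?ltnW // opprB addrCA subrr addr0 -natrB 1?ltnW //.
rewrite -mulrA ler_wpM2l // mulrAC.
rewrite -[X in X <= _]mul1r ler_wpM2r ?invr_ge0 ?(ltW x0) //.
by rewrite mulrC -ler_pdivrMr // div1r.
Qed.
End Loss.

Section RealSums.
Variables (R : realType) (V : finType) (F : V -> V -> R).
Hypotheses (Fsym : forall u v, F u v = F v u) (F0 : forall u, F u u = 0).
Implicit Types X Y : {set V}.

Definition rdeg v X := \sum_(x in X) F v x.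
Definition rsum X := \sum_(x in X) rdeg x X.

Lemma rdegU1 v x X : x \notin X -> rdeg v (x |: X) = F v x + rdeg v X.
Proof. by move=> xX; rewrite /rdeg big_setU1. Qed.

Lemma rsumU1 x X : x \notin X -> rsum (x |: X) = rsum X + 2 * rdeg x X.
Proof.
move=> xX; rewrite /rsum big_setU1 //= rdegU1 // F0 add0r.
under eq_bigr do rewrite rdegU1 //.
rewrite big_split /=.
have -> : \sum_(i in X) F i x = rdeg x X by apply: eq_bigr => y _; rewrite Fsym.
rewrite /rsum; ring.
Qed.

Lemma sum_rdeg X Y : \sum_(x in X) rdeg x Y = \sum_(y in Y) rdeg y X.
Proof.
rewrite exchange_big; apply: eq_bigr => y _; apply: eq_bigr => x _; exact: Fsym.
Qed.

Lemma rsumD1 x X : x \in X -> rsum X = rsum (X :\ x) + 2 * rdeg x X.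
Proof.
move=> xX; rewrite -{1}(setD1K xX) rsumU1 ?setD11 //; congr (_ + 2 * _).
by rewrite /rdeg [RHS](big_setD1 x xX) /= F0 add0r.
Qed.
End RealSums.

(** * Quadratic forms with a critical point on the simplex *)

Section Quadratic.
Variables (R : realType) (U : finType) (gam : U -> U -> R) (z : U -> R) (lam : R).
Hypotheses (gsym : forall p q, gam p q = gam q p).
Hypotheses (gz : forall p, \sum_q gam p q * z q = lam) (z1 : \sum_p z p = 1).
Hypothesis z_ge0 : forall p, 0 <= z p.
Hypothesis gPD : forall x : U -> R,
  \sum_p x p ^+ 2 <= \sum_p \sum_q gam p q * x p * x q.

(* z is a critical point of the quadratic form on the simplex, where the form
   takes the value lam. *)
Lemma quad_lower (n : U -> R) N : N = \sum_p n p ->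
  lam * N ^+ 2 + \sum_p (n p - z p * N) ^+ 2 <= \sum_p \sum_q gam p q * n p * n q.
Proof.
move=> eN; have := gPD (fun p => n p - z p * N).
have -> : \sum_p \sum_q gam p q * (n p - z p * N) * (n q - z q * N) =
  \sum_p \sum_q gam p q * n p * n q - lam * N ^+ 2; last by lra.
have e1 p : \sum_q gam p q * (n p - z p * N) * (n q - z q * N) =
  \sum_q gam p q * n p * n q - N * \sum_q gam q p * z p * n q
   - (n p - z p * N) * N * lam.
  rewrite -(gz p) !mulr_sumr -!sumrB; apply: eq_bigr => q _.
  rewrite (gsym q p); ring.
rewrite (eq_bigr _ (fun p _ => e1 p)) !sumrB -mulr_suml -mulr_suml -mulr_sumr.
rewrite sumrB -mulr_suml z1 -eN mul1r subrr mul0r mul0r subr0; congr (_ - _).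
rewrite exchange_big /=.
have -> : \sum_j \sum_i gam j i * z i * n j = \sum_j lam * n j.
  by apply: eq_bigr => j _; rewrite -mulr_suml gz.
by rewrite -mulr_sumr -eN; ring.
Qed.

Variable V : finType.

Definition bloss (f : V -> U) u v := if u == v then 0 else gam (f u) (f v).

Lemma bloss_sym f u v : bloss f u v = bloss f v u.
Proof. by rewrite /bloss eq_sym gsym. Qed.

Lemma bloss0 f u : bloss f u u = 0.
Proof. by rewrite /bloss eqxx. Qed.

(** Each vertex joins the class of least loss to those already placed; for m placed vertices the
    z-average of these losses is lam m. *)
Lemma greedy (p0 : U) (X : {set V}) : exists f : V -> U,
  rsum (bloss f) X <= lam * (#|X|%:R * (#|X|%:R - 1)).
Proof.
elim: {X}#|X| {-2}X (erefl #|X|) => [|m IH] X cX.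
  exists (fun=> p0); move/eqP: cX; rewrite cards_eq0 => /eqP->.
  by rewrite /rsum big_set0 cards0 mul0r mulr0.
have [x xX] : exists x, x \in X by apply/set0Pn; rewrite -card_gt0 cX.
have cY : #|X :\ x| = m by have := cardsD1 x X; rewrite xX cX => -[].
have [f hf] := IH _ cY; set Y := X :\ x in cY hf *.
pose D p := \sum_(v in Y) gam p (f v).
have [p hp] : exists p, D p <= lam * m%:R.
  exists [arg min_(p < p0) D p]%O; case: arg_minP => // p _ hmin.
  have -> : lam * m%:R = \sum_q z q * D q.
    under eq_bigr do rewrite mulr_sumr.
    rewrite exchange_big /= -cY mulr_natr -sumr_const.
    by apply: eq_bigr => v _; rewrite -(gz (f v)); apply: eq_bigr => q _; rewrite gsym mulrC.
  rewrite -[D p]mul1r -z1 mulr_suml; apply: ler_sum => q _.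
  by rewrite ler_wpM2l // hmin.
exists (fun v => if v == x then p else f v).
rewrite (rsumD1 (@bloss_sym _) (@bloss0 _) xX) -/Y cX.
have -> : rsum (bloss (fun v => if v == x then p else f v)) Y = rsum (bloss f) Y.
  apply: eq_bigr => u /setD1P[ux _]; apply: eq_bigr => v /setD1P[vx _].
  by rewrite /bloss (negbTE ux) (negbTE vx).
have -> : rdeg (bloss (fun v => if v == x then p else f v)) x X = D p.
  rewrite /rdeg (big_setD1 x) //= bloss0 add0r; apply: eq_bigr => v /setD1P[vx _].
  by rewrite /bloss eq_sym (negbTE vx) eqxx.
have : 2 * D p <= 2 * (lam * m%:R) by rewrite ler_pM2l.
move: hf; rewrite cY -(natr1 m); move: (rsum _ _) (D p) m%:R => s t k; nra.
Qed.

Lemma rsum_bloss f (X : {set V}) (n := fun p => #|[set v in X | f v == p]|%:R : R) :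
  rsum (bloss f) X = \sum_p \sum_q gam p q * n p * n q - \sum_p n p * gam p p.
Proof.
have rd v : v \in X -> rdeg (bloss f) v X = \sum_q gam (f v) q * n q - gam (f v) (f v).
  move=> vX; rewrite /rdeg (big_setD1 v) //= bloss0 add0r.
  have -> : \sum_(i in X :\ v) bloss f v i = \sum_(i in X :\ v) gam (f v) (f i).
    by apply: eq_bigr => u /setD1P[uv _]; rewrite /bloss eq_sym (negbTE uv).
  have -> : \sum_q gam (f v) q * n q = \sum_(i in X) gam (f v) (f i).
    rewrite (partition_big f xpredT) //=; apply: eq_bigr => q _.
    rewrite (eq_bigr (fun=> gam (f v) q)) => [|i /andP[_ /eqP->]//].
    rewrite (eq_bigl (fun i => i \in [set v in X | f v == q])) => [|i]; last by rewrite inE.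
    by rewrite sumr_const mulr_natr.
  by rewrite [in RHS](big_setD1 v) //= addrC addrK.
rewrite /rsum (eq_bigr _ rd) sumrB; congr (_ - _).
  rewrite (partition_big f xpredT) //=; apply: eq_bigr => p _.
  rewrite (eq_bigr (fun=> \sum_q gam p q * n q)) => [|i /andP[_ /eqP->]//].
  rewrite (eq_bigl (fun i => i \in [set v in X | f v == p])) => [|i]; last by rewrite inE.
  rewrite sumr_const -mulr_natr mulr_suml; apply: eq_bigr => q _.
  by rewrite -/(n p); ring.
rewrite (partition_big f xpredT) //=; apply: eq_bigr => p _.
rewrite (eq_bigr (fun=> gam p p)) => [|i /andP[_ /eqP->]//].
rewrite (eq_bigl (fun i => i \in [set v in X | f v == p])) => [|i]; last by rewrite inE.
by rewrite sumr_const -mulr_natr mulrC.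
Qed.

Lemma sum_fibers f (X : {set V}) :
  \sum_(p : U) (#|[set v in X | f v == p]|%:R : R) = #|X|%:R.
Proof.
rewrite -natr_sum -sum1_card (partition_big f xpredT) //=; congr (_%:R).
apply: eq_bigr => p _; rewrite -sum1_card; apply: eq_bigl => v; by rewrite inE.
Qed.

Lemma rsum_bloss_lower f (X : {set V}) g : (forall p, gam p p <= g) ->
  lam * #|X|%:R ^+ 2 + \sum_p (#|[set v in X | f v == p]|%:R - z p * #|X|%:R) ^+ 2
    <= rsum (bloss f) X + g * #|X|%:R.
Proof.
move=> leg; rewrite rsum_bloss.
have := quad_lower (esym (sum_fibers f X)).
have : \sum_p #|[set v in X | f v == p]|%:R * gam p p <= g * #|X|%:R.
  rewrite -(sum_fibers f) mulr_sumr; apply: ler_sum => p _.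
  by rewrite mulrC ler_wpM2r.
lra.
Qed.
End Quadratic.

Lemma lvlE rd d : (0 < rd)%N -> lvl rd d = (rd.-1 * d + d.+1)%N.
Proof. by case: rd => // k _; rewrite /lvl /= mulnS [(d * k)%N]mulnC addn1 addnC addnS. Qed.

(** * The quadratic form of the pattern *)

Section PatternForm.
Variables (R : realType) (r0 rd d m a : nat).
Hypotheses (r0_gt0 : (0 < r0)%N) (rd_gt0 : (0 < rd)%N) (d_gt0 : (0 < d)%N).
Hypotheses (em : m = (r0 + rd)%N) (lt_da : (d < a)%N).
Local Notation I := (lvl rd d).
Local Notation U := 'I_m.
Local Notation gap := (gap R a).
Implicit Types p q : U.

Definition gam p q : R := gap (defic d r0 p q).
(* [lam] is the minimum over the simplex of the quadratic form of [gam], attained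
   at [zvec]. *)
Definition bigG : R := (rd.-1)%:R * gap d + gap d.+1.
Definition den : R := r0%:R * bigG + rd%:R.
Definition lam : R := bigG / den.
Definition zvec p : R := if (p < r0)%N then lam else den^-1.

Lemma a_gt0 : (0 < a)%N. Proof. exact: leq_trans lt_da. Qed.

Lemma gap_d : d%:R <= gap d.
Proof.
have := gap_le R a_gt0 (j := 0) (k := d); rewrite gap0 add0r subn0; apply.
exact: ltnW.
Qed.

Lemma gap_d1 : gap d + 1 <= gap d.+1.
Proof.
have := gap_le R a_gt0 (j := d) (k := d.+1); rewrite subSn // subnn; apply.
by rewrite leqnSn.
Qed.

Lemma bigG_ge : I%:R <= bigG.
Proof.
have h1 := gap_d; have h2 := gap_d1.
have e : I%:R = (rd.-1)%:R * d%:R + (d%:R + 1) :> R.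
  by rewrite natr1 -natrM -natrD lvlE.
by rewrite e lerD ?ler_wpM2l //; lra.
Qed.

Lemma bigG_gt0 : 0 < bigG.
Proof. by apply: lt_le_trans bigG_ge; rewrite ltr0n lvl_gt0. Qed.

Lemma den_ge : (r0 * I + rd)%:R <= den.
Proof. by rewrite natrD natrM lerD2r ler_wpM2l // bigG_ge. Qed.

Lemma den_gt0 : 0 < den.
Proof. by apply: lt_le_trans den_ge; rewrite ltr0n addn_gt0 rd_gt0 orbT. Qed.

Lemma lam_gt0 : 0 < lam.
Proof. by rewrite divr_gt0 ?bigG_gt0 ?den_gt0. Qed.

Lemma lam_le1 : lam <= 1.
Proof.
rewrite ler_pdivrMr ?den_gt0 // mul1r /den.
have h : 1 * bigG <= r0%:R * bigG by rewrite ler_pM2r ?bigG_gt0 // ler1n.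
have := ler0n R rd; lra.
Qed.

(** As a function of G, [lam] is I / M at G = I and has difference quotient at most 1 from there. *)
Lemma lam_upper : lam <= I%:R / (r0 * I + rd)%:R + (bigG - I%:R).
Proof.
have M0 : 0 < (r0 * I + rd)%:R :> R by rewrite ltr0n addn_gt0 rd_gt0 orbT.
have D0 := den_gt0; have hG := bigG_ge; have hD := den_ge.
rewrite -subr_ge0.
have -> : I%:R / (r0 * I + rd)%:R + (bigG - I%:R) - lam =
   (bigG - I%:R) * (1 - rd%:R / (den * (r0 * I + rd)%:R)).
  rewrite /lam /den natrD natrM in D0 M0 *.
  by field; rewrite ?lt0r_neq0.
rewrite mulr_ge0 ?subr_ge0 // ler_pdivrMr ?mulr_gt0 // mul1r.
apply: (le_trans (y := den * 1)); last by rewrite ler_wpM2l ?(ltW D0) // ler1n addn_gt0 rd_gt0 orbT.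
rewrite mulr1; apply: le_trans hD; rewrite ler_nat; exact: leq_addl.
Qed.

Lemma gam_sym p q : gam p q = gam q p.
Proof.
rewrite /gam /defic eq_sym orbC; congr gap.
by case: eqP => [->|].
Qed.

Lemma gamE p q : gam p q =
  (p == q)%:R * (if (p < r0)%N then 1 else gap d.+1 - gap d) +
  (if (p < r0)%N || (q < r0)%N then 0 else gap d).
Proof.
rewrite /gam /defic; case: (eqVneq p q) => [->|ne].
  by rewrite mul1r orbb; case: ifP => _; [rewrite gap1 ?addr0 ?a_gt0 | rewrite subrK].
by rewrite mul0r add0r; case: (_ || _); rewrite ?gap0.
Qed.

Lemma sum_U (F : nat -> R) (x y : R) : (forall i, (i < r0)%N -> F i = x) ->
  (forall i, (r0 <= i)%N -> F i = y) -> \sum_(p : U) F p = r0%:R * x + rd%:R * y.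
Proof.
move=> hx hy; rewrite em big_split_ord /=; congr (_ + _).
  rewrite (eq_bigr (fun=> x)) => [|i _]; last by rewrite hx.
  by rewrite sumr_const card_ord mulr_natl.
rewrite (eq_bigr (fun=> y)) => [|i _]; last by rewrite hy //= leq_addr.
by rewrite sumr_const card_ord mulr_natl.
Qed.

Lemma zvec_sum : \sum_p zvec p = 1.
Proof.
rewrite (@sum_U (fun i => if (i < r0)%N then lam else den^-1) lam den^-1).
- rewrite /lam mulrA -mulrDl divff //; exact: lt0r_neq0 den_gt0.
- by move=> i ->.
- by move=> i; rewrite ltnNge => ->.
Qed.

Lemma zvec_gt0 p : 0 < zvec p.
Proof. by rewrite /zvec; case: ifP => _; rewrite ?lam_gt0 ?invr_gt0 ?den_gt0. Qed.

Lemma sum_eq (x : U -> R) p (k : R) : \sum_q (p == q)%:R * k * x q = k * x p.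
Proof.
rewrite (bigD1 p) //= eqxx mul1r big1 ?addr0 // => q ne.
by rewrite eq_sym (negbTE ne) !mul0r.
Qed.

(** A level 0 vertex loses only to its own part, a level d vertex G / den to the parts of level d.
    The weights G : 1 make the two equal. *)
Lemma gam_zvec p : \sum_q gam p q * zvec q = lam.
Proof.
under eq_bigr do rewrite gamE mulrDl.
rewrite big_split /= sum_eq /zvec; case: (ltnP p r0) => [lt|le] /=.
  by rewrite mul1r big1 ?addr0 // => q _; rewrite mul0r.
rewrite (@sum_U (fun i => (if (i < r0)%N then 0 else gap d) *
  (if (i < r0)%N then lam else den^-1)) 0 (gap d * den^-1)).
- rewrite mulr0 add0r mulrA -mulrDl; congr (_ / _).
  rewrite /bigG -[in rd%:R](prednK rd_gt0) -natr1; ring.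
- by move=> i ->; rewrite mul0r.
- by move=> i; rewrite ltnNge => ->.
Qed.

(** The form is a sum of squares with coefficients 1 and gap (d + 1) - gap d, both at least 1, plus
    gap d times the square of the sum over level d. *)
Lemma gam_PD (x : U -> R) : \sum_p x p ^+ 2 <= \sum_p \sum_q gam p q * x p * x q.
Proof.
have h1 := gap_d1; have h0 : 0 <= gap d by apply: le_trans gap_d; rewrite ler0n.
pose y (q : U) := if (q < r0)%N then 0 else x q.
have -> : \sum_p \sum_q gam p q * x p * x q =
  \sum_(p : U) (if (p < r0)%N then 1 else gap d.+1 - gap d) * x p ^+ 2 +
  gap d * (\sum_q y q) ^+ 2.
  have -> : gap d * (\sum_q y q) ^+ 2 = \sum_p \sum_q gap d * y p * y q.
    rewrite expr2 mulr_suml mulr_sumr; apply: eq_bigr => p _.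
    by rewrite !mulr_sumr; apply: eq_bigr => q _; rewrite mulrA.
  rewrite -big_split /=; apply: eq_bigr => p _.
  under eq_bigr do rewrite gamE !mulrDl.
  rewrite big_split /=; congr (_ + _).
    rewrite expr2 mulrA -(sum_eq _ p (_ * x p)); apply: eq_bigr => q _; ring.
  apply: eq_bigr => q _; rewrite /y.
  by case: (p < r0)%N; case: (q < r0)%N => /=; rewrite ?mulr0 ?mul0r.
rewrite -[X in X <= _]addr0; apply: lerD; last by apply: mulr_ge0; rewrite ?sqr_ge0.
apply: ler_sum => p _; rewrite -[X in X <= _]mul1r ler_wpM2r ?sqr_ge0 //.
by case: ifP => // _; lra.
Qed.

Lemma gam_diag p : gam p p <= gap d.+1.
Proof.
rewrite /gam /defic eqxx; case: ifP => _ //.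
rewrite (gap1 _ a_gt0); have := gap_d1; have := gap_d; have := ler0n R d; lra.
Qed.
End PatternForm.

(** By [gap_upper], gap j tends to j, so G tends to (rd - 1) d + d + 1 = I. Besides [d < a], this is
    what [a] being large is for. *)
Lemma bigG_lim (R : realType) (rd d : nat) (eps : R) : (0 < rd)%N -> 0 < eps ->
  exists a0 : nat, forall a, (a0 <= a)%N -> bigG R rd d a <= (lvl rd d)%:R + eps.
Proof.
move=> rd_gt0 eps_gt0; pose C : R := rd%:R * d.+1%:R * d.+1%:R.
exists ((Num.bound (C / eps)).+1 + d.+1)%N => a le_a.
have lt_da : (d < a)%N by apply: leq_trans le_a; rewrite leq_addl.
have a0 : (0 < a)%N by apply: leq_trans lt_da.
have big : C / eps <= (a - d)%:R.
  have C0 : 0 <= C / eps by rewrite divr_ge0 ?mulr_ge0 ?ler0n // ltW.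
  apply: le_trans (ltW (archi_boundP C0)) _; rewrite ler_nat; lia.
have D0 : 0 < (a - d)%:R :> R by rewrite ltr0n subn_gt0.
have gj j : (j <= d.+1)%N -> gap R a j <= j%:R + d.+1%:R * d.+1%:R / (a - d)%:R.
  move=> lej; have leja : (j <= a)%N by apply: leq_trans lej _.
  apply: le_trans (gap_upper R a0 leja) _.
  have J0 : 0 < (a.+1 - j)%:R :> R by rewrite ltr0n subn_gt0 ltnS.
  have -> : a.+1%:R = (a.+1 - j)%:R + j%:R :> R by rewrite -natrD subnK // ltnW.
  rewrite mulrDl divff ?lt0r_neq0 // mulrDr mulr1 lerD2l mulrA.
  rewrite ler_pM ?mulr_ge0 ?invr_ge0 ?ler0n // -?natrM ?ler_nat ?leq_mul //.
  by rewrite lef_pV2 ?posrE // ler_nat; lia.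
have h1 : gap R a d <= _ := gj d (leqnSn d).
have h2 : gap R a d.+1 <= _ := gj d.+1 (leqnn _).
set x := _ / (a - d)%:R in h1 h2.
have hx : rd%:R * x <= eps.
  rewrite /x mulrA ler_pdivrMr // mulrA -ler_pdivrMl //.
  by rewrite mulrC.
have e : (lvl rd d)%:R = (rd.-1)%:R * d%:R + d.+1%:R :> R.
  by rewrite -natrM -natrD lvlE.
rewrite /bigG e.
have h3 : (rd.-1)%:R * gap R a d <= (rd.-1)%:R * (d%:R + x) by rewrite ler_wpM2l.
have e2 : rd%:R = (rd.-1)%:R + 1 :> R by rewrite natr1 prednK.
move: hx h3; rewrite e2 mulrDl mul1r mulrDr; lra.
Qed.

(** * Graphs with bounded loss degrees *)

Section Graph.
Variables (R : realType) (r0 rd d s a q : nat).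
Hypotheses (r0_gt0 : (0 < r0)%N) (rd_gt0 : (0 < rd)%N) (d_gt0 : (0 < d)%N).
Hypotheses (lt_da : (d < a)%N).
Local Notation I := (lvl rd d).
Local Notation M := (r0 * I + rd)%N.
Hypothesis le_s : (M + 1 <= s)%N.
Variables (V : finType) (w : V -> V -> nat).
Hypotheses (wsym : forall u v, w u v = w v u) (wdiag : forall u, w u u = a.+1).
Hypotheses (wpos : forall u v, (0 < w u v)%N) (wq : forall u v, (w u v <= q)%N).
Implicit Types (X Y W : {set V}) (u v x y : V).

Definition wloss u v : R := loss R a (w u v).

Definition wdef u v : nat := (a.+1 - w u v)%N.

Lemma wloss_sym u v : wloss u v = wloss v u.
Proof. by rewrite /wloss wsym. Qed.

Lemma wloss0 u : wloss u u = 0.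
Proof. by rewrite /wloss wdiag loss_top. Qed.

Lemma wdef_sym u v : wdef u v = wdef v u.
Proof. by rewrite /wdef wsym. Qed.

Lemma wdef0 u : wdef u u = 0%N.
Proof. by rewrite /wdef wdiag subnn. Qed.

Let a_gt0 : (0 < a)%N := leq_ltn_trans (leq0n d) lt_da.

Lemma wloss_ge u v : a.+1%:R - (w u v)%:R <= wloss u v.
Proof. exact: loss_ge. Qed.

Lemma wloss_lower u v : - q%:R <= wloss u v.
Proof.
apply: le_trans (wloss_ge u v); rewrite -[X in X <= _]add0r lerB ?ler0n //.
by rewrite ler_nat.
Qed.

(** As the diagonal of [w] is a + 1, [dsum w X] is (a + 1) k^2 minus twice the signed deficiency.
    Truncated deficiencies complement [w] only once multiplicities above a + 1 are excluded. *)
Definition wcons k W := forall X, X \subset W -> #|X| = k -> forall th,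
  (dsum w X + 2 * th * k <= a.+1 * k * k + r0 * th * th.+1 + 2 * dualB rd d th)%N.

Lemma rdeg_ge v X : (a.+1 * #|X|)%:R - (deg w v X)%:R <= rdeg wloss v X.
Proof.
rewrite natrM mulr_natr /deg natr_sum -sumr_const -sumrB.
by apply: ler_sum => x _; apply: wloss_ge.
Qed.

Lemma dsumU1_diag v X : v \notin X ->
  dsum w (v |: X) = (dsum w X + a.+1 + 2 * deg w v X)%N.
Proof.
move=> vX; rewrite dsumU ?disjoints1 // big_set1 {1}/dsum big_set1 deg1 wdiag.
by rewrite addnAC addnC addnA addnC addnA addnAC.
Qed.

(* A k-set violating the bound for some th also violates it for a value of th
   for which every other vertex is too deficient towards it. *)
Lemma descend L W k : (k < s)%N -> wcons k.+1 W ->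
  {in W, forall x, rdeg wloss x W <= L * #|W|%:R} ->
  L <= I%:R / M%:R + (2 * M%:R * s%:R)^-1 ->
  (2 * M * (s * (s + s * q)) < #|W|)%N -> wcons k W.
Proof.
move=> lt_ks cons1 degL leL bigW X XW cX th; rewrite leqNgt; apply/negP.
pose viol th := (a.+1 * k * k + r0 * th * th.+1 + 2 * dualB rd d th
  < dsum w X + 2 * th * k)%N.
rewrite -/(viol th).
(* For th + 1 > k the slope r0 (th + 1) already exceeds k, so lowering th preserves the
   violation. *)
have lower : forall th, viol th -> exists2 th', (th' <= k)%N & viol th'.
  elim=> [|j IH] vj; first by exists 0%N.
  case: (leqP j.+1 k) => [le|lt]; first by exists j.+1.
  apply: IH; move: vj; rewrite /viol dualBS.
  have h1 : (2 * k <= 2 * (r0 * j.+1))%N.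
    by rewrite leq_mul2l /=; apply: leq_trans (leq_pmull _ r0_gt0); rewrite ltnW.
  move: (dualB _ _ _) (slots _ _ _) (dsum w X) h1 => D sl S; clear; lia.
have M_gt0 : (0 < M)%N by rewrite addn_gt0 rd_gt0 orbT.
have leIM : (I <= M)%N by apply: leq_trans (leq_addr _ _); rewrite leq_pmull.
have raise : forall n th, (k - th <= n)%N -> (th <= k)%N -> viol th ->
    exists th', [/\ (th' <= k)%N, viol th' & (k * I < th'.+1 * M)%N].
  elim=> [|n IH] j lej lejk vj.
    exists j; split=> //; have -> : j = k by move: lej lejk; clear; lia.
    by rewrite (leq_ltn_trans (leq_mul (leqnn k) leIM)) // ltn_pmul2r.
  case: (leqP (j.+1 * M) (k * I)) => [le|lt]; last by exists j.
  have ltjk : (j < k)%N.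
    rewrite -(@ltn_pmul2r I) ?lvl_gt0 //; apply: leq_trans le.
    apply: (@leq_trans (j.+1 * I)%N); first by rewrite ltn_pmul2r ?lvl_gt0.
    by rewrite leq_mul2l leIM orbT.
  apply: (IH j.+1) => //; first by move: lej ltjk; clear; lia.
  have := raise_cond rd_gt0 d_gt0 le; move: vj; rewrite /viol dualBS.
  move: (dualB _ _ _) (slots _ _ _) (dsum w X) => D sl S; clear; lia.
move=> vth; have [th1 le1 v1] := lower _ vth.
have [j [lejk vj ltj]] := raise _ th1 (leqnn _) le1 v1.
have far v : v \in W :\: X -> j.+1%:R <= rdeg wloss v X.
  case/setDP=> vW vX; apply: le_trans (rdeg_ge v X).
  have := cons1 (v |: X); rewrite subUset sub1set vW XW cardsU1 vX cX add1n.
  move=> /(_ isT erefl j); rewrite dsumU1_diag // => h.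
  rewrite lerBrDr -natrD ler_nat.
  move: vj h; rewrite /viol; move: (dualB _ _ _) (deg _ _ _) (dsum w X) => D e S.
  by clear; lia.
(* Losses may still be negative; this constant is absorbed by the size of W. *)
have near v : v \in X -> - (k%:R * q%:R) <= rdeg wloss v X.
  move=> _; rewrite -mulrN /rdeg -cX mulr_natl -sumr_const.
  by apply: ler_sum => x _; apply: wloss_lower.
have up : \sum_(v in W) rdeg wloss v X <= k%:R * (L * #|W|%:R).
  rewrite (sum_rdeg wloss_sym) -cX mulr_natl -sumr_const.
  by apply: ler_sum => x xX; apply: degL; apply: (subsetP XW).
have dn : j.+1%:R * (#|W|%:R - k%:R) - k%:R * (k%:R * q%:R) <= \sum_(v in W) rdeg wloss v X.
  rewrite (big_setID X) /= (setIidPr XW) [leRHS]addrC; apply: lerD.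
    rewrite -natrB -?cX ?subset_leq_card // -cardsDS // mulr_natr -sumr_const.
    by apply: ler_sum => v; apply: far.
  have -> : - (k%:R * (k%:R * q%:R)) = \sum_(v in X) - (k%:R * q%:R) :> R.
    by rewrite sumr_const cX -[RHS]mulr_natl mulrN.
  by apply: ler_sum => v vX; apply: near.
have {up dn} := le_trans dn up; apply/negP; rewrite -ltNge.
(* Integrality leaves a gap of 1 / M between j + 1 and k I / M. The excess of L over I / M takes at
   most half of it, the bounded errors less than the other half. *)
have ltj' : k%:R * I%:R + 1 <= j.+1%:R * M%:R :> R.
  by rewrite -!natrM natr1 ler_nat.
have hk : k%:R <= s%:R :> R by rewrite ler_nat ltnW.
have hj : j.+1%:R <= s%:R :> R by rewrite ler_nat (leq_ltn_trans lejk).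
have hn : 2 * M%:R * (s%:R * (s%:R + s%:R * q%:R)) < #|W|%:R :> R.
  by rewrite -!natrM -natrD -!natrM ltr_nat.
have M0 : 0 < M%:R :> R by rewrite ltr0n.
have s0 : 0 < s%:R :> R by rewrite ltr0n (leq_ltn_trans _ lt_ks).
have k0 := ler0n R k; have q0 := ler0n R q; have I0 := ler0n R I.
have j0 := ler0n R j.+1; have n0 := ler0n R #|W|.
move: (M%:R : R) (k%:R : R) (j.+1%:R : R) (I%:R : R) (s%:R : R) (q%:R : R) (#|W|%:R : R)
  leL ltj' hk hj hn M0 s0 k0 q0 I0 j0 n0.
move=> {vj ltj far near} m K J i S Q n leL hJ hk hj hn m0 S0 k0 q0 i0 j0 n0.
have h1 : K * (L * n) <= K * ((i / m + (2 * m * S)^-1) * n).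
  by rewrite ler_wpM2l // ler_wpM2r.
apply: le_lt_trans h1 _.
have h2 : K * ((i / m + (2 * m * S)^-1) * n) <= (J - (2 * m)^-1) * n.
  rewrite mulrA ler_wpM2r // mulrDr.
  have h3 : K * (2 * m * S)^-1 <= (2 * m)^-1.
    have i2 : 0 <= (2 * m)^-1 by rewrite invr_ge0 mulr_ge0 // ltW.
    rewrite invfM mulrCA -[X in _ <= X]mulr1 ler_wpM2l //.
    by rewrite ler_pdivrMr // mul1r.
  have h4 : K * (i / m) <= J - m^-1.
    by rewrite mulrA ler_pdivrMr // mulrBl mulVf ?lt0r_neq0 //; lra.
  have e : m^-1 = 2 * (2 * m)^-1 by field; rewrite lt0r_neq0.
  by rewrite e in h4; lra.
apply: le_lt_trans h2 _.
have h5 : J * K + K * (K * Q) <= S * (S + S * Q).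
  rewrite mulrDr lerD ?ler_pM ?mulr_ge0 ?(ltW S0) //.
have h6 : S * (S + S * Q) < (2 * m)^-1 * n.
  by rewrite [X in _ < X]mulrC ltr_pdivlMr ?mulr_gt0 // [X in X < _]mulrC.
rewrite mulrBl mulrBr; lra.
Qed.

Variables (t K n0 : nat).
Hypothesis find : forall (c : V -> V -> nat) W, (forall x y, c x y = c y x) ->
  (forall x, c x x = 0%N) -> (n0 <= #|W|)%N -> sparse c rd d r0 W ->
  bounded_deg c rd d K r0 W -> exists A B, skeleton c rd d r0 t W A B.

Lemma structure L W : wcons s [set: V] ->
  {in W, forall x, rdeg wloss x W <= L * #|W|%:R} ->
  L <= I%:R / M%:R + (2 * M%:R * s%:R)^-1 ->
  L <= I%:R / M%:R + (K%:R * M%:R)^-1 -> (0 < K)%N ->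
  (2 * M * (s * (s + s * q)) + n0 < #|W|)%N ->
  [/\ {in W &, forall u v, (w u v <= a.+1)%N}, sparse wdef rd d r0 W &
    exists A B, skeleton wdef rd d r0 t W A B].
Proof.
move=> cons_s degL leL leK K_gt0 bigW.
have ltW1 : (2 * M * (s * (s + s * q)) < #|W|)%N by apply: leq_ltn_trans bigW; rewrite leq_addr.
have I_gt0 := lvl_gt0 rd d.
have M_gt0 : (0 < M)%N by rewrite addn_gt0 rd_gt0 orbT.
have cons k : (k <= s)%N -> wcons k W.
  move=> le; rewrite -(subKn le); elim: (s - k)%N => [|n IH].
    by rewrite subn0 => X XW; apply: cons_s; rewrite subsetT.
  case: (ltnP n s) => [lt|ge].
    apply: (descend (L := L)) => //; first by rewrite ltn_subrL (leq_ltn_trans _ lt).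
    by rewrite -subSn // subSS.
  by have -> : (s - n.+1 = s - n)%N by move: ge; clear; lia.
have s2 : (2 <= s)%N by apply: leq_trans le_s; rewrite addn1.
(* The case k = 2, th = 0 reads w u v <= a + 1; from here on [wdef] is the exact complement of
   [w]. *)
have le_w : {in W &, forall u v, (w u v <= a.+1)%N}.
  move=> u v uW vW; case: (eqVneq u v) => [->|ne]; first by rewrite wdiag.
  have := cons 2%N s2 [set u; v]; rewrite subUset !sub1set uW vW cards2 ne.
  move=> /(_ isT erefl 0%N); rewrite dsumU1_diag ?inE // /dsum big_set1 !deg1 wdiag.
  rewrite /dualB big_ord0 !muln0; clear; lia.
have sumw v X : v \in W -> X \subset W -> (deg wdef v X + deg w v X = a.+1 * #|X|)%N.
  move=> vW XW; rewrite /deg -big_split /= mulnC -sum_nat_const.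
  by apply: eq_bigr => x xX; rewrite subnK // le_w // (subsetP XW).
have sp : sparse wdef rd d r0 W.
  move=> X XW leX th leth.
  have := cons #|X| _ X XW erefl th => H.
  have {}H := H ltac:(apply: leq_trans leX _; apply: leq_trans le_s; rewrite addn1 //).
  have : (dsum wdef X + dsum w X = a.+1 * #|X| * #|X|)%N.
    rewrite /dsum -big_split /= mulnC -sum_nat_const; apply: eq_bigr => x xX.
    by rewrite sumw // (subsetP XW).
  move: H; move: (dsum _ _) (dsum _ _) (dualB _ _ _) => S1 S2 D; clear; lia.
split=> //; apply: find => //; first exact: wdef_sym; first exact: wdef0.
  by apply: leq_trans (ltnW bigW); rewrite leq_addl.
move=> v vW; rewrite -(ler_nat R) !natrM.
have M0 : 0 < M%:R :> R by rewrite ltr0n.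
have K0 : 0 < K%:R :> R by rewrite ltr0n.
have h1 : (deg wdef v W)%:R <= L * #|W|%:R.
  apply: le_trans (degL v vW); apply: le_trans (rdeg_ge v W).
  by rewrite -(sumw v W vW (subxx W)) natrD addrK.
have h2 : (deg wdef v W)%:R <= (I%:R / M%:R + (K%:R * M%:R)^-1) * #|W|%:R :> R.
  by apply: le_trans h1 _; rewrite ler_wpM2r.
apply: (@le_trans _ _ (K%:R * M%:R * ((I%:R / M%:R + (K%:R * M%:R)^-1) * #|W|%:R))).
  by rewrite ler_wpM2l // mulr_ge0 // ltW.
rewrite mulrA [(K * I + 1)%:R]natrD [(K * I)%:R]natrM ler_wpM2r // le_eqVlt.
apply/orP; left; apply/eqP.
move: (M%:R : R) (K%:R : R) (I%:R : R) M0 K0 => x y i x0 y0.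
by field; rewrite !lt0r_neq0.
Qed.
End Graph.

(** * Averaging the losses over a skeleton *)

Section Weighted.
Variables (R : realType) (r0 rd d a m t : nat).
Hypotheses (r0_gt0 : (0 < r0)%N) (rd_gt0 : (0 < rd)%N) (d_gt0 : (0 < d)%N).
Hypotheses (em : m = (r0 + rd)%N) (lt_da : (d < a)%N).
Local Notation I := (lvl rd d).
Variables (V : finType) (w : V -> V -> nat).
Hypotheses (wsym : forall u v, w u v = w v u) (wdiag : forall u, w u u = a.+1).
Hypotheses (wpos : forall u v, (0 < w u v)%N).
Implicit Types (X Y : {set V}) (u v x y : V) (p q : 'I_m).
Local Notation wloss := (wloss R a w).
Local Notation wdef := (wdef a w).
Local Notation gam := (@gam R r0 d m a).
Local Notation zvec := (@zvec R r0 rd d m a).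
Local Notation lam := (lam R r0 rd d a).
Local Notation den := (den R r0 rd d a).
Local Notation G := (bigG R rd d a).
Variables (W : {set V}) (A : nat -> {set V}) (B : {set V}).
Hypothesis lew : {in W &, forall u v, (w u v <= a.+1)%N}.
Hypotheses (sp : sparse wdef rd d r0 W) (sk : skeleton wdef rd d r0 t W A B).
Hypotheses (le_t : (I <= t)%N) (le_t2 : 2 * G * d%:R <= t%:R).
Local Notation part p := (part r0 A B p).
Local Notation free v := (free r0 W A B m v).

Let a_gt0 : (0 < a)%N := leq_ltn_trans (leq0n d) lt_da.

Lemma wloss_defic u v p q : u \in W -> v \in W -> (defic d r0 p q <= wdef u v)%N ->
  gam p q + (wdef u v - defic d r0 p q)%:R <= wloss u v.
Proof.
move=> uW vW le; have lewuv := lew uW vW; have w0 := wpos u v.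
have lea : (wdef u v <= a)%N by rewrite /wdef; move: w0; clear; lia.
have := @loss_le R a a_gt0 (w u v) (a.+1 - defic d r0 p q) w0.
have -> : (a.+1 - defic d r0 p q - w u v = wdef u v - defic d r0 p q)%N.
  by rewrite /wdef subnAC.
apply; rewrite leq_subr andbT; move: le lewuv; rewrite /wdef; clear; lia.
Qed.

Lemma wloss_ge0 : {in W &, forall u v, 0 <= wloss u v}.
Proof.
move=> u v uW vW; apply: le_trans (loss_ge _ a_gt0 (wpos u v)).
by rewrite subr_ge0 ler_nat lew.
Qed.

(* The average over the skeleton with the optimal weights. *)
Definition mus (f : V -> R) : R :=
  \sum_(p : 'I_m) zvec p / #|part p|%:R * \sum_(x in part p) f x.

Lemma t_gt0 : (0 < t)%N. Proof. exact: leq_trans (lvl_gt0 _ _) le_t. Qed.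

Lemma part_gt0 p : (0 < #|part p|)%N.
Proof. by rewrite (card_part rd_gt0 d_gt0 sk em); case: ifP; rewrite ?t_gt0. Qed.

Lemma part_le p : (#|part p| <= t)%N.
Proof. by rewrite (card_part rd_gt0 d_gt0 sk em); case: ifP; rewrite ?t_gt0. Qed.

Lemma wt_gt0 p : 0 < zvec p / #|part p|%:R.
Proof. by rewrite divr_gt0 ?zvec_gt0 // ltr0n part_gt0. Qed.

Lemma mus_le f g : (forall p, {in part p, forall x, f x <= g x}) -> mus f <= mus g.
Proof.
move=> le; apply: ler_sum => p _; rewrite ler_wpM2l ?(ltW (wt_gt0 p)) //.
by apply: ler_sum => x; apply: le.
Qed.

Lemma mus_part (F : 'I_m -> R) f : (forall p, {in part p, forall x, f x = F p}) ->
  mus f = \sum_p zvec p * F p.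
Proof.
move=> e; apply: eq_bigr => p _; rewrite (eq_bigr (fun=> F p)); last exact: e.
by rewrite sumr_const -[F p *+ _]mulr_natl mulrA divfK // pnatr_eq0 -lt0n part_gt0.
Qed.

Lemma mus_const k : mus (fun=> k) = k.
Proof.
by rewrite (mus_part (F := fun=> k)) // -mulr_suml zvec_sum ?mul1r.
Qed.

Lemma mus_sum X : \sum_(v in X) mus (wloss v) = mus (fun x => rdeg wloss x X).
Proof.
rewrite exchange_big; apply: eq_bigr => p _; rewrite -mulr_sumr; congr (_ * _).
rewrite exchange_big /=; apply: eq_bigr => x _; apply: eq_bigr => v _.
exact: wloss_sym.
Qed.

(** Every skeleton vertex has at least this weight in [mus]. The factor 2 leaves room for the second
    alternative of [classify]. *)
Definition kappa : R := (2 * den * t%:R)^-1.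

Let den0 : 0 < den. Proof. exact: den_gt0. Qed.
Let G0 : 0 < G. Proof. exact: bigG_gt0. Qed.
Let tR0 : 0 < t%:R :> R. Proof. by rewrite ltr0n t_gt0. Qed.

Lemma kappa_gt0 : 0 < kappa.
Proof. by rewrite invr_gt0 !mulr_gt0. Qed.

Lemma zvec_ge p : den^-1 <= zvec p.
Proof.
rewrite /zvec; case: ifP => // _; rewrite /lam -[X in X <= _]mul1r.
rewrite ler_wpM2r ?invr_ge0 ?(ltW den0) //.
apply: le_trans (bigG_ge _ rd_gt0 lt_da); rewrite ler1n; exact: lvl_gt0.
Qed.

Lemma wt_ge p : kappa <= zvec p / #|part p|%:R.
Proof.
have h1 : kappa <= den^-1 * t%:R^-1.
  rewrite /kappa -mulrA invfM -[X in _ <= X]mul1r invfM.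
  rewrite ler_wpM2r ?mulr_ge0 ?invr_ge0 ?(ltW den0) ?(ltW tR0) //.
  by rewrite invf_le1 // ler1n.
apply: le_trans h1 _; apply: ler_pM; first by rewrite invr_ge0 ltW.
- by rewrite invr_ge0 ltW.
- exact: zvec_ge.
by rewrite lef_pV2 ?posrE ?ltr0n ?part_gt0 ?t_gt0 // ler_nat part_le.
Qed.

Definition typed v p := [forall q, [forall x in part q, wdef v x == defic d r0 p q]].

Lemma typedP v p : reflect (forall q, {in part q, forall x, wdef v x = defic d r0 p q})
  (typed v p).
Proof.
apply: (iffP forallP) => [h q x xq|h q].
  by apply/eqP; move/forall_inP: (h q); apply.
by apply/forall_inP => x xq; apply/eqP; apply: h xq.
Qed.

(** For v dominating a row of the pattern, that row averages to lam by [gam_zvec], and any excess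
    deficiency costs at least 1 on a skeleton vertex of weight at least [kappa]. *)
Lemma mus_free v : free v ->
  lam + (if [exists p, typed v p] then 0 else kappa) <= mus (wloss v).
Proof.
move=> fv; have vW : v \in W by case/setDP: fv.
have pW p x : x \in part p -> x \in W.
  exact: (subsetP (part_sub rd_gt0 d_gt0 sk em p)).
have [[p dom]|[p ltp [few pos]]] :=
    classify (wdef_sym a wsym) (wdef0 wdiag) rd_gt0 d_gt0 sp sk em fv.
  have ge q x : x \in part q -> gam p q + (wdef v x - defic d r0 p q)%:R <= wloss v x.
    by move=> xq; apply: wloss_defic => //; [apply: pW xq | apply: dom].
  have -> : mus (wloss v) =
      lam + \sum_q zvec q / #|part q|%:R * \sum_(x in part q) (wloss v x - gam p q).
    rewrite -(gam_zvec R rd_gt0 em lt_da p) -big_split; apply: eq_bigr => q _ /=.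
    rewrite sumrB sumr_const -[gam p q *+ _]mulr_natl mulrBr mulrA.
    by rewrite divfK ?pnatr_eq0 -?lt0n ?part_gt0 // [gam p q * _]mulrC addrC subrK.
  rewrite lerD2l.
  have ge0 q : true -> 0 <= zvec q / #|part q|%:R * \sum_(x in part q) (wloss v x - gam p q).
    move=> _; rewrite mulr_ge0 ?(ltW (wt_gt0 q)) // sumr_ge0 // => x xq.
    by rewrite subr_ge0; apply: le_trans (ge q x xq); rewrite lerDl.
  case: ifP => [_|/negbT]; first exact: sumr_ge0.
  rewrite negb_exists => /forallP/(_ p).
  rewrite negb_forall => /existsP[q]; rewrite negb_forall_in => /existsP[x /andP[xq ne]].
  rewrite (bigD1 q) //= -[X in X <= _]addr0 lerD //; last first.
    by apply: sumr_ge0 => q' _; apply: ge0.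
  apply: le_trans (wt_ge q) _; rewrite -[X in X <= _]mulr1.
  rewrite ler_wpM2l ?(ltW (wt_gt0 q)) // (bigD1 x) //=.
  have h1 : 1 <= wloss v x - gam p q.
    rewrite lerBrDl; apply: le_trans (ge q x xq).
    rewrite lerD2l ler1n subn_gt0 ltn_neqAle eq_sym ne; exact: dom.
  rewrite -[X in X <= _]addr0 lerD // sumr_ge0 // => y /andP[yq _].
  by rewrite subr_ge0; apply: le_trans (ge q y yq); rewrite lerDl.
(* Deficiency 1 to almost all of a part of level 0 gives almost lam, and
   deficiency 1 to every part of level d exceeds what is missing, as t is large. *)
apply: (le_trans (y := lam + kappa)).
  by rewrite lerD2l; case: ifP => // _; rewrite ltW ?kappa_gt0.
have ge q x : x \in part q -> (wdef v x)%:R <= wloss v x.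
  move=> xq; apply: le_trans (loss_ge _ a_gt0 (wpos v x)).
  by rewrite natrB // lew // (pW q).
pose F q : R := if (q < r0)%N then (if q == p then 1 - (d * rd)%:R / t%:R else 0) else 1.
have h : \sum_q zvec q * F q <= mus (wloss v).
  rewrite /mus; apply: ler_sum => q _.
  rewrite -mulrA ler_wpM2l ?(ltW (zvec_gt0 _ _ rd_gt0 lt_da q)) //.
  have sum_ge : (\sum_(x in part q) wdef v x)%:R <= \sum_(x in part q) wloss v x.
    by rewrite natr_sum; apply: ler_sum => x; apply: ge.
  have inv0 : 0 <= (#|part q|%:R : R)^-1 by rewrite invr_ge0 ler0n.
  apply: le_trans (ler_wpM2l inv0 sum_ge).
  have cq : 0 < #|part q|%:R :> R by rewrite ltr0n part_gt0.
  rewrite mulrC ler_pdivlMr //.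
  rewrite /F; case: ltnP => [ltq|leq].
    case: eqP => [->|_]; last by rewrite mul0r ler0n.
    have cp : #|part p| = t by rewrite (card_part rd_gt0 d_gt0 sk em) ltp.
    rewrite cp mulrBl mul1r divfK ?lt0r_neq0 // lerBlDr -natrD ler_nat -cp.
    rewrite -(cardsID [set x | wdef v x == 0%N] (part p)) addnC leq_add //.
      rewrite -sum1_card.
      apply: (@leq_trans (\sum_(x in part p :\: [set x | wdef v x == 0%N]) wdef v x)%N).
        by apply: leq_sum => x; rewrite !inE lt0n => /andP[].
      by rewrite [leqRHS](big_setID [set x | wdef v x == 0%N]) leq_addl.
    move: few; rewrite /lvl addn1 ltnS; apply: leq_trans; apply: subset_leq_card.
    by apply/subsetP=> x; rewrite !inE.
  rewrite mul1r ler_nat -sum1_card; apply: leq_sum => x xq; exact: pos leq x xq.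
apply: le_trans h.
have -> : \sum_q zvec q * F q = zvec p * (1 - (d * rd)%:R / t%:R) +
    \sum_(q : 'I_m) (if (q < r0)%N then 0 else den^-1).
  rewrite (bigD1 p) //= [X in _ = _ + X](bigD1 p) //= /F ltp eqxx add0r.
  congr (_ + _); apply: eq_bigr => q /negbTE ->; rewrite /zvec.
  by case: ifP => _; rewrite ?mulr0 ?mulr1.
rewrite (@sum_U R r0 rd m em (fun i => if (i < r0)%N then 0 else den^-1) 0 den^-1).
- rewrite /zvec ltp mulr0 add0r mulrBr mulr1 -addrA lerD2l natrM.
  have h1 : lam * (d%:R * rd%:R / t%:R) <= 2^-1 * (rd%:R * den^-1).
    rewrite /lam.
    have -> : G / den * (d%:R * rd%:R / t%:R) = 2^-1 * (rd%:R * den^-1) * (2 * G * d%:R / t%:R).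
      by field; rewrite !lt0r_neq0.
    rewrite -[X in _ <= X]mulr1 ler_wpM2l ?mulr_ge0 ?invr_ge0 ?ler0n ?(ltW den0) //.
    by rewrite ler_pdivrMr // mul1r.
  have h2 : kappa <= 2^-1 * (rd%:R * den^-1).
    rewrite /kappa -mulrA invfM ler_wpM2l ?invr_ge0 //.
    rewrite invfM mulrC ler_wpM2r ?invr_ge0 ?(ltW den0) //.
    apply: (le_trans (y := 1)); last by rewrite ler1n.
    by rewrite invf_le1 // ler1n t_gt0.
  by lra.
- by move=> i ->.
- by move=> i; rewrite ltnNge => ->.
Qed.

Definition touched := \bigcup_(p : 'I_m) part p.

Lemma touched_card : (#|touched| <= m * t)%N.
Proof.
rewrite /touched; apply: (@leq_trans (\sum_(p : 'I_m) #|part p|)%N).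
  elim/big_rec2: _ => [|p k X _ le]; first by rewrite cards0.
  by apply: leq_trans (leq_card_setU _ _) _; rewrite leq_add2l.
have -> : (m * t = \sum_(p : 'I_m) t)%N by rewrite sum_nat_const card_ord.
by apply: leq_sum => p _; apply: part_le.
Qed.

Lemma mus_ge0 v : v \in W -> 0 <= mus (wloss v).
Proof.
move=> vW; rewrite -[X in X <= _](mus_const 0); apply: mus_le => p x xp.
by rewrite wloss_ge0 // (subsetP (part_sub rd_gt0 d_gt0 sk em p)).
Qed.

Definition untyped := [set v in W :\: touched | ~~ [exists p, typed v p]].

Lemma sum_mus_ge : lam * (#|W|%:R - (m * t)%:R) + kappa * #|untyped|%:R <=
  \sum_(v in W) mus (wloss v).
Proof.
have lam0 : 0 < lam by exact: lam_gt0.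
have h : lam * #|W :\: touched|%:R + kappa * #|untyped|%:R <=
    \sum_(v in W :\: touched) mus (wloss v).
  rewrite !mulr_natr -!sumr_const.
  rewrite [X in _ + X](eq_bigl (fun v => (v \in W :\: touched) && ~~ [exists p, typed v p])).
    rewrite [X in _ + X]big_mkcondr -big_split /=; apply: ler_sum => v fv.
    by apply: le_trans (mus_free fv); rewrite if_neg.
  by move=> v; rewrite inE.
rewrite (big_setID touched) /= -[X in X <= _]add0r lerD //.
  by apply: sumr_ge0 => v /setIP[vW _]; apply: mus_ge0.
apply: le_trans h; rewrite lerD2r ler_wpM2l ?(ltW lam0) // lerBlDr -natrD ler_nat.
rewrite -(cardsID touched W) addnC leq_add2l.
by apply: leq_trans touched_card; apply: subset_leq_card; apply: subsetIr.
Qed.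

(** By symmetry, the sum of [mus (wloss v)] over v is the [mus]-average of the loss degrees of the
    skeleton vertices, so one of these degrees reaches the bound. *)
Lemma heavy : exists2 x, x \in W & lam * (#|W|%:R - (m * t)%:R) <= rdeg wloss x W.
Proof.
case: (pickP [pred x | (x \in W) && (lam * (#|W|%:R - (m * t)%:R) <= rdeg wloss x W)]).
  by move=> x /andP[]; exists x.
move=> none; exfalso.
have lt x : x \in W -> rdeg wloss x W < lam * (#|W|%:R - (m * t)%:R).
  by move=> xW; have := none x; rewrite /= xW /= => /negbT; rewrite -ltNge.
have : \sum_(v in W) mus (wloss v) < lam * (#|W|%:R - (m * t)%:R).
  rewrite mus_sum -(mus_const (lam * _)).
  have p0 : 'I_m by apply: (@Ordinal m 0); rewrite em addn_gt0 r0_gt0.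
  have pW p x : x \in part p -> x \in W.
    exact: (subsetP (part_sub rd_gt0 d_gt0 sk em p)).
  apply: ltr_sum; first by apply/hasP; exists p0; rewrite ?mem_index_enum.
  move=> p _; rewrite ltr_pM2l ?wt_gt0 //; apply: ltr_sum.
    have /card_gt0P[x xp] := part_gt0 p.
    by apply/hasP; exists x; rewrite ?mem_index_enum.
  by move=> x xp; apply: lt; apply: pW xp.
have := sum_mus_ge; have : 0 <= kappa * #|untyped|%:R by rewrite mulr_ge0 // ltW // kappa_gt0.
lra.
Qed.

Lemma untyped_le L : {in W, forall x, rdeg wloss x W <= L} ->
  lam * (#|W|%:R - (m * t)%:R) + kappa * #|untyped|%:R <= L.
Proof.
move=> le; apply: le_trans sum_mus_ge _; rewrite mus_sum -(mus_const L).
apply: mus_le => p x xp; apply: le.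
exact: (subsetP (part_sub rd_gt0 d_gt0 sk em p)).
Qed.
End Weighted.

Section Prune.
Variables (R : realType) (V : finType) (g : V -> V -> R).
Hypotheses (gsym : forall u v, g u v = g v u) (g0 : forall u, g u u = 0).

(** A vertex of degree above L k in a set of size k carries at least 2 L k of the ordered sum, more
    than the drop of L k^2. *)
Lemma prune L (W : {set V}) : 0 <= L -> exists W' : {set V}, [/\ W' \subset W,
  {in W', forall x, rdeg g x W' <= L * #|W'|%:R} &
  rsum g W' + L * (#|W|%:R ^+ 2 - #|W'|%:R ^+ 2) <= rsum g W].
Proof.
move=> L0; elim: {W}#|W| {-2}W (leqnn #|W|) => [|n IH] W leW.
  exists set0; move: leW; rewrite leqn0 cards_eq0 => /eqP->.
  split=> //; first by move=> x; rewrite inE.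
  by rewrite subrr mulr0 addr0.
case: (pickP [pred x | (x \in W) && (L * #|W|%:R < rdeg g x W)]) => [x /andP[xW ltx]|none].
  have cW := cardsD1 x W; rewrite xW in cW.
  have [|W' [sW hdeg le]] := IH (W :\ x); first by move: leW; rewrite cW; clear; lia.
  exists W'; split=> //; first exact: subset_trans sW (subsetDl _ _).
  rewrite (rsumD1 gsym g0 xW).
  have h : L * (#|W|%:R ^+ 2 - #|W :\ x|%:R ^+ 2) <= 2 * rdeg g x W.
    have -> : #|W|%:R = #|W :\ x|%:R + 1 :> R by rewrite cW add1n natr1.
    move: ltx; rewrite cW add1n -natr1; move: (#|_|%:R : R) => k ltx.
    apply: (le_trans (y := 2 * (L * (k + 1)))); last by rewrite ler_pM2l // ltW.
    nra.
  lra.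
exists W; split=> //; last by rewrite subrr mulr0 addr0.
by move=> x xW; have := none x; rewrite /= xW /= => /negbT; rewrite -leNgt.
Qed.
End Prune.

(** * Stability for loss matrices *)

Section Stability.
Variables (R : realType) (r0 rd d s a q m t K n0 : nat) (eta0 : R).
Hypotheses (r0_gt0 : (0 < r0)%N) (rd_gt0 : (0 < rd)%N) (d_gt0 : (0 < d)%N).
Hypotheses (em : m = (r0 + rd)%N) (lt_da : (d < a)%N).
Local Notation I := (lvl rd d).
Local Notation M := (r0 * I + rd)%N.
Local Notation gam := (@gam R r0 d m a).
Local Notation zvec := (@zvec R r0 rd d m a).
Local Notation lam := (lam R r0 rd d a).
Local Notation G := (bigG R rd d a).
Local Notation kappa := (kappa R r0 rd d a t).
Hypothesis le_s : (M + 1 <= s)%N.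
Hypotheses (le_t : (I <= t)%N) (le_t2 : 2 * G * d%:R <= t%:R).
Hypotheses (eta0_gt0 : 0 < eta0) (K_gt0 : (0 < K)%N).
Hypotheses (lam_s : lam + eta0 <= I%:R / M%:R + (2 * M%:R * s%:R)^-1).
Hypotheses (lam_K : lam + eta0 <= I%:R / M%:R + (K%:R * M%:R)^-1).
Variables (V : finType) (w : V -> V -> nat).
Hypotheses (wsym : forall u v, w u v = w v u) (wdiag : forall u, w u u = a.+1).
Hypotheses (wpos : forall u v, (0 < w u v)%N) (wq : forall u v, (w u v <= q)%N).
Hypothesis find : forall (c : V -> V -> nat) (W : {set V}), (forall x y, c x y = c y x) ->
  (forall x, c x x = 0%N) -> (n0 <= #|W|)%N -> sparse c rd d r0 W ->
  bounded_deg c rd d K r0 W -> exists A B, skeleton c rd d r0 t W A B.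
Hypothesis cons_s : wcons r0 rd d a w s [set: V].
Implicit Types (X Y W : {set V}) (u v x y : V).
Local Notation wloss := (wloss R a w).
Local Notation wdef := (wdef a w).

Definition big_size := (2 * M * (s * (s + s * q)) + n0).+1.

Lemma structureE L W : {in W, forall x, rdeg wloss x W <= L * #|W|%:R} ->
  L <= lam + eta0 -> (big_size <= #|W|)%N ->
  [/\ {in W &, forall u v, (w u v <= a.+1)%N}, sparse wdef rd d r0 W &
    exists A B, skeleton wdef rd d r0 t W A B].
Proof.
move=> degL leL leW.
exact: (structure r0_gt0 rd_gt0 d_gt0 lt_da le_s wsym wdiag wpos wq find cons_s degL
  (le_trans leL lam_s) (le_trans leL lam_K) K_gt0 leW).
Qed.

(** Either some degree already exceeds lam |W|, or all are bounded and the structure results apply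
    to W. *)
Lemma heavyE W : (big_size <= #|W|)%N ->
  exists2 x, x \in W & lam * (#|W|%:R - (m * t)%:R) <= rdeg wloss x W.
Proof.
have lam0 : 0 < lam by exact: lam_gt0.
move=> leW; case: (pickP [pred x | (x \in W) && (lam * #|W|%:R < rdeg wloss x W)]).
  move=> x /andP[xW lt]; exists x => //; apply: le_trans (ltW lt).
  by rewrite ler_pM2l // gerBl ler0n.
move=> none; have degL : {in W, forall x, rdeg wloss x W <= lam * #|W|%:R}.
  by move=> x xW; have := none x; rewrite /= xW /= => /negbT; rewrite -leNgt.
have [|lew sp [A [B sk]]] := structureE degL _ leW; first by rewrite lerDl ltW.
exact: (heavy r0_gt0 rd_gt0 d_gt0 em lt_da wsym wdiag wpos lew sp sk le_t le_t2).
Qed.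

(** The first summand pays for one removed vertex in [rsum_lower], the second for sets below
    [big_size], where only [q] controls the losses. *)
Definition slack : R := (2 * m * t + q.+1 * (big_size * big_size))%:R.

(** Induction by removing heavy vertices: each accounts for the increment of lam n^2 up to a
    constant. *)
Lemma rsum_lower W : lam * #|W|%:R ^+ 2 <= rsum wloss W + slack * (#|W|%:R + 1).
Proof.
have lam1 : lam <= 1 by exact: lam_le1.
have lam0 : 0 < lam by exact: lam_gt0.
have sl0 : 0 <= slack by exact: ler0n.
move: {2}#|W| (erefl #|W|) => n; elim: n W => [|n IH] W cW.
  move/eqP: (cW); rewrite cards_eq0 => /eqP->.
  by rewrite /rsum big_set0 cards0 expr0n /= mulr0 !add0r mulr1.
case: (leqP big_size n.+1) => [le|lt].
  have [|x xW hx] := @heavyE W; first by rewrite cW.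
  have cY : #|W :\ x| = n by have := cardsD1 x W; rewrite xW cW => -[].
  have {}IH := IH _ cY; rewrite cY in IH; rewrite (rsumD1 (wloss_sym R a wsym) (wloss0 R wdiag) xW).
  have h2 : 2 * (lam * (m * t)%:R) <= slack.
    apply: (le_trans (y := 2 * (1 * (m * t)%:R))); first by rewrite ler_pM2l // ler_wpM2r.
    by rewrite mul1r -natrM /slack ler_nat mulnA leq_addr.
  move: hx IH; rewrite cW -(natr1 n); move: (n%:R : R) (rdeg _ _ _) (rsum _ _) ((m * t)%:R : R) h2.
  by move=> k D S T h2 hx IH; nra.
have lower : - (q%:R * (#|W|%:R * #|W|%:R)) <= rsum wloss W.
  have -> : - (q%:R * (#|W|%:R * #|W|%:R)) = \sum_(x in W) \sum_(y in W) - q%:R :> R.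
    by rewrite !sumr_const -mulrnA -[RHS]mulr_natl natrM; ring.
  by apply: ler_sum => x xW; apply: ler_sum => y _; apply: (wloss_lower R lt_da wpos wq).
have hW : lam * #|W|%:R ^+ 2 <= #|W|%:R * #|W|%:R.
  by rewrite expr2 -[X in _ <= X]mul1r ler_wpM2r // mulr_ge0.
have hs : (q%:R + 1) * (#|W|%:R * #|W|%:R) <= slack.
  rewrite natr1 -!natrM /slack ler_nat (leq_trans _ (leq_addl _ _)) //.
  by rewrite leq_mul2l leq_mul ?orbT // cW ltnW.
have h3 : slack <= slack * (#|W|%:R + 1) by rewrite -[X in X <= _]mulr1 ler_wpM2l // lerDr.
lra.
Qed.

Definition edit (f : V -> 'I_m) u v : R :=
  ((u != v) && (w u v != a.+1 - defic d r0 (f u) (f v))%N)%:R.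

(** Errors are kept at e^2 because [key] controls the squares of the size deviations; the sizes are
    then known up to O(e n). *)
Lemma stable_partition (e eta : R) : 0 < e -> e <= 1 -> 0 < eta -> eta <= eta0 ->
  eta <= kappa * (e ^+ 2 / 4) -> eta <= e ^+ 2 ->
  let n : R := #|V|%:R in
  (2 * big_size)%:R <= n -> 2 * slack <= eta * (e ^+ 2 / 8) * n ->
  (m * t)%:R <= kappa * (e ^+ 2 / 4) * n -> (m * t)%:R <= e ^+ 2 / 4 * n ->
  gap R a d.+1 <= e ^+ 2 * n ->
  rsum wloss [set: V] <= (lam + eta * (e ^+ 2 / 8)) * n ^+ 2 ->
  exists f : V -> 'I_m, rsum (edit f) [set: V] <= 6 * e * n ^+ 2 /\
    forall p, `|#|[set v | f v == p]|%:R - zvec p * n| <= 4 * e * n.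
Proof.
move=> e_gt0 e_le1 eta_gt0 eta_le eta_kap eta_e n big_n n_slack n_mt n_mt2 n_gap le_sum.
pose e1 := e ^+ 2.
have lam1 : lam <= 1 by exact: lam_le1.
have lam0 : 0 < lam by exact: lam_gt0.
have e1_gt0 : 0 < e1 by rewrite exprn_gt0.
have e1_le : e1 <= e by rewrite /e1 expr2 -[X in _ <= X]mulr1 ler_pM2l.
have e1_le1 : e1 <= 1 by apply: le_trans e1_le e_le1.
rewrite -/e1 in eta_kap eta_e n_slack n_mt n_mt2 n_gap le_sum.
have n_ge1 : 1 <= n.
  by apply: le_trans big_n; rewrite ler1n muln_gt0.
have n_gt0 : 0 < n by apply: lt_le_trans n_ge1.
have [W [_ degW sumW]] := @prune _ _ wloss (wloss_sym R a wsym) (wloss0 R wdiag)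
  (lam + eta) [set: V] (ltW (addr_gt0 lam0 eta_gt0)).
rewrite cardsT -/n in sumW.
set k : R := #|W|%:R in degW sumW.
have k_le : k <= n by rewrite ler_nat max_card.
have k_ge0 : 0 <= k by exact: ler0n.
have lowW := rsum_lower W; rewrite -/k in lowW.
(* The pruned vertices carry density lam + eta and the rest nearly lam, while the total exceeds lam
   n^2 by at most eta e^2 n^2 / 8; so few are pruned. *)
have hk : n - k <= e1 / 4 * n.
  have h1 : eta * (n ^+ 2 - k ^+ 2) <= eta * (e1 / 4 * n ^+ 2).
    have h2 : slack * (k + 1) <= eta * (e1 / 8) * n * n.
      apply: (le_trans (y := 2 * slack * n)); last by rewrite ler_wpM2r // ltW.
      have sl0 : 0 <= slack by exact: ler0n.
      rewrite -mulrA mulrCA ler_wpM2l //; lra.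
    nra.
  rewrite ler_pM2l // in h1.
  rewrite -(ler_pM2r n_gt0) -[e1 / 4 * n * n]mulrA -expr2; apply: le_trans h1; nra.
have sizeW : (big_size <= #|W|)%N.
  rewrite -(ler_nat R) -/k; move: big_n; rewrite natrM => big_n.
  have : e1 / 4 * n <= 1 / 4 * n by rewrite ler_pM2r // ler_pM2r // invr_gt0.
  lra.
have [|lew sp [A [B sk]]] := structureE degW _ sizeW; first by rewrite lerD2l.
pose T := touched r0 m A B; pose Un := untyped r0 d a m w W A B.
have un_le := untyped_le rd_gt0 d_gt0 em lt_da wsym wdiag wpos lew sp sk le_t le_t2 degW.
have T_le := touched_card rd_gt0 d_gt0 em sk le_t.
rewrite -/k -/Un -/T in un_le T_le.
pose W1 := (W :\: T) :\: Un.
set k1 : R := #|W1|%:R.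
have kap0 : 0 < kappa by apply: kappa_gt0.
have hk1 : n - k1 <= e1 * n.
  have hU : #|Un|%:R <= e1 / 2 * n.
    rewrite -(ler_pM2l kap0).
    have h1 : eta * k <= kappa * (e1 / 4) * n by rewrite ler_pM // ltW.
    have h2 : lam * (m * t)%:R <= (m * t)%:R by rewrite -[X in _ <= X]mul1r ler_wpM2r.
    lra.
  have hT : #|T|%:R <= e1 / 4 * n by apply: le_trans n_mt2; rewrite ler_nat.
  have : k <= k1 + #|T|%:R + #|Un|%:R.
    rewrite -!natrD ler_nat; have e2 := cardsID T W; have e3 := cardsID Un (W :\: T).
    have s2 := subset_leq_card (subsetIr W T).
    have s3 := subset_leq_card (subsetIr (W :\: T) Un).
    by move: e2 e3 s2 s3; rewrite -/W1; clear; lia.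
  lra.
have k1_ge0 : 0 <= k1 by exact: ler0n.
have W1W : W1 \subset W by apply: subset_trans (subsetDl _ _) (subsetDl _ _).
have k1_le : k1 <= n by rewrite ler_nat max_card.
have p0 : 'I_m by apply: (@Ordinal m 0); rewrite em addn_gt0 r0_gt0.
pose f v := odflt p0 [pick p | typed r0 d a w A B v p].
have fP v : v \in W1 -> free r0 W A B m v /\ typed r0 d a w A B v (f v).
  case/setDP=> vWT vU; split=> //; move: vU; rewrite inE vWT negbK /= => /existsP[p tp].
  by rewrite /f; case: pickP => [p'|/(_ p)] //=; rewrite tp.
(* Each unit of deficiency beyond the pattern raises the loss by at least 1, which pays for a wrong
   pair. *)
have pair u v : u \in W1 -> v \in W1 -> bloss gam f u v + edit f u v <= wloss u v.
  move=> uW1 vW1; rewrite /bloss /edit; case: (eqVneq u v) => [->|ne] /=.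
    by rewrite wloss0 // addr0.
  have [fu /typedP tu] := fP u uW1; have [fv /typedP tv] := fP v vW1.
  have le_def := typed_pair (wdef_sym a wsym) (wdef0 wdiag) rd_gt0 d_gt0 sp sk em le_t
    fu fv ne tu tv.
  have uW := subsetP W1W _ uW1; have vW := subsetP W1W _ vW1.
  apply: le_trans (wloss_defic R lt_da wpos lew uW vW le_def); rewrite lerD2l ler_nat.
  case: eqP => //= neq; rewrite subn_gt0 ltn_neqAle le_def andbT.
  have lw := lew u v uW vW; apply/eqP=> e2; apply: neq.
  by rewrite e2 /wdef subKn.
(* The passage from k to k1, the excess eta and the diagonal contribute 2, 1 and 1 times e^2 n^2. *)
have key : rsum (edit f) W1 + \sum_p (#|[set v in W1 | f v == p]|%:R - zvec p * k1) ^+ 2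
    <= 4 * e1 * n ^+ 2.
  have h1 : rsum (bloss gam f) W1 + rsum (edit f) W1 <= rsum wloss W1.
    rewrite -big_split; apply: ler_sum => u uW1; rewrite -big_split.
    by apply: ler_sum => v; apply: pair.
  have h2 : rsum wloss W1 <= rsum wloss W.
    have g0 u v : u \in W -> v \in W -> 0 <= wloss u v.
      by move=> uW vW; apply: (wloss_ge0 R lt_da wpos lew uW vW).
    rewrite /rsum [leRHS](big_setID W1) /= (setIidPr W1W) -[X in X <= _]addr0 lerD //.
      apply: ler_sum => u uW1; rewrite /rdeg [leRHS](big_setID W1) /= (setIidPr W1W) lerDl.
      by apply: sumr_ge0 => v /setDP[vW _]; apply: g0 => //; apply: (subsetP W1W).
    by apply: sumr_ge0 => u /setDP[uW _]; apply: sumr_ge0 => v vW; apply: g0.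
  have h3 : rsum wloss W <= (lam + eta) * k * k.
    rewrite mulr_natr -sumr_const; exact: ler_sum.
  have h4 := rsum_bloss_lower (gam_sym R r0 d a) (gam_zvec R rd_gt0 em lt_da)
    (zvec_sum R rd_gt0 em lt_da) (gam_PD r0 lt_da) f W1 (gam_diag R r0 (m := m) lt_da).
  rewrite -/k1 in h4.
  have h5 : gap R a d.+1 * k1 <= e1 * n ^+ 2.
    rewrite expr2 mulrA; apply: (le_trans (y := e1 * n * k1)); first by rewrite ler_wpM2r.
    by rewrite ler_wpM2l // mulr_ge0 // ltW.
  have h6 : lam * (k ^+ 2 - k1 ^+ 2) <= 2 * e1 * n ^+ 2.
    have hle : k1 <= k by rewrite ler_nat subset_leq_card.
    apply: (le_trans (y := k ^+ 2 - k1 ^+ 2)).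
      by rewrite -[X in _ <= X]mul1r ler_wpM2r // subr_ge0 ler_sqr.
    have h8 : (k - k1) * (k + k1) <= (e1 * n) * (2 * n).
      by rewrite ler_pM // ?subr_ge0 ?addr_ge0 //; lra.
    nra.
  have h7 : eta * k ^+ 2 <= e1 * n ^+ 2.
    have n0le : 0 <= n by exact: ltW.
    by apply: ler_pM; rewrite ?sqr_ge0 ?(ltW eta_gt0) // ler_sqr ?nnegrE.
  nra.
have edit01 u v : 0 <= edit f u v <= 1.
  by rewrite /edit ler0n /=; case: (_ && _); rewrite ?lexx ?ler01.
have edit_ge0 : 0 <= rsum (edit f) W1.
  by apply: sumr_ge0 => u _; apply: sumr_ge0 => v _; case/andP: (edit01 u v).
have sq_ge0 : 0 <= \sum_p (#|[set v in W1 | f v == p]|%:R - zvec p * k1) ^+ 2.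
  by apply: sumr_ge0 => p _; apply: sqr_ge0.
have cC : #|~: W1|%:R = n - k1 by rewrite cardsCs setCK natrB ?max_card.
exists f; split.
  have h1 : rsum (edit f) [set: V] <= rsum (edit f) W1 + 2 * (n * (n - k1)).
    rewrite {1}/rsum (big_setID W1) /= setTI setTD.
    have hA : \sum_(i in ~: W1) rdeg (edit f) i [set: V] <= (n - k1) * n.
      rewrite -cC mulrC mulr_natr -sumr_const; apply: ler_sum => u _.
      rewrite /rdeg /n -cardsT -sumr_const.
      by apply: ler_sum => v _; case/andP: (edit01 u v).
    have hB : \sum_(i in W1) rdeg (edit f) i [set: V] <= rsum (edit f) W1 + n * (n - k1).
      have -> : \sum_(i in W1) rdeg (edit f) i [set: V] =
          rsum (edit f) W1 + \sum_(i in W1) rdeg (edit f) i (~: W1).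
        rewrite -big_split; apply: eq_bigr => u _.
        by rewrite /rdeg (big_setID W1) /= setTI setTD.
      rewrite lerD2l; apply: (le_trans (y := k1 * (n - k1))); last first.
        by rewrite ler_wpM2r // subr_ge0.
      rewrite mulrC mulr_natr -sumr_const; apply: ler_sum => u _.
      rewrite -cC -sumr_const; apply: ler_sum => v _; by case/andP: (edit01 u v).
    lra.
  have h2 : 2 * (n * (n - k1)) <= 2 * (e1 * n ^+ 2) by nra.
  have h3 : e1 * n ^+ 2 <= e * n ^+ 2 by rewrite ler_wpM2r // sqr_ge0.
  lra.
move=> p; set N : R := #|[set v | f v == p]|%:R; set N1 : R := #|[set v in W1 | f v == p]|%:R.
have dN : 0 <= N - N1 <= e1 * n.
  apply/andP; split.
    rewrite subr_ge0 ler_nat subset_leq_card //.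
    by apply/subsetP=> v; rewrite !inE => /andP[].
  apply: le_trans hk1; rewrite lerBlDr -cC -natrD ler_nat.
  rewrite -(cardsID W1 [set v | f v == p]) addnC leq_add //; apply: subset_leq_card.
    by apply/subsetP=> v; rewrite !inE => /andP[].
  by apply/subsetP=> v; rewrite !inE andbC.
have zp : 0 <= zvec p <= 1.
  have zg := zvec_gt0 R r0 rd_gt0 lt_da.
  rewrite (ltW (zg m p)) /= -(zvec_sum R rd_gt0 em lt_da) (bigD1 p) //= lerDl.
  by apply: sumr_ge0 => p' _; apply: ltW.
have h1 : (N1 - zvec p * k1) ^+ 2 <= (2 * e * n) ^+ 2.
  have -> : (2 * e * n) ^+ 2 = 4 * e1 * n ^+ 2 by rewrite /e1; ring.
  apply: le_trans key.
  apply: (le_trans (y := \sum_p (#|[set v in W1 | f v == p]|%:R - zvec p * k1) ^+ 2)).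
    by rewrite (bigD1 p) //= lerDl; apply: sumr_ge0 => p' _; apply: sqr_ge0.
  by rewrite lerDr.
have h2 : `|N1 - zvec p * k1| <= 2 * e * n.
  have h0 : 0 <= 2 * e * n by rewrite !mulr_ge0 // ltW.
  by rewrite -(ler_sqr) ?nnegrE // real_normK ?num_real.
have h3 : 0 <= zvec p * (n - k1) <= e1 * n.
  case/andP: zp => z0 z1; rewrite mulr_ge0 ?subr_ge0 //=.
  by apply: le_trans hk1; rewrite -[X in _ <= X]mul1r ler_wpM2r // subr_ge0.
have h4 : e1 * n <= e * n by rewrite ler_pM2r.
move: h2 dN h3; rewrite !ler_norml => /andP[h2 h2'] /andP[h5 h5'] /andP[h3 h3'].
apply/andP; split; lra.
Qed.
End Stability.

(** * Sums over pairs, and maximal blow-ups on arbitrary vertex sets *)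

Lemma sum_pairs (Mo : nmodType) (V : finType) (X : {set V}) (F : {set V} -> Mo) :
  \sum_(u in X) \sum_(v in X | v != u) F [set u; v] = (\sum_(B in pairs X) F B) *+ 2.
Proof.
rewrite (pair_big_dep (mem X) (fun u v => (v \in X) && (v != u)) (fun u v => F [set u; v])) /=.
rewrite (partition_big (fun p : V * V => [set p.1; p.2]) (mem (pairs X))) /=; last first.
  move=> [u v] /= /and3P[uX vX ne]; rewrite inE subUset !sub1set uX vX.
  by rewrite cards2 [u == v]eq_sym ne.
rewrite -sumrMnl; apply: eq_bigr => B; rewrite inE => /andP[BX /cards2P[x [y [ne eB]]]].
have [xX yX] : x \in X /\ y \in X by move: BX; rewrite eB subUset !sub1set => /andP.
rewrite (eq_bigr (fun=> F B)) => [|[u v] /andP[_ /eqP <-]//].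
rewrite (eq_bigl (fun p => p \in [set (x, y); (y, x)])) => [|[u v]] /=.
  by rewrite sumr_const cards2 xpair_eqE negb_and ne.
rewrite !inE !xpair_eqE; apply/andP/orP => [[/and3P[uX vX vu] /eqP eu]|].
  have := set21 u v; have := set22 u v; rewrite eu eB !inE.
  case/orP=> /eqP ev; case/orP=> /eqP eu'; move: vu; rewrite ev eu' ?eqxx //; auto.
case=> /andP[/eqP-> /eqP->]; rewrite xX yX ?ne eB; last by rewrite setUC.
by rewrite eq_sym ne.
Qed.

Lemma pairs_setT (V : finType) (B : {set V}) : (B \in pairs [set: V]) = (#|B| == 2)%N.
Proof. by rewrite inE subsetT. Qed.

Lemma blowup2 (U V : finType) (P : pattern U) (f : V -> U) u v :
  blowup P f [set u; v] = P [set f u; f v].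
Proof. by rewrite /blowup imsetU1 imset_set1. Qed.

Lemma edge_prod_reindex (U V V' : finType) (P : pattern U) (f : V' -> U) (phi : V -> V') :
  bijective phi ->
  edge_prod (blowup P f) [set: V'] = edge_prod (blowup P (f \o phi)) [set: V].
Proof.
case=> psi phiK psiK; rewrite /edge_prod (reindex (fun B : {set V} => phi @: B)) /=.
  apply: eq_big => B; first by rewrite !pairs_setT card_imset //; apply: can_inj phiK.
  by move=> _; rewrite /blowup imset_comp.
exists (fun B : {set V'} => psi @: B) => B _.
  by rewrite -imset_comp (eq_imset _ phiK) imset_id.
by rewrite -imset_comp (eq_imset _ psiK) imset_id.
Qed.

Lemma pi_max_ge (U : finType) (P : pattern U) (V : finType) (f : V -> U) :
  (edge_prod (blowup P f) [set: V] <= pi_max P #|V|)%N.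
Proof.
rewrite (edge_prod_reindex P f (phi := @enum_val _ V)); last first.
  by exists enum_rank; [exact: enum_valK | exact: enum_rankK].
pose g := [ffun i => (f \o @enum_val _ V) i].
apply: (@leq_trans (edge_prod (blowup P g) [set: 'I_#|V|])).
  rewrite leq_eqVlt; apply/orP; left; apply/eqP; apply: eq_bigr => B _.
  by rewrite /blowup; congr (P _); apply: eq_imset => i; rewrite ffunE.
by rewrite /pi_max (leq_bigmax g).
Qed.

Lemma pi_max_attained (U : finType) (P : pattern U) (V : finType) (u0 : U) :
  exists h : {ffun V -> U}, edge_prod (blowup P h) [set: V] = pi_max P #|V|.
Proof.
have [|f ef] := @bigop.eq_bigmax {ffun 'I_#|V| -> U}
    (fun f => edge_prod (blowup P f) [set: 'I_#|V|]).
  by apply/card_gt0P; exists [ffun=> u0].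
exists [ffun v => f (enum_rank v)].
rewrite /pi_max ef (edge_prod_reindex P f (phi := @enum_rank V)); last first.
  by exists enum_val; [exact: enum_rankK | exact: enum_valK].
by apply: eq_bigr => B _; rewrite /blowup; congr (P _); apply: eq_imset => i; rewrite ffunE.
Qed.

(* For h closest to f: if neither fiber contains the other, exchanging two values
   of h brings it closer to f. *)
Lemma closest_fibers (U V : finType) (Q : {ffun V -> U} -> bool) (f : V -> U) h0 : Q h0 ->
  (forall h u v, Q h -> Q [ffun x => h (tperm u v x)]) ->
  exists2 h, Q h & forall p,
    [set v | f v == p] \subset [set v | h v == p] \/
    [set v | h v == p] \subset [set v | f v == p].
Proof.
move=> Qh0 Qperm; pose D (h : {ffun V -> U}) := #|[set v | h v != f v]|.
case: (arg_minnP D Qh0) => h Qh hmin.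
exists h => // p; case: (boolP ([set v | f v == p] \subset [set v | h v == p])); first by left.
case/subsetPn=> u; rewrite !inE => /eqP fu hu; right.
apply/subsetP=> v; rewrite !inE => /eqP hv; apply/negPn/negP=> fv.
have := hmin _ (Qperm h u v Qh); apply/negP; rewrite -ltnNge.
apply: proper_card; apply/properP; split.
  apply/subsetP=> x; rewrite !inE ffunE.
  case: tpermP => [->|->|//]; first by rewrite hv fu eqxx.
  by move=> _; rewrite hv eq_sym.
exists u; first by rewrite inE fu.
by rewrite inE ffunE tpermL hv fu eqxx.
Qed.

(** * The pattern with levels 0 and d *)

Section TuranPattern.
Variables (r0 rd d : nat).
Hypotheses (r0_gt0 : (0 < r0)%N) (rd_gt0 : (0 < rd)%N) (d_gt0 : (0 < d)%N).
Definition levels := r0 :: rcons (nseq d.-1 0%N) rd.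
Local Notation m := (sumn levels).

Lemma sumn_levels : m = (r0 + rd)%N.
Proof. by rewrite /levels /= -cats1 sumn_cat sumn_nseq /= addn0. Qed.

Lemma level0 (v : 'I_m) : (v < r0)%N -> turan_level levels v = 0%N.
Proof.
move=> lt; apply/eqP; rewrite turan_levelP //= take0 /= addn0.
exact: lt.
Qed.

Lemma level_top (v : 'I_m) : (r0 <= v)%N -> turan_level levels v = d.
Proof.
move: (nat_of_ord v) (ltn_ord v) => x; rewrite sumn_levels => ltx le.
apply/eqP; rewrite turan_levelP ?sumn_levels // /levels.
have e : d = d.-1.+1 by rewrite prednK.
have sz : size (nseq d.-1 0%N) = d.-1 by rewrite size_nseq.
rewrite /= size_rcons sz -e ltnSn /=.
rewrite {1}e /= -cats1 take_cat sz ltnn subnn take0 cats0 sumn_nseq mul0n addn0.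
rewrite ltnS le /= take_oversize; last by rewrite size_cat sz /= addn1 -e.
by rewrite sumn_cat sumn_nseq /= !addn0 add0n.
Qed.

Lemma turan_pattern_defic a (p q : 'I_m) : (d < a)%N ->
  @turan_pattern levels a [set p; q] = (a.+1 - defic d r0 p q)%N.
Proof.
move=> lt; have key (u : 'I_m) : turan_level levels u = if (u < r0)%N then 0%N else d.
  by case: ltnP => [/level0|/level_top].
rewrite /defic; case: (eqVneq p q) => [->|ne].
  rewrite setUid turan_pattern_loop key; case: ifP => _; first by rewrite subn0 subn1.
  by rewrite subSS.
have aux (u v : 'I_m) : (u < v)%N ->
    @turan_pattern levels a [set u; v] = (a.+1 - (if (u < r0)%N || (v < r0)%N then 0 else d))%N.
  move=> ltuv; rewrite turan_pattern_pair // key.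
  case: (ltnP u r0) => [_|le] /=; first by rewrite !subn0 addn1.
  by rewrite ltnNge (leq_trans le (ltnW ltuv)) /= addn1 subSn // ltnW.
have : (p < q)%N || (q < p)%N by rewrite -neq_ltn.
case/orP=> lt'; first exact: aux.
by rewrite setUC aux // orbC.
Qed.

(** Twice the deficiency is the sum of n (n - 1) over the parts plus d Y (Y - 1), with Y vertices at
    level d. Level 0 parts use (n - th) (n - th - 1) >= 0, level d [dualB_blowup]. *)
Lemma blowup_dual (V : finType) (f : V -> 'I_m) th :
  (2 * th * #|V| <= \sum_u \sum_(v | v != u) defic d r0 (f u) (f v) +
     r0 * th * th.+1 + 2 * dualB rd d th)%N.
Proof.
pose n p := #|[set v | f v == p]|.
pose Y := (\sum_(p : 'I_m | (r0 <= p)%N) n p)%N.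
have cV : (#|V| = \sum_(p : 'I_m) n p)%N.
  rewrite -sum1_card (partition_big f xpredT) //=; apply: eq_bigr => p _.
  by rewrite /n -sum1_card; apply: eq_bigl => v; rewrite inE.
have cY : (\sum_(v | (r0 <= f v)%N) 1 = Y)%N.
  rewrite (partition_big f (fun p : 'I_m => r0 <= p)%N) //=; apply: eq_bigr => p le.
  rewrite /n -sum1_card; apply: eq_bigl => v; rewrite inE andb_idl //.
  by move=> /eqP->.
have deg u : (\sum_(v | v != u) defic d r0 (f u) (f v) =
    (n (f u)).-1 + (if f u < r0 then 0 else d * Y.-1))%N.
  have cn : ((n (f u)).-1 = \sum_(v | v != u) (f v == f u))%N.
    have -> : n (f u) = (\sum_v (f v == f u))%N.
      by rewrite /n -sum1_card big_mkcond; apply: eq_bigr => v _; rewrite inE; case: ifP.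
    by rewrite (bigD1 u) //= eqxx.
  case: (ltnP (f u) r0) => [lt|le].
    rewrite addn0 cn; apply: eq_bigr => v _.
    by rewrite /defic eq_sym lt /=; case: eqP.
  have -> : (Y.-1 = \sum_(v | v != u) (r0 <= f v))%N.
    by rewrite -cY big_mkcond (bigD1 u) //= le /=; apply: eq_bigr => v _; case: ifP.
  rewrite cn big_distrr -big_split; apply: eq_bigr => v _ /=.
  rewrite /defic eq_sym; case: eqP => [->|_]; first by rewrite ltnNge le /= muln1.
  by rewrite (ltnNge (f u)) le add0n /= ltnNge; case: (r0 <= _)%N; rewrite ?muln1 ?muln0.
have -> : (\sum_u \sum_(v | v != u) defic d r0 (f u) (f v) =
    \sum_(p : 'I_m) n p * (n p).-1 + d * Y * Y.-1)%N.
  under eq_bigr do rewrite deg.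
  rewrite big_split /=; congr (_ + _)%N.
    rewrite (partition_big f xpredT) //=; apply: eq_bigr => p _.
    rewrite (eq_bigr (fun=> (n p).-1)) => [|v /eqP->//].
    by rewrite sum_nat_const; congr (_ * _)%N; apply: eq_card => v; rewrite !inE.
  transitivity (\sum_(u | (r0 <= f u)%N) d * Y.-1)%N.
    by rewrite [RHS]big_mkcond /=; apply: eq_bigr => u _; rewrite ltnNge; case: (r0 <= f u)%N.
  by rewrite -mulnA mulnCA mulnC -cY big_distrl /=; apply: eq_bigr => u _; rewrite mul1n.
have split (F : nat -> nat) : (\sum_(p : 'I_m) F p =
    \sum_(i < r0) F i + \sum_(j < rd) F (r0 + j)%N)%N.
  by rewrite sumn_levels big_split_ord.
(* Extended by 0 to all of [nat], so that sums over positions split into the two levels. *)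
pose nn i := if insub i is Some p then n p else 0%N.
have nnE (p : 'I_m) : nn p = n p by rewrite /nn valK.
have eqY : Y = (\sum_(j < rd) nn (r0 + j))%N.
  transitivity (\sum_(p : 'I_m) if (r0 <= p)%N then nn p else 0)%N.
    by rewrite /Y big_mkcond; apply: eq_bigr => p _; rewrite nnE.
  rewrite (split (fun i => if (r0 <= i)%N then nn i else 0%N)).
  rewrite [X in (X + _)%N]big1 => [|i _]; last by rewrite leqNgt ltn_ord.
  by rewrite add0n; apply: eq_bigr => j _; rewrite leq_addr.
have e1 : (\sum_(p : 'I_m) n p = \sum_(i < r0) nn i + \sum_(j < rd) nn (r0 + j))%N.
  by rewrite -split; apply: eq_bigr => p _; rewrite nnE.
have e2 : (\sum_(p : 'I_m) n p * (n p).-1 = \sum_(i < r0) nn i * (nn i).-1 +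
    \sum_(j < rd) nn (r0 + j) * (nn (r0 + j)).-1)%N.
  by rewrite -(split (fun i => nn i * (nn i).-1)%N); apply: eq_bigr => p _; rewrite nnE.
have := dualB_blowup rd_gt0 d_gt0 (fun j : 'I_rd => nn (r0 + j)%N) th (card_ord rd).
rewrite -eqY cV e1 e2 -eqY.
have : (2 * th * (\sum_(i < r0) nn i) <= \sum_(i < r0) nn i * (nn i).-1 + r0 * th * th.+1)%N.
  have -> : (r0 * th * th.+1 = \sum_(i < r0) th * th.+1)%N.
    by rewrite sum_nat_const card_ord mulnA.
  rewrite big_distrr -big_split; apply: leq_sum => i _ /=.
  case: (nn i) => [|k]; first by rewrite muln0.
  by case: (leqP th k) => [/subnK <-|/subnK <-]; move: (_ - _)%N => j /=; clear; lia.
move: (\sum_(i < r0) nn i)%N (\sum_(i < r0) _)%N (\sum_(j < rd) _)%N => S1 S2 S3.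
clear; lia.
Qed.
End TuranPattern.

Lemma nat_large (R : realType) (A x : R) : 0 < x ->
  exists N : nat, forall n, (N <= n)%N -> A <= x * n%:R.
Proof.
move=> x_gt0; exists (Num.bound (`|A| / x)) => n le.
rewrite mulrC -ler_pdivrMr //; apply: (le_trans (y := `|A| / x)).
  by rewrite ler_wpM2r ?invr_ge0 ?(ltW x_gt0) ?ler_norm.
apply: le_trans (_ : (Num.bound (`|A| / x))%:R <= _); last by rewrite ler_nat.
by apply/ltW/archi_boundP; rewrite divr_ge0 // ltW.
Qed.

(** I + 1 / K decreases in K; this allows replacing K by a positive value. *)
Lemma bounded_degS (V : finType) (c : V -> V -> nat) rd d K r W :
  bounded_deg c rd d K.+1 r W -> bounded_deg c rd d K r W.
Proof.
move=> bd v vW; have := bd v vW.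
move: (deg c v W) (#|W|) (lvl rd d) (r * lvl rd d + rd)%N => D n J M h.
rewrite -(leq_pmul2l (ltn0Sn K)).
apply: (@leq_trans (K * ((K.+1 * J + 1) * n))%N).
  by have := leq_mul (leqnn K) h; rewrite !mulnA [(K.+1 * K)%N]mulnC.
clear; nia.
Qed.

(** * From multigraphs to loss matrices *)

Section Multigraph.
Variables (R : realType) (a : nat).
Hypothesis a_gt0 : (0 < a)%N.
Variables (V : finType).
Implicit Types (G : multigraph V) (u v : V).

(* The diagonal value makes the diagonal losses and deficiencies vanish. *)
Definition wmat G u v := if u == v then a.+1 else G [set u; v].

Lemma wmat_sym G u v : wmat G u v = wmat G v u.
Proof. by rewrite /wmat eq_sym setUC. Qed.

Lemma wmat_diag G u : wmat G u u = a.+1.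
Proof. by rewrite /wmat eqxx. Qed.

Lemma sum_pairs_nat G (X : {set V}) :
  (\sum_(u in X) \sum_(v in X | v != u) G [set u; v] = 2 * edge_sum G X)%N.
Proof. by rewrite mul2n -addnn; exact: (@sum_pairs nat V X G). Qed.

Lemma dsum_wmat G (X : {set V}) :
  dsum (wmat G) X = (a.+1 * #|X| + 2 * edge_sum G X)%N.
Proof.
rewrite -sum_pairs_nat mulnC -sum_nat_const -big_split; apply: eq_bigr => u uX /=.
rewrite /deg (bigD1 u) //= wmat_diag; congr (_ + _)%N; apply: eq_bigr => v /andP[_ ne].
by rewrite /wmat eq_sym (negbTE ne).
Qed.

Lemma edge_prod_pos G : (0 < edge_prod G [set: V])%N ->
  forall u v, u != v -> (0 < G [set u; v])%N.
Proof.
rewrite /edge_prod => + u v ne; rewrite (bigD1 [set u; v]) /=.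
  by rewrite muln_gt0 => /andP[].
by rewrite pairs_setT cards2 ne.
Qed.

Lemma ln_edge_prod G : (0 < edge_prod G [set: V])%N ->
  ln (edge_prod G [set: V])%:R = \sum_(B in pairs [set: V]) ln (G B)%:R :> R.
Proof.
move=> pos; have posB B : B \in pairs [set: V] -> (0 < G B)%N.
  by rewrite pairs_setT => /cards2P[u [v [ne ->]]]; apply: edge_prod_pos.
suff [] : (0 < edge_prod G [set: V])%N /\
  ln (edge_prod G [set: V])%:R = \sum_(B in pairs [set: V]) ln (G B)%:R :> R by [].
rewrite /edge_prod; elim/big_rec2: _ => [|B x y /posB G_gt0 [y_gt0 <-]].
  by rewrite ln1.
by rewrite muln_gt0 G_gt0 y_gt0 natrM lnM ?posrE ?ltr0n.
Qed.

Lemma rsum_wmat G : (0 < edge_prod G [set: V])%N ->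
  rsum (wloss R a (wmat G)) [set: V] * unit_loss R a =
  #|V|%:R * (#|V|%:R - 1) * ln a.+1%:R - 2 * ln (edge_prod G [set: V])%:R.
Proof.
move=> pos; rewrite (ln_edge_prod pos).
have u0 := unit_loss_gt0 R a_gt0.
have e1 : rsum (wloss R a (wmat G)) [set: V] =
    \sum_(u in [set: V]) \sum_(v in [set: V] | v != u) loss R a (G [set u; v]).
  apply: eq_bigr => u _; rewrite /rdeg (bigD1 u) //= /wloss wmat_diag loss_top add0r.
  by apply: eq_bigr => v /andP[_ ne]; rewrite /wmat eq_sym (negbTE ne).
have e2 : \sum_(u in [set: V]) \sum_(v in [set: V] | v != u) (ln a.+1%:R : R) =
    #|V|%:R * (#|V|%:R - 1) * ln a.+1%:R.
  have h u : \sum_(v in [set: V] | v != u) (ln a.+1%:R : R) = (#|V|%:R - 1) * ln a.+1%:R.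
    have : \sum_(v in [set: V]) (ln a.+1%:R : R) = #|V|%:R * ln a.+1%:R.
      by rewrite sumr_const cardsT mulr_natl.
    by rewrite (bigD1 u) //= mulrBl mul1r => <-; rewrite addrC addrK.
  by rewrite (eq_bigr _ (fun u _ => h u)) sumr_const cardsT -mulrA mulr_natl.
rewrite e1 (sum_pairs _ (fun B => loss R a (G B))) -e2.
rewrite (sum_pairs _ (fun=> ln a.+1%:R)) !mulr2n mulrDl.
have -> : (\sum_(B in pairs [set: V]) loss R a (G B)) * unit_loss R a =
    \sum_(B in pairs [set: V]) ln a.+1%:R - \sum_(B in pairs [set: V]) ln (G B)%:R.
  rewrite mulr_suml -sumrB; apply: eq_bigr => B _.
  by rewrite /loss divfK // lt0r_neq0.
ring.
Qed.

(** Extend the pair to an s-set. This is crude, but affects only errors of lower order. *)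
Lemma weight_le s q G : sq_graph s q G -> (1 < s)%N -> (s <= #|V|)%N ->
  forall u v, u != v -> (G [set u; v] <= q)%N.
Proof.
move=> sq s2 sV u v ne; have c2 : #|[set u; v]| = 2%N by rewrite cards2 ne.
have [|X XC cX] := @subset_of_card V (~: [set u; v]) (s - 2).
  by rewrite cardsCs setCK c2 leq_sub2r.
have cY : #|[set u; v] :|: X| = s.
  rewrite cardsU c2 cX; have -> : [set u; v] :&: X = set0.
    apply/setP=> x; rewrite in_setI in_set0; apply/negP=> /andP[xu /(subsetP XC)].
    by rewrite in_setC xu.
  by rewrite cards0 subn0 subnKC.
apply: leq_trans (sq _ cY); rewrite /edge_sum (bigD1 [set u; v]) ?leq_addr //=.
by rewrite inE subsetUl c2.
Qed.

Lemma edit_distance2 G1 G2 : (edit_distance G1 G2)%:R * 2 =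
  \sum_(u in [set: V]) \sum_(v in [set: V] | v != u)
     (G1 [set u; v] != G2 [set u; v])%:R :> R.
Proof.
rewrite (sum_pairs _ (fun B => (G1 B != G2 B)%:R)) mulr_natr; congr (_ *+ 2).
rewrite /edit_distance -sum1_card natr_sum [RHS]big_mkcond /=.
rewrite (eq_bigl (fun B => (B \in pairs [set: V]) && (G1 B != G2 B))).
  by rewrite big_mkcondr /= -big_mkcond; apply: eq_bigr => B _; case: ifP.
by move=> B; rewrite inE.
Qed.
End Multigraph.

Section Blowups.
Variables (R : realType) (r0 rd d a : nat).
Hypotheses (r0_gt0 : (0 < r0)%N) (rd_gt0 : (0 < rd)%N) (d_gt0 : (0 < d)%N).
Hypothesis lt_da : (d < a)%N.
Local Notation levels := (levels r0 rd d).
Local Notation m := (sumn levels).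
Local Notation T := (@turan_pattern levels a).
Local Notation gam := (@gam R r0 d m a).
Local Notation lam := (lam R r0 rd d a).
Local Notation L := (ln a.+1%:R : R).
Let a_gt0 : (0 < a)%N := leq_ltn_trans (leq0n d) lt_da.
Let em : m = (r0 + rd)%N := sumn_levels r0 rd d.

Lemma defic_le (p q : 'I_m) : (defic d r0 p q <= a)%N.
Proof.
rewrite /defic; case: ifP => _; case: ifP => _ //; exact: ltnW.
Qed.

Let m_gt0 : (0 < m)%N.
Proof. by rewrite em addn_gt0 r0_gt0. Qed.
Let u0 : 'I_m := Ordinal m_gt0.

Lemma wmat_blowup (V : finType) (f : V -> 'I_m) u v : u != v ->
  wmat a (blowup T f) u v = (a.+1 - defic d r0 (f u) (f v))%N.
Proof. by move=> ne; rewrite /wmat (negbTE ne) blowup2 turan_pattern_defic. Qed.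

Lemma blowup_pos (V : finType) (f : V -> 'I_m) : (0 < edge_prod (blowup T f) [set: V])%N.
Proof.
rewrite /edge_prod; apply: prodn_cond_gt0 => B; rewrite pairs_setT => /cards2P[u [v [ne ->]]].
by rewrite blowup2 turan_pattern_defic // subn_gt0 ltnS defic_le.
Qed.

Lemma rsum_blowup (V : finType) (f : V -> 'I_m) :
  rsum (wloss R a (wmat a (blowup T f))) [set: V] = rsum (bloss gam f) [set: V].
Proof.
apply: eq_bigr => u _; apply: eq_bigr => v _; rewrite /wloss /bloss.
case: eqVneq => [->|ne]; first by rewrite wmat_diag loss_top.
by rewrite wmat_blowup.
Qed.

Lemma sq_wcons (V : finType) (G : multigraph V) s : sq_graph s (sigma_max T s) G ->
  wcons r0 rd d a (wmat a G) s [set: V].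
Proof.
move=> sq X _ cX th; rewrite dsum_wmat cX.
have [|f ef] := @bigop.eq_bigmax {ffun 'I_s -> 'I_m} (fun f => edge_sum (blowup T f) [set: 'I_s]).
  by apply/card_gt0P; exists [ffun=> u0].
have leX : (edge_sum G X <= edge_sum (blowup T f) [set: 'I_s])%N by rewrite -ef; exact: sq.
have := blowup_dual rd_gt0 d_gt0 f th; rewrite card_ord.
have : (dsum (wmat a (blowup T f)) [set: 'I_s] +
    \sum_u \sum_(v | v != u) defic d r0 (f u) (f v) = a.+1 * s * s)%N.
  have -> : (a.+1 * s * s = \sum_(u : 'I_s) \sum_(v : 'I_s) a.+1)%N.
    by under eq_bigr do rewrite sum_nat_const card_ord; rewrite sum_nat_const card_ord; clear; lia.
  rewrite /dsum (eq_bigl xpredT) => [|u]; last by rewrite inE.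
  rewrite -big_split; apply: eq_bigr => u _ /=.
  rewrite /deg (eq_bigl xpredT) => [|v]; last by rewrite inE.
  rewrite (bigD1 u) //= [RHS](bigD1 u) //= wmat_diag -addnA; congr (_ + _)%N.
  rewrite -big_split; apply: eq_bigr => v ne /=.
  by rewrite wmat_blowup 1?eq_sym // subnK // leqW // defic_le.
rewrite dsum_wmat cardsT card_ord.
move: leX; move: (\sum_u _)%N (edge_sum _ _) (edge_sum _ _) (dualB _ _ _) => S1 S2 S3 D.
clear; lia.
Qed.

(** Maximal product means minimal loss, which the blow-up from [greedy] bounds. *)
Lemma optimal_rsum (V : finType) (h : V -> 'I_m) :
  edge_prod (blowup T h) [set: V] = pi_max T #|V| ->
  0 <= rsum (bloss gam h) [set: V] <= lam * (#|V|%:R * (#|V|%:R - 1)).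
Proof.
move=> opt; apply/andP; split.
  apply: sumr_ge0 => u _; apply: sumr_ge0 => v _; rewrite /bloss; case: ifP => // _.
  rewrite /gam; have := gap_le R a_gt0 (j := 0) (k := defic d r0 (h u) (h v)).
  by rewrite gap0 add0r subn0 defic_le => /(_ isT); apply: le_trans.
have z_ge0 p : 0 <= zvec R r0 rd d a (m := m) p by apply/ltW/zvec_gt0.
have [f hf] := greedy (gam_sym R r0 d a) (gam_zvec R rd_gt0 em lt_da)
   (zvec_sum R rd_gt0 em lt_da) z_ge0 u0 [set: V].
rewrite cardsT in hf; apply: le_trans hf.
have u0' := unit_loss_gt0 R a_gt0.
rewrite -(ler_pM2r u0') -!rsum_blowup !rsum_wmat ?blowup_pos // lerD2l lerN2 ler_pM2l //.
rewrite ler_ln ?posrE ?ltr0n ?blowup_pos // ler_nat opt.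
exact: pi_max_ge.
Qed.

(** The exponent costs delta times the logarithm of the maximum, and the latter is at most n (n - 1)
    L / 2 since the losses in the optimal blow-up are nonnegative. *)
Lemma near_optimal_rsum (V : finType) (G : multigraph V) (delta : R) : 0 <= delta ->
  (pi_max T #|V|)%:R `^ (1 - delta) <= (edge_prod G [set: V])%:R :> R ->
  (0 < edge_prod G [set: V])%N /\
  rsum (wloss R a (wmat a G)) [set: V] <=
    (lam + delta * L / unit_loss R a) * #|V|%:R ^+ 2.
Proof.
move=> delta_ge0 le; have [h opt] := pi_max_attained T V u0.
have pi_gt0 : 0 < (pi_max T #|V|)%:R :> R by rewrite -opt ltr0n blowup_pos.
have pos : (0 < edge_prod G [set: V])%N.
  by rewrite -(ltr0n R); apply: lt_le_trans le; apply: powR_gt0.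
split=> //; have u1 := unit_loss_gt0 R a_gt0.
have /andP[h0 h1] := optimal_rsum opt.
have e := rsum_wmat R a_gt0 (blowup_pos h); rewrite rsum_blowup opt in e.
have : ln ((pi_max T #|V|)%:R `^ (1 - delta)) <= ln (edge_prod G [set: V])%:R :> R.
  by rewrite ler_ln // posrE ?ltr0n // powR_gt0.
rewrite ln_powR => hln.
rewrite -(ler_pM2r u1) (rsum_wmat R a_gt0 pos).
have lam0 : 0 < lam by exact: lam_gt0.
have L0 : 0 <= L by rewrite ln_ge0 // ler1n.
have n0 := ler0n R #|V|.
have -> : (lam + delta * L / unit_loss R a) * #|V|%:R ^+ 2 * unit_loss R a =
    (lam * unit_loss R a + delta * L) * #|V|%:R ^+ 2.
  by field; rewrite lt0r_neq0.
set n : R := #|V|%:R in h1 e n0 *; set lP := ln (pi_max _ _)%:R in e hln *.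
set lG := ln (edge_prod _ _)%:R in hln *.
have i0 : 0 <= rsum (bloss gam h) [set: V] * unit_loss R a by rewrite mulr_ge0 // ltW.
have i1 : rsum (bloss gam h) [set: V] * unit_loss R a <= lam * (n * (n - 1)) * unit_loss R a.
  by rewrite ler_pM2r.
have i2 : delta * (2 * lP) <= delta * (n * (n - 1) * L) by rewrite ler_wpM2l //; lra.
have i3 : 0 <= n * (delta * L) by rewrite !mulr_ge0.
have i4 : 0 <= n * (lam * unit_loss R a) by rewrite mulr_ge0 // mulr_ge0 // ltW.
move: e i0 i1 i2 i3 i4 hln.
move: (rsum _ _) (unit_loss R a) L lam => S w l k; clear; nra.
Qed.
End Blowups.

(** * Comparison with an optimal blow-up *)

Section Compare.
Variables (R : realType) (r0 rd d a : nat).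
Hypotheses (r0_gt0 : (0 < r0)%N) (rd_gt0 : (0 < rd)%N) (d_gt0 : (0 < d)%N).
Hypothesis lt_da : (d < a)%N.
Local Notation levels := (levels r0 rd d).
Local Notation m := (sumn levels).
Local Notation T := (@turan_pattern levels a).
Local Notation gam := (@gam R r0 d m a).
Local Notation lam := (lam R r0 rd d a).
Local Notation zvec := (@zvec R r0 rd d m a).
Let a_gt0 : (0 < a)%N := leq_ltn_trans (leq0n d) lt_da.
Let em : m = (r0 + rd)%N := sumn_levels r0 rd d.
Variable V : finType.
Local Notation n := (#|V|%:R : R).

(** The loss is at most lam n (n - 1), and at least lam n^2 plus the squared deviations minus
    O(n). *)
Lemma optimal_fibers (h : V -> 'I_m) (e : R) : 0 <= e ->
  edge_prod (blowup T h) [set: V] = pi_max T #|V| ->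
  gap R a d.+1 <= e ^+ 2 * n ->
  forall p, `|#|[set v | h v == p]|%:R - zvec p * n| <= e * n.
Proof.
move=> e0 opt n_gap p.
have /andP[_ h1] := optimal_rsum R r0_gt0 rd_gt0 d_gt0 lt_da opt.
have := rsum_bloss_lower (gam_sym R r0 d a) (gam_zvec R rd_gt0 em lt_da)
    (zvec_sum R rd_gt0 em lt_da) (gam_PD r0 lt_da) h [set: V] (gam_diag R r0 (m := m) lt_da).
rewrite cardsT => h2.
have n0 : 0 <= n by exact: ler0n.
have lam0 : 0 < lam by exact: lam_gt0.
have h3 : (#|[set v | h v == p]|%:R - zvec p * n) ^+ 2 <= (e * n) ^+ 2.
  apply: (le_trans (y := \sum_p (#|[set v in [set: V] | h v == p]|%:R - zvec p * n) ^+ 2)).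
    rewrite (bigD1 p) //= -[X in X <= _]addr0 lerD ?sumr_ge0 // => [|q _]; last exact: sqr_ge0.
    by rewrite le_eqVlt; apply/orP; left; apply/eqP; congr ((_%:R - _) ^+ 2);
       apply: eq_card => v; rewrite !inE.
  have h4 : gap R a d.+1 * n <= e ^+ 2 * n * n by rewrite ler_wpM2r.
  have h5 : 0 <= lam * n by rewrite mulr_ge0 // ltW.
  rewrite exprMn expr2 [n ^+ 2]expr2 !mulrA -expr2.
  move: h1 h2 h4; rewrite !mulrBr !mulr1 expr2; lra.
have e_n : 0 <= e * n by rewrite mulr_ge0.
by rewrite -ler_sqr ?nnegrE // real_normK ?num_real.
Qed.

Lemma diff_card (f h : V -> 'I_m) (x : R) :
  (forall p, [set v | f v == p] \subset [set v | h v == p] \/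
    [set v | h v == p] \subset [set v | f v == p]) ->
  (forall p, `|#|[set v | f v == p]|%:R - #|[set v | h v == p]|%:R| <= x) ->
  #|[set v | h v != f v]|%:R <= m%:R * x.
Proof.
move=> nested close.
have -> : #|[set v | h v != f v]|%:R =
    \sum_(p : 'I_m) #|[set v | f v == p] :\: [set v | h v == p]|%:R :> R.
  rewrite -natr_sum; congr (_%:R); rewrite -sum1_card (partition_big f xpredT) //=.
  apply: eq_bigr => p _; rewrite -sum1_card; apply: eq_bigl => v; rewrite !inE.
  by case: (eqVneq (f v) p) => [->|]; rewrite ?andbF ?andbT.
have -> : m%:R * x = \sum_(p : 'I_m) x by rewrite sumr_const card_ord mulr_natl.
apply: ler_sum => p _; apply: le_trans (close p).
case: (nested p) => sub.
  by rewrite (eqP (_ : _ :\: _ == set0)) ?cards0 ?normr_ge0 // setD_eq0.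
by rewrite cardsD (setIidPr sub) natrB ?subset_leq_card // ler_norm.
Qed.

(** A pair on which the two multigraphs differ is wrong for f or has an end where h differs from
    f. *)
Lemma edit_distance_le (G : multigraph V) (f h : V -> 'I_m) :
  2 * (edit_distance G (blowup T h))%:R <=
  rsum (@edit R r0 d a m V (wmat a G) f) [set: V] + 2 * (n * #|[set v | h v != f v]|%:R).
Proof.
rewrite mulrC edit_distance2.
pose b v : R := (h v != f v)%:R.
have sb : \sum_(v in [set: V]) b v = #|[set v | h v != f v]|%:R.
  rewrite -sum1_card natr_sum [RHS]big_mkcond /=; apply: eq_big => v; rewrite inE //.
  by rewrite /b => _; case: ifP.
have -> : 2 * (n * #|[set v | h v != f v]|%:R) =
    \sum_(u in [set: V]) \sum_(v in [set: V]) (b u + b v).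
  have e1 u : \sum_(v in [set: V]) (b u + b v) = n * b u + #|[set v | h v != f v]|%:R.
    by rewrite big_split sumr_const cardsT mulr_natl sb.
  rewrite (eq_bigr _ (fun u _ => e1 u)) big_split -mulr_sumr sb sumr_const cardsT /=.
  by rewrite -[X in _ = _ + X]mulr_natl; ring.
rewrite -big_split; apply: ler_sum => u _.
rewrite /rdeg -big_split [X in X <= _]big_mkcondr /=; apply: ler_sum => v _.
have edit0 : 0 <= edit R r0 d a (wmat a G) f u v by rewrite /edit ler0n.
have b0 x : 0 <= b x by rewrite ler0n.
case: ifP => [ne|_]; last by rewrite addr_ge0 ?addr_ge0.
have ne' : u != v by rewrite eq_sym.
case: eqP => [_|neq] /=; first by rewrite addr_ge0 ?addr_ge0.
rewrite /b; case: (eqVneq (h u) (f u)) => [eu|_] /=; last first.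
  by rewrite -[X in X <= _]addr0 addrCA lerD ?addr_ge0.
case: (eqVneq (h v) (f v)) => [ev|_] /=; last by rewrite add0r lerDr.
rewrite !addr0 /edit ne' /= {1}/wmat (negbTE ne').
case: eqP => // e; case: neq.
by rewrite e blowup2 turan_pattern_defic // eu ev.
Qed.
End Compare.

Theorem theorem1p17 (R : realType) (r0 rd d s : nat) :
  (0 < r0)%N -> (0 < rd)%N -> (0 < d)%N ->
  (r0 * (d * rd + 1) + rd + 1 <= s)%N ->
  exists a0 : nat, forall a : nat, (a0 <= a)%N ->
    let T := @turan_pattern (r0 :: rcons (nseq d.-1 0%N) rd) a in
    let q := sigma_max T s in
    forall eps : R, 0 < eps ->
    exists (delta : R) (n0 : nat), 0 < delta /\
      forall (V : finType) (G : multigraph V),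
        (n0 <= #|V|)%N -> sq_graph s q G ->
        (pi_max T #|V|)%:R `^ (1 - delta) <= (edge_prod G [set: V])%:R :> R ->
        exists Gstar : multigraph V,
          [/\ is_blowup T Gstar,
              edge_prod Gstar [set: V] = pi_max T #|V| &
              (edit_distance G Gstar)%:R <= eps * #|V|%:R ^+ 2].
Proof.
move=> r0_gt0 rd_gt0 d_gt0 le_s.
(* [t] must be fixed before [a]: the requirement 2 G d <= t will follow from G <= I + 1. *)
pose I := lvl rd d; pose M := (r0 * I + rd)%N; pose t := (2 * I.+1 * d)%N.
have I_gt0 : (0 < I)%N := lvl_gt0 rd d.
have M_gt0 : (0 < M)%N by rewrite addn_gt0 rd_gt0 orbT.
have s_gt0 : (0 < s)%N by apply: leq_trans le_s; rewrite addn1.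
have le_t : (I <= t)%N.
  apply: leq_trans (leq_pmulr _ d_gt0); apply: leq_trans (leqnSn I) _; exact: leq_pmull.
have [K' [nf find]] := find_skeleton rd_gt0 d_gt0 r0 le_t.
pose K := K'.+1.
have x_gt0 : 0 < (2 * M%:R * s%:R)^-1 :> R by rewrite invr_gt0 !mulr_gt0 ?ltr0n.
have y_gt0 : 0 < (K%:R * M%:R)^-1 :> R by rewrite invr_gt0 !mulr_gt0 ?ltr0n.
(* Halved, so that the excess of [lam] over I / M and the pruning threshold together stay within
   both tolerances; the 1 serves [le_t2]. *)
pose eta0 : R := Num.min 1 (Num.min (2 * M%:R * s%:R)^-1 (K%:R * M%:R)^-1) / 2.
have eta0_gt0 : 0 < eta0 by rewrite divr_gt0 // !lt_min ltr01 x_gt0 y_gt0.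
have [a1 ha1] := bigG_lim d rd_gt0 eta0_gt0.
exists (a1 + d.+1)%N => a le_a T q eps eps_gt0.
have lt_da : (d < a)%N by apply: leq_trans le_a; rewrite leq_addl.
have a_gt0 : (0 < a)%N by apply: leq_ltn_trans lt_da.
have hG : bigG R rd d a <= I%:R + eta0 by apply: ha1; apply: leq_trans le_a; rewrite leq_addr.
have eta0_1 : eta0 <= 1 / 2 by rewrite ler_pM2r ?invr_gt0 // ge_min lexx.
have eta0_x : 2 * eta0 <= (2 * M%:R * s%:R)^-1.
  by rewrite /eta0 mulrC divfK ?pnatr_eq0 // !ge_min lexx orbT.
have eta0_y : 2 * eta0 <= (K%:R * M%:R)^-1.
  by rewrite /eta0 mulrC divfK ?pnatr_eq0 // !ge_min lexx !orbT.
pose la := lam R r0 rd d a.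
have la_le : la <= I%:R / M%:R + eta0.
  by apply: le_trans (lam_upper R r0 rd_gt0 lt_da) _; rewrite lerD2l lerBlDl.
have lam_s : la + eta0 <= I%:R / M%:R + (2 * M%:R * s%:R)^-1 by lra.
have lam_K : la + eta0 <= I%:R / M%:R + (K%:R * M%:R)^-1 by lra.
have le_t2 : 2 * bigG R rd d a * d%:R <= t%:R.
  rewrite /t !natrM ler_wpM2r // ler_pM2l // -natr1; lra.
pose m := sumn (levels r0 rd d); have em : m = (r0 + rd)%N := sumn_levels r0 rd d.
(* There will be 3 e n^2 wrong pairs (6 e in ordered count), and part sizes off by 4 e n for f and e
   n for the optimum, hence at most 5 m e n vertices where the two differ. *)
pose e : R := Num.min 1 (eps / (3 + 5 * m%:R)).
have D0 : 0 < 3 + 5 * m%:R :> R by rewrite ltr_wpDr // mulr_ge0.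
have e_gt0 : 0 < e by rewrite lt_min ltr01 divr_gt0.
have e_le1 : e <= 1 by rewrite ge_min lexx.
have e_eps : (3 + 5 * m%:R) * e <= eps.
  by rewrite mulrC -ler_pdivlMr // ge_min lexx orbT.
pose kap := kappa R r0 rd d a t.
have kap_gt0 : 0 < kap by apply: kappa_gt0.
have e2_gt0 : 0 < e ^+ 2 by rewrite exprn_gt0.
have e4_gt0 : 0 < e ^+ 2 / 4 by rewrite divr_gt0.
have e8_gt0 : 0 < e ^+ 2 / 8 by rewrite divr_gt0.
pose eta := Num.min eta0 (Num.min (kap * (e ^+ 2 / 4)) (e ^+ 2)).
have eta_gt0 : 0 < eta by rewrite !lt_min eta0_gt0 e2_gt0 mulr_gt0.
have eta_1 : eta <= eta0 by rewrite ge_min lexx.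
have eta_2 : eta <= kap * (e ^+ 2 / 4) by rewrite !ge_min lexx orbT.
have eta_3 : eta <= e ^+ 2 by rewrite !ge_min lexx !orbT.
have u_gt0 := unit_loss_gt0 R a_gt0.
have L_gt0 : 0 < ln a.+1%:R :> R by rewrite ln_gt0 // ltr1n.
(* Makes the excess loss density in [near_optimal_rsum] equal to eta e^2 / 8. *)
pose delta := eta * (e ^+ 2 / 8) * unit_loss R a / ln a.+1%:R.
have delta_gt0 : 0 < delta by rewrite !mulr_gt0 // ?invr_gt0.
have dE : delta * ln a.+1%:R / unit_loss R a = eta * (e ^+ 2 / 8).
  by rewrite divfK ?lt0r_neq0 // mulfK ?lt0r_neq0.
pose q' := (a.+1 + q)%N.
pose sz := big_size r0 rd d s q' nf.
have [N1 hN1] := nat_large (2 * slack R r0 rd d s q' m t nf) (mulr_gt0 eta_gt0 e8_gt0).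
have [N2 hN2] := nat_large ((m * t)%:R) (mulr_gt0 kap_gt0 e4_gt0).
have [N3 hN3] := nat_large ((m * t)%:R) e4_gt0.
have [N4 hN4] := nat_large (gap R a d.+1) e2_gt0.
exists delta, (s + 2 * sz + N1 + N2 + N3 + N4)%N; split=> // V G leV sq leP.
have s2 : (1 < s)%N.
  apply: leq_trans le_s; rewrite addn1 ltnS.
  by apply: leq_trans M_gt0 _.
have [pos sumG] := near_optimal_rsum r0_gt0 rd_gt0 d_gt0 lt_da (ltW delta_gt0) leP.
rewrite dE in sumG.
have leVs : (s <= #|V|)%N by move: leV; clear; lia.
pose w := wmat a G.
have wpos u v : (0 < w u v)%N.
  by rewrite /w /wmat; case: eqVneq => // ne; apply: edge_prod_pos.
have wq u v : (w u v <= q')%N.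
  rewrite /w /wmat; case: eqVneq => [_|ne]; first exact: leq_addr.
  by apply: leq_trans (weight_le sq s2 leVs ne) _; apply: leq_addl.
have find' (c : V -> V -> nat) (W : {set V}) : (forall x y, c x y = c y x) ->
  (forall x, c x x = 0%N) -> (nf <= #|W|)%N -> sparse c rd d r0 W ->
  bounded_deg c rd d K r0 W -> exists A B, skeleton c rd d r0 t W A B.
  by move=> cs c0 leW sp /bounded_degS bd; apply: (find V c W).
have cons_s := sq_wcons r0_gt0 rd_gt0 d_gt0 lt_da sq.
have [f [edit_f size_f]] : exists f : V -> 'I_m,
    rsum (edit R r0 d a w f) [set: V] <= 6 * e * #|V|%:R ^+ 2 /\
    forall p, `|#|[set v | f v == p]|%:R - zvec R r0 rd d a p * #|V|%:R| <= 4 * e * #|V|%:R.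
  apply: (stable_partition r0_gt0 rd_gt0 d_gt0 em lt_da le_s le_t le_t2 eta0_gt0
     (ltn0Sn K') lam_s lam_K (wmat_sym a G) (wmat_diag a G) wpos wq find' cons_s
     e_gt0 e_le1 eta_gt0 eta_1 eta_2 eta_3).
  - by rewrite ler_nat; move: leV; rewrite -/sz; clear; lia.
  - by apply: hN1; move: leV; clear; lia.
  - by apply: hN2; move: leV; clear; lia.
  - by apply: hN3; move: leV; clear; lia.
  - by apply: hN4; move: leV; clear; lia.
  - exact: sumG.
have m_gt0 : (0 < m)%N by rewrite em addn_gt0 r0_gt0.
have [h0 opt0] := pi_max_attained T V (Ordinal m_gt0).
have [|h u v|h /eqP opt nested] := @closest_fibers 'I_m V
    (fun h => edge_prod (blowup T h) [set: V] == pi_max T #|V|) f h0.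
- exact/eqP.
- move=> /eqP <-; rewrite (edge_prod_reindex T h (phi := tperm u v)); last first.
    by exists (tperm u v); apply: tpermK.
  apply/eqP; apply: eq_bigr => B _; rewrite /blowup; congr (T _).
  by apply: eq_imset => x; rewrite ffunE.
exists (blowup T h); split=> //; first exact: blowupP.
have size_h : forall p, `|#|[set v | h v == p]|%:R - zvec R r0 rd d a p * #|V|%:R| <= e * #|V|%:R.
  apply: (optimal_fibers r0_gt0 rd_gt0 d_gt0 lt_da (ltW e_gt0) opt).
  by apply: hN4; move: leV; clear; lia.
have close p : `|#|[set v | f v == p]|%:R - #|[set v | h v == p]|%:R| <= 5 * e * #|V|%:R.
  have := size_f p; have := size_h p.
  rewrite !ler_norml => /andP[h1 h2] /andP[h3 h4].
  by move: h1 h2 h3 h4; clear => *; apply/andP; split; lra.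
have hD := diff_card nested close.
have hE := edit_distance_le R d_gt0 lt_da G f h.
have n0 := ler0n R #|V|.
have hn : #|V|%:R * #|[set v | h v != f v]|%:R <= #|V|%:R * (m%:R * (5 * e * #|V|%:R)).
  by rewrite ler_wpM2l.
have he : (3 + 5 * m%:R) * e * #|V|%:R ^+ 2 <= eps * #|V|%:R ^+ 2.
  by rewrite ler_wpM2r // sqr_ge0.
apply: le_trans he; rewrite -/w in hE.
move: (rsum _ _) ((edit_distance _ _)%:R : R) (#|[set v | _]|%:R : R) (#|V|%:R : R) (m%:R : R)
  edit_f hE hn => S E D n k; clear; lra.
Qed.
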